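(* Let $d\geq 1$, let $A$ be a finite-dimensional algebra over a field, let $\mathcal{M}\subseteq \operatorname{mod}A$ be a $d$-cluster tilting subcategory and let $\mathcal{U}\subseteq\mathcal{M}$ be a functorially finite $d$-torsion class. Let $M_{\mathcal{U}}$ be a basic $\operatorname{Ext}^d$-projective generator of $\mathcal{U}$ and let $P_{\mathcal{U}}$ be the maximal basic projective $A$-module with $\operatorname{Hom}_A(P_{\mathcal{U}},U)=0$ for all $U\in\mathcal{U}$. Let $P_\bullet^{M_{\mathcal{U}}}$ be the complex formed by the first $d+1$ terms (in degrees $-d,\dots,0$) of the minimal projective resolution of $M_{\mathcal{U}}$. Then $P_\bullet^{M_{\mathcal{U}}}\oplus P_{\mathcal{U}}[d]$ is a silting complex in $K^b(\operatorname{proj}A)$.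
   Context: $\operatorname{mod}A$ is the category of finitely generated right $A$-modules, and $K^b(\operatorname{proj}A)$ is the bounded homotopy category of finitely generated projectives. All subcategories are full and closed under isomorphisms, finite direct sums and direct summands. $P_{\mathcal{U}}$ is viewed as a stalk complex in degree $0$, so $P_{\mathcal{U}}[d]$ is concentrated in degree $-d$ (differentials raise degree by one). A functorially finite subcategory $\mathcal{M}\subseteq\operatorname{mod}A$ is $d$-cluster tilting if $\mathcal{M}=\{X\mid \operatorname{Ext}^i_A(X,M)=0\ \forall M\in\mathcal{M},\,1\le i\le d-1\}=\{Y\mid \operatorname{Ext}^i_A(M,Y)=0\ \forall M\in\mathcal{M},\,1\le i\le d-1\}$. A subcategory $\mathcal{U}\subseteq\mathcal{M}$ is a $d$-torsion class if for every $M\in\mathcal{M}$ there is an exact sequence $0\to U_M\to M\to V_1\to\cdots\to V_d\to 0$ in $\operatorname{mod}A$ with all terms in $\mathcal{M}$, such that $U_M\in\mathcal{U}$ and $0\to\operatorname{Hom}_A(U,V_1)\to\cdots\to\operatorname{Hom}_A(U,V_d)\to 0$ is exact for every $U\in\mathcal{U}$. $X\in\mathcal{U}$ is $\operatorname{Ext}^d$-projective in $\mathcal{U}$ if $\operatorname{Ext}^d_A(X,U)=0$ for all $U\in\mathcal{U}$; it is an $\operatorname{Ext}^d$-projective generator of $\mathcal{U}$ if moreover every $\operatorname{Ext}^d$-projective object of $\mathcal{U}$ lies in $\operatorname{add}(X)$. An object $S\in K^b(\operatorname{proj}A)$ is silting if $\operatorname{Hom}_{K^b(\operatorname{proj}A)}(S,S[i])=0$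 for all $i>0$ and the smallest thick subcategory of $K^b(\operatorname{proj}A)$ containing $S$ is $K^b(\operatorname{proj}A)$. *)

(* Defs.v *)
From HB Require Import structures.
From mathcomp Require Import all_boot all_order all_algebra all_field.

Set Implicit Arguments.
Unset Strict Implicit.
Unset Printing Implicit Defensive.

Import Order.TTheory GRing.Theory Num.Theory.
Local Open Scope ring_scope.

Definition fin_gen (R : pzRingType) (M : lmodType R) : Prop :=
  exists (n : nat) (e : 'I_n -> M),
    forall x : M, exists a : 'I_n -> R, x = \sum_(i < n) a i *: e i.

(* A right A-module is a left module over the converse ring A^c. *)
Record fgmod (k : fieldType) (A : falgType k) : Type := FGMod {
  fgmod_sort :> lmodType A^c;
  fgmod_fin_gen : fin_gen fgmod_sort
}.

Section Modules.
Context {k : fieldType} {A : falgType k}.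
Implicit Types M N P Q X Y Z : fgmod A.

Lemma fin_gen_zero : fin_gen 'rV[A^c]_0.
Proof. by exists 0, (fun=> 0) => x; exists (fun=> 0); apply/rowP; case. Qed.

Definition zeromod : fgmod A := FGMod fin_gen_zero.

Lemma fin_gen_pair M N : fin_gen (M * N)%type.
Proof.
case: (fgmod_fin_gen M) => m [e eP]; case: (fgmod_fin_gen N) => n [f fP].
exists (m + n)%N, (fun i => match split i with
                            | inl j => (e j, 0) | inr j => (0, f j) end).
case=> x y; have [a ->] := eP x; have [b ->] := fP y.
exists (fun i => match split i with inl j => a j | inr j => b j end).
rewrite big_split_ord /=.
have H1 (i : 'I_m) : split (lshift n i) = inl i by exact: (unsplitK (inl i)).
have H2 (i : 'I_n) : split (rshift m i) = inr i by exact: (unsplitK (inr i)).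
under [in RHS]eq_bigr do rewrite H1.
under [X in _ = _ + X]eq_bigr do rewrite H2.
apply: injective_projections.
- rewrite [RHS](raddfD fst) !(raddf_sum fst) /= [X in _ + X]big1 ?addr0 // => i _.
  by rewrite scaler0.
- rewrite [RHS](raddfD snd) !(raddf_sum snd) /= [X in X + _]big1 ?add0r // => i _.
  by rewrite scaler0.
Qed.

Definition dsum2 M N : fgmod A := FGMod (fin_gen_pair M N).

Definition dsum (s : seq (fgmod A)) : fgmod A := foldr dsum2 zeromod s.

Definition is_zero M : Prop := forall x : M, x = 0.

Definition iso M N : Prop := exists f : {linear M -> N}, bijective f.

Definition summand M N : Prop := exists Z, iso N (dsum2 M Z).

Definition in_add M N : Prop := exists n : nat, summand N (dsum (nseq n M)).

Definition indecomposable M : Prop :=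
  ~ is_zero M /\ forall N Z, iso M (dsum2 N Z) -> is_zero N \/ is_zero Z.

Definition basic M : Prop :=
  exists s : seq (fgmod A),
    [/\ iso M (dsum s),
        forall i : nat, (i < size s)%N -> indecomposable (nth zeromod s i)
      & forall i j : nat, (i < j < size s)%N ->
          ~ iso (nth zeromod s i) (nth zeromod s j)].

Definition surj M N (f : M -> N) : Prop := forall y, exists x, f x = y.

Definition exact_at M N Z (f : M -> N) (g : N -> Z) : Prop :=
  forall y, g y = 0 <-> exists x, f x = y.

Definition projective P : Prop :=
  forall M N (g : {linear M -> N}) (f : {linear P -> N}),
    surj g -> exists h : {linear P -> M}, forall x, g (h x) = f x.

(* The kernel of f is a superfluous submodule: S + Ker f = P only for S = P.
   For P projective, this says that P -> Im f is a projective cover. *)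
Definition superfluous_ker P N (f : P -> N) : Prop :=
  forall S : {pred P}, GRing.submod_closed S ->
    (forall x, exists2 s, s \in S & f (x - s) = 0) -> forall x, x \in S.

Definition pair_lin_fun (U V W : lmodType A^c)
  (f : {linear U -> V}) (g : {linear U -> W}) (x : U) : V * W := (f x, g x).

Lemma pair_lin_is_linear (U V W : lmodType A^c)
  (f : {linear U -> V}) (g : {linear U -> W}) : linear (pair_lin_fun f g).
Proof. by move=> a x y; rewrite /pair_lin_fun !linearP. Qed.

HB.instance Definition _ (U V W : lmodType A^c)
    (f : {linear U -> V}) (g : {linear U -> W}) :=
  GRing.isLinear.Build A^c U (V * W)%type _ (pair_lin_fun f g)
    (pair_lin_is_linear f g).

Definition pair_lin M N Z (f : {linear M -> N}) (g : {linear M -> Z}) :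
  {linear M -> dsum2 N Z} := pair_lin_fun f g.

Definition fst_lin M N : {linear dsum2 M N -> M} := fst.

Definition snd_lin M N : {linear dsum2 M N -> N} := snd.

Definition ifmod (b : bool) M : fgmod A := if b then M else zeromod.

Definition ifhom (b c : bool) M N (f : {linear M -> N}) :
    {linear ifmod b M -> ifmod c N} :=
  match b, c return {linear ifmod b M -> ifmod c N} with
  | true, true => f
  | _, _ => \0
  end.

End Modules.

(* Cochain complexes indexed by int.  The differential is a family over all
   pairs of degrees that vanishes unless j = i + 1; this avoids transports
   between X (i + 1 + n) and X (i + n + 1) in shifts and cones. *)
Record complex (k : fieldType) (A : falgType k) : Type := Complex {
  cx_obj :> int -> fgmod A;
  cx_d : forall i j : int, {linear cx_obj i -> cx_obj j};
  cx_shape : forall i j : int, j != i + 1 -> forall x, cx_d i j x = 0;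
  cx_dd : forall (i j l : int) x, cx_d j l (cx_d i j x) = 0
}.
Arguments cx_d {k A} c i j.

Record cmap (k : fieldType) (A : falgType k) (X Y : complex A) : Type := CMap {
  cmap_fun :> forall i : int, {linear X i -> Y i};
  cmap_comm : forall (i j : int) x,
    cmap_fun j (cx_d X i j x) = cx_d Y i j (cmap_fun i x)
}.

Section Complexes.
Context {k : fieldType} {A : falgType k}.
Implicit Types X Y Z S : complex A.

Section Stalk.
Variable M : fgmod A.
Definition stalk_obj (i : int) := ifmod (i == 0) M.
Definition stalk_d (i j : int) : {linear stalk_obj i -> stalk_obj j} := \0.
Lemma stalk_shape (i j : int) : j != i + 1 -> forall x, stalk_d i j x = 0.
Proof. by []. Qed.
Lemma stalk_dd (i j l : int) x : stalk_d j l (stalk_d i j x) = 0.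
Proof. by []. Qed.
Definition stalk : complex A := Complex stalk_shape stalk_dd.
End Stalk.

Section Shift.
Variables (X : complex A) (n : int).
Definition shift_obj (i : int) := X (i + n).
Definition shift_d (i j : int) : {linear shift_obj i -> shift_obj j} :=
  if odd `|n|%N then (\- cx_d X (i + n) (j + n) : {linear shift_obj i -> shift_obj j})
  else cx_d X (i + n) (j + n).
Lemma shift_shape (i j : int) : j != i + 1 -> forall x, shift_d i j x = 0.
Proof.
move=> ij x; have H : j + n != i + n + 1.
  by rewrite addrAC (inj_eq (addIr n)).
have H' : cx_d X (i + n) (j + n) x = 0 by exact: cx_shape.
by rewrite /shift_d; case: odd; rewrite //= H' oppr0.
Qed.
Lemma shift_dd (i j l : int) x : shift_d j l (shift_d i j x) = 0.
Proof.
rewrite /shift_d; case: odd => /=; last by rewrite cx_dd.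
by rewrite (linearN (cx_d X (j + n) (l + n))) cx_dd !oppr0.
Qed.
Definition shift : complex A := Complex shift_shape shift_dd.
End Shift.

Section DirectSum.
Variables X Y : complex A.
Definition cx_sum_obj (i : int) := dsum2 (X i) (Y i).
Definition cx_sum_d (i j : int) : {linear cx_sum_obj i -> cx_sum_obj j} :=
  pair_lin (cx_d X i j \o fst_lin (X i) (Y i) : {linear cx_sum_obj i -> X j})
           (cx_d Y i j \o snd_lin (X i) (Y i) : {linear cx_sum_obj i -> Y j}).
Lemma cx_sum_shape (i j : int) : j != i + 1 -> forall x, cx_sum_d i j x = 0.
Proof. by move=> ij x; rewrite /= /pair_lin_fun /= !cx_shape. Qed.
Lemma cx_sum_dd (i j l : int) x : cx_sum_d j l (cx_sum_d i j x) = 0.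
Proof. by rewrite /= /pair_lin_fun /= !cx_dd. Qed.
Definition cx_sum : complex A := Complex cx_sum_shape cx_sum_dd.
End DirectSum.

(* The brutal truncation keeping the terms in degrees >= n. *)
Section Truncation.
Variables (n : int) (X : complex A).
Definition trunc_obj (i : int) := ifmod (n <= i) (X i).
Definition trunc_d (i j : int) : {linear trunc_obj i -> trunc_obj j} := ifhom _ _ (cx_d X i j).
Lemma trunc_shape (i j : int) : j != i + 1 -> forall x, trunc_d i j x = 0.
Proof.
move=> ij; rewrite /trunc_d /trunc_obj; case: (n <= i); case: (n <= j) => //= x.
by rewrite cx_shape.
Qed.
Lemma trunc_dd (i j l : int) x : trunc_d j l (trunc_d i j x) = 0.
Proof.
move: x; rewrite /trunc_d /trunc_obj.
case: (n <= i); case: (n <= j); case: (n <= l) => //= x;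
  by rewrite ?cx_dd ?linear0.
Qed.
Definition trunc : complex A := Complex trunc_shape trunc_dd.
End Truncation.

Definition cx_cast X (i j : int) (e : i = j) : {linear X i -> X j} :=
  match e with erefl => idfun end.

(* f as a family over all pairs of degrees, zero off the diagonal *)
Definition cmap_ext X Y (f : cmap X Y) (i j : int) : {linear X i -> Y j} :=
  match i =P j with
  | ReflectT e => cx_cast Y e \o f i
  | ReflectF _ => \0
  end.

Lemma cmap_ext_diag X Y (f : cmap X Y) (i : int) x : cmap_ext f i i x = f i x.
Proof. by rewrite /cmap_ext; case: eqP => // e; rewrite (eq_axiomK e). Qed.

Lemma cmap_ext_off X Y (f : cmap X Y) (i j : int) x : i != j -> cmap_ext f i j x = 0.
Proof. by rewrite /cmap_ext; case: eqP. Qed.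

Section Cone.
Variables (X Y : complex A) (f : cmap X Y).
Definition cone_obj (i : int) := dsum2 (X (i + 1)) (Y i).
Definition cone_d (i j : int) : {linear cone_obj i -> cone_obj j} :=
  let p := fst_lin (X (i + 1)) (Y i) in
  let q := snd_lin (X (i + 1)) (Y i) in
  pair_lin (\- (cx_d X (i + 1) (j + 1) \o p) : {linear cone_obj i -> X (j + 1)})
           ((cmap_ext f (i + 1) j \o p) \+ (cx_d Y i j \o q)
              : {linear cone_obj i -> Y j}).
Lemma cone_shape (i j : int) : j != i + 1 -> forall x, cone_d i j x = 0.
Proof.
move=> ij x; rewrite /= /pair_lin_fun /=.
rewrite !cx_shape ?(inj_eq (addIr 1)) //.
by rewrite cmap_ext_off 1?eq_sym // oppr0 addr0.
Qed.
Lemma cone_dd (i j l : int) x : cone_d j l (cone_d i j x) = 0.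
Proof.
have H : cmap_ext f (j + 1) l (cx_d X (i + 1) (j + 1) x.1)
         = cx_d Y j l (cmap_ext f (i + 1) j x.1); last first.
  apply: injective_projections.
    by rewrite /= (linearN (cx_d X (j + 1) (l + 1))) cx_dd !oppr0.
  rewrite /= (linearN (cmap_ext f (j + 1) l)) (linearD (cx_d Y j l)).
  by rewrite cx_dd addr0 H addNr.
case: (eqVneq j (i + 1)) => [->|ij]; last first.
  rewrite cx_shape ?(inj_eq (addIr 1)) //.
  by rewrite (cmap_ext_off _ _ (i := i + 1)) 1?eq_sym // !linear0.
rewrite cmap_ext_diag; case: (eqVneq l (i + 1 + 1)) => [->|jl].
  by rewrite cmap_ext_diag cmap_comm.
by rewrite cmap_ext_off 1?eq_sym // cx_shape.
Qed.
Definition cone : complex A := Complex cone_shape cone_dd.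
End Cone.

Definition homotopic X Y (f g : forall i : int, {linear X i -> Y i}) : Prop :=
  exists h : forall i j : int, {linear X i -> Y j},
    forall i x, f i x = g i x + (cx_d Y (i - 1) i (h i (i - 1) x)
                                 + h (i + 1) i (cx_d X i (i + 1) x)).

Definition nullhomotopic X Y (f : forall i : int, {linear X i -> Y i}) : Prop :=
  homotopic f (fun=> \0).

Definition homotopy_equiv X Y : Prop :=
  exists (f : cmap X Y) (g : cmap Y X),
    homotopic (fun i => g i \o f i) (fun=> idfun)
    /\ homotopic (fun i => f i \o g i) (fun=> idfun).

(* X is an object of the bounded homotopy category of f.g. projectives. *)
Definition in_Kb_proj X : Prop :=
  (exists n : nat, forall i : int, (n < `|i|)%N -> is_zero (X i))
  /\ forall i, projective (X i).

(* Thick subcategories of the bounded homotopy category of f.g. projectives. *)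
Record thick (T : complex A -> Prop) : Prop := Thick {
  thick_Kb : forall X, T X -> in_Kb_proj X;
  thick_zero : T (stalk zeromod);
  thick_iso : forall X Y, in_Kb_proj Y -> homotopy_equiv X Y -> T X -> T Y;
  thick_shift : forall X (n : int), T X -> T (shift X n);
  thick_cone : forall X Y (f : cmap X Y), T X -> T Y -> T (cone f);
  thick_summand : forall X Y, in_Kb_proj X -> in_Kb_proj Y ->
    T (cx_sum X Y) -> T X
}.

Definition silting S : Prop :=
  [/\ in_Kb_proj S,
      forall n : int, 0 < n -> forall f : cmap S (shift S n), nullhomotopic f
    & forall T : complex A -> Prop, thick T -> T S ->
        forall X, in_Kb_proj X -> T X].

(* A resolution is a complex concentrated in degrees <= 0. *)
Definition proj_resolution (M : fgmod A) (P : complex A)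
    (eps : {linear P 0 -> M}) : Prop :=
  [/\ forall i, 0 < i -> is_zero (P i),
      forall i, projective (P i),
      surj eps,
      exact_at (cx_d P (-1) 0) eps
    & forall i, i < 0 -> exact_at (cx_d P (i - 1) i) (cx_d P i (i + 1))].

Definition min_proj_resolution (M : fgmod A) (P : complex A)
    (eps : {linear P 0 -> M}) : Prop :=
  [/\ proj_resolution eps, superfluous_ker eps
    & forall i, i < 0 -> superfluous_ker (cx_d P i (i + 1))].

(* Ext^n(M, N) = 0, where Ext^n(M, N) is the n-th cohomology of Hom(P, N) for
   a projective resolution P of M (it does not depend on the choice of P). *)
Definition ext_zero (n : nat) (M N : fgmod A) : Prop :=
  exists (P : complex A) (eps : {linear P 0 -> M}), proj_resolution eps /\
    let i : int := - (n%:Z) in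
    forall f : {linear P i -> N}, (forall x, f (cx_d P (i - 1) i x) = 0) ->
    exists g : {linear P (i + 1) -> N}, forall x, f x = g (cx_d P i (i + 1) x).

End Complexes.

Section Subcategories.
Context {k : fieldType} {A : falgType k}.
Implicit Types (C M U : fgmod A -> Prop) (X Y Z N : fgmod A).

Definition subcategory C : Prop :=
  [/\ C zeromod,
      forall X Y, iso X Y -> C X -> C Y,
      forall X Y, C X -> C Y -> C (dsum2 X Y)
    & forall X Y, summand X Y -> C Y -> C X].

Definition contravariantly_finite C : Prop :=
  forall X, exists (N : fgmod A) (f : {linear N -> X}), C N /\
    forall N' (g : {linear N' -> X}), C N' ->
      exists h : {linear N' -> N}, forall x, g x = f (h x).

Definition covariantly_finite C : Prop :=
  forall X, exists (N : fgmod A) (f : {linear X -> N}), C N /\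
    forall N' (g : {linear X -> N'}), C N' ->
      exists h : {linear N -> N'}, forall x, g x = h (f x).

Definition functorially_finite C : Prop :=
  contravariantly_finite C /\ covariantly_finite C.

Definition cluster_tilting (d : nat) M : Prop :=
  [/\ subcategory M, functorially_finite M,
      forall X, M X <-> forall N (i : nat), M N -> (1 <= i <= d - 1)%N ->
        ext_zero i X N
    & forall Y, M Y <-> forall N (i : nat), M N -> (1 <= i <= d - 1)%N ->
        ext_zero i N Y].

(* In the exact sequence 0 -> UX -> X -> V_1 -> ... -> V_d -> 0, the module
   V_(i+1) is V i for i < d, and V i = 0 for i >= d.  Exactness of
   0 -> Hom(W, V_1) -> ... -> Hom(W, V_d) -> 0 is injectivity of the first map
   and the factorisation property at each later term; composites vanish because
   the sequence of modules is exact. *)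
Definition torsion_class (d : nat) M U : Prop :=
  [/\ subcategory U, forall X, U X -> M X
    & forall X, M X ->
      exists (UX : fgmod A) (V : nat -> fgmod A)
             (iota : {linear UX -> X}) (p : {linear X -> V 0})
             (v : forall i : nat, {linear V i -> V i.+1}),
      [/\ [/\ U UX, forall i, (i < d)%N -> M (V i)
            & forall i, (d <= i)%N -> is_zero (V i)],
          [/\ injective iota, exact_at iota p, exact_at p (v 0)
            & forall i, exact_at (v i) (v i.+1)]
        & forall W, U W ->
          (forall f : {linear W -> V 0}, (forall x, v 0 (f x) = 0) ->
             forall x, f x = 0)
          /\ forall (i : nat) (f : {linear W -> V i.+1}),
               (forall x, v i.+1 (f x) = 0) ->
               exists g : {linear W -> V i}, forall x, f x = v i (g x)]].

Definition ext_projective (d : nat) U X : Prop :=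
  U X /\ forall N, U N -> ext_zero d X N.

Definition ext_projective_generator (d : nat) U X : Prop :=
  ext_projective d U X /\ forall Y, ext_projective d U Y -> in_add X Y.

Definition basic_proj_perp U Q : Prop :=
  [/\ basic Q, projective Q
    & forall N, U N -> forall (f : {linear Q -> N}) x, f x = 0].

(* maximal with respect to the direct summand relation *)
Definition maximal_basic_proj_perp U Q : Prop :=
  basic_proj_perp U Q
  /\ forall Q', basic_proj_perp U Q' -> summand Q Q' -> iso Q Q'.

End Subcategories.

(* Main.v *)
Require Import Defs.
From HB Require Import structures.
From mathcomp Require Import all_boot all_order all_algebra all_field.
From mathcomp Require Import boolp zify.

(** Call S the complex of the theorem and R its first summand, the
    truncated minimal resolution of MU.

    Vanishing of Hom(S, S[n]) for n > 0. Since R is exact strictly between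
    the degrees -d and 0, a chain map X -> R[n] from a complex of
    projectives in degrees at least -d is null-homotopic once Hom(X, MU)
    has no cohomology in degree -n (hom_van_trunc_res); here Hom(X, -) is
    graded by the degrees of X. For X = S the stalk PU[d] contributes
    nothing, because Hom(PU, MU) = 0. The summand R contributes Ext^n(MU,
    MU) when 0 < n < d, which is zero because MU lies in the cluster
    tilting subcategory. For n = d one has to extend every map P_(-d) -> MU
    to P_(-d+1) (rigid_extend). Here Ext^d(MU, -) vanishes not only on U
    but on all quotients of modules of U (ext_projective_Fac), and
    minimality of the resolution concludes.

    Generation. The torsion class has enough Ext^d-projectives in the
    following sense. For a projective module F, minimal left
    U-approximations F -> T_0, T_0 / Im F -> T_1, and so on, give an exact
    sequence F -> T_0 -> ... -> T_d -> 0 whose terms are all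
    Ext^d-projective, hence in add MU (approx_chain_ext_projective). This
    holds because an extension of T_j by a module left perpendicular to the
    torsion-free modules is again left perpendicular, such modules are
    resolved by right U-approximations (left_perp_ures), and maps into them
    extend along the left approximations (approx_chain_extend); minimality
    then splits the extension.

    Let now X be a bounded complex of projectives with Hom(X, S[n]) = 0 for
    n > 0. The sequences above, together with the stalk PU, which accounts
    for the projectives without maps to U (proj_perp_add), show that for
    every module N the complex Hom(X, N) has no cohomology in degrees below
    -d (silt_coh): up to homotopy, X sits in degrees at least -d. Hence
    there are no nonzero maps from such X to complexes concentrated far
    enough to the left.

    To generate a complex X, shift it into nonnegative degrees, so that
    Hom(X, S[n]) = 0 for n > 0. The cone of a left add S-approximation X ->
    W has the same property, and one may iterate. After finitely many steps
    the connecting map from the cone to the shift of the preceding complex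
    is null-homotopic by silt_coh, so that this complex is a homotopy
    retract of a sum of copies of S; two-out-of-three in triangles leads
    back to X (generation).

    Only the vanishing of Ext and of cohomology is ever needed, so it is
    treated as a property (ext_van, coh_van) and no groups are formed. The
    definition of Ext by projective resolutions is related to one by
    injective cosyzygies in coh_van_extP. *)

Set Implicit Arguments.
Unset Strict Implicit.
Unset Printing Implicit Defensive.

Import Order.TTheory GRing.Theory Num.Theory.
Local Open Scope ring_scope.

(** * Submodules, quotient modules and factorisation *)

Section LinearMaps.
Variables (R : pzRingType).
Implicit Types X Y Z : lmodType R.

Definition mklin X Y (f : X -> Y) (H : linear f) : {linear X -> Y} :=
  HB.pack f (GRing.isLinear.Build R X Y _ f H).

Definition lcomp X Y Z (g : {linear Y -> Z}) (f : {linear X -> Y}) :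
  {linear X -> Z} := g \o f.

Definition idlin X : {linear X -> X} := idfun.
End LinearMaps.

Section SubQuot.
Variables (R : pzRingType) (M : lmodType R) (S : M -> Prop).
Definition smod_closed := S 0 /\ forall a x y, S x -> S y -> S (a *: x + y).
Hypothesis S_cl : smod_closed.

Lemma smod0 : S 0. Proof. by case: S_cl. Qed.
Lemma smodD x y : S x -> S y -> S (x + y).
Proof. by case: S_cl => _ H Sx Sy; rewrite -[x]scale1r; apply: H. Qed.
Lemma smodZ a x : S x -> S (a *: x).
Proof. by case: S_cl => S0 H Sx; rewrite -[_ *: _]addr0; apply: H. Qed.
Lemma smodN x : S x -> S (- x).
Proof. by move=> Sx; rewrite -scaleN1r; apply: smodZ. Qed.
Lemma smodB x y : S x -> S y -> S (x - y).
Proof. by move=> Sx Sy; apply/smodD/smodN. Qed.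

Definition sub_pred : {pred M} := [pred x | `[< S x >]].
Lemma sub_closed : GRing.submod_closed sub_pred.
Proof.
split; first by apply/asboolP/smod0.
move=> a x y /asboolP Sx /asboolP Sy; apply/asboolP/smodD => //; exact: smodZ.
Qed.

Definition submodule (_ : smod_closed) := {x : M | x \in sub_pred}.
End SubQuot.

Section SubInst.
Variables (R : pzRingType) (M : lmodType R) (S : M -> Prop) (S_cl : smod_closed S).
#[local] HB.instance Definition _ :=
  GRing.isSubmodClosed.Build R M (sub_pred S) (sub_closed S_cl).
HB.instance Definition _ := [isSub of submodule S_cl for @sval M (fun x => x \in sub_pred S)].
HB.instance Definition _ := [Choice of submodule S_cl by <:].
HB.instance Definition _ :=
  [SubChoice_isSubLmodule of submodule S_cl by <:].

Definition sub_incl : {linear submodule S_cl -> M} := \val.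

Lemma sub_incl_inj : injective sub_incl. Proof. exact: val_inj. Qed.
Lemma sub_inclP x : S x <-> exists y, sub_incl y = x.
Proof.
split=> [/asboolP Sx|[[y Sy] <-]]; last exact/asboolP.
by exists (exist _ x Sx).
Qed.
End SubInst.

Section Quot.
Variables (R : pzRingType) (M : lmodType R) (S : M -> Prop) (S_cl : smod_closed S).
Notation coset_pred x := [pred y : M | `[< S (x - y) >]].

Lemma coset_ex x : exists y, coset_pred x y.
Proof. by exists x; apply/asboolP; rewrite subrr; exact: smod0. Qed.

(** The quotient is realised on chosen representatives. The choice depends
    only on the coset, so that congruent elements have equal
    representatives. *)
Definition coset_rep x := xchoose (coset_ex x).

Lemma coset_repP x : S (x - coset_rep x).
Proof. exact/asboolP/(xchooseP (coset_ex x)). Qed.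

Lemma coset_rep_eq x y : coset_rep x = coset_rep y <-> S (x - y).
Proof.
split=> [e|Sxy].
  rewrite -(subrKA (coset_rep x)) {2}e; apply: smodD => //; first exact: coset_repP.
  by rewrite -opprB; apply: smodN => //; exact: coset_repP.
apply: eq_xchoose => z /=; apply/asboolP/asboolP => H.
  have -> : y - z = (x - z) - (x - y) by rewrite opprB [RHS]addrC subrKA.
  exact: smodB.
by rewrite -(subrKA y); apply: smodD.
Qed.

Lemma coset_repK x : coset_rep (coset_rep x) = coset_rep x.
Proof. by apply/esym/coset_rep_eq/coset_repP. Qed.

Definition quotient := {x : M | coset_rep x == x}.
Notation Q := quotient.
HB.instance Definition _ := [isSub of Q for @sval M (fun x => coset_rep x == x)].
HB.instance Definition _ := [Choice of Q by <:].

Definition quot_cl x : Q := exist _ (coset_rep x) (introT eqP (coset_repK x)).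

Lemma quot_cl_eq x y : quot_cl x = quot_cl y <-> S (x - y).
Proof.
rewrite -coset_rep_eq; split=> [/(congr1 val)//|e]; exact: val_inj.
Qed.
Lemma quot_clK (q : Q) : quot_cl (val q) = q.
Proof. by apply: val_inj => /=; apply/eqP/(svalP q). Qed.
Lemma quot_cl_val x : S (x - val (quot_cl x)). Proof. exact: coset_repP. Qed.

Definition quot_add (p q : Q) := quot_cl (val p + val q).
Definition quot_opp (p : Q) := quot_cl (- val p).
Definition quot_scale (a : R) (p : Q) := quot_cl (a *: val p).

Lemma quot_clD x y : quot_add (quot_cl x) (quot_cl y) = quot_cl (x + y).
Proof.
apply/esym/quot_cl_eq; rewrite opprD addrACA; apply: smodD => //; exact: quot_cl_val.
Qed.
Lemma quot_clN x : quot_opp (quot_cl x) = quot_cl (- x).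
Proof.
by apply/esym/quot_cl_eq; rewrite -opprD; apply: smodN => //; exact: quot_cl_val.
Qed.
Lemma quot_clZ a x : quot_scale a (quot_cl x) = quot_cl (a *: x).
Proof.
by apply/esym/quot_cl_eq; rewrite -scalerBr; apply: smodZ => //; exact: quot_cl_val.
Qed.

Lemma quot_addA : associative quot_add.
Proof.
by move=> p q r; rewrite -(quot_clK p) -(quot_clK q) -(quot_clK r) !quot_clD addrA.
Qed.
Lemma quot_addC : commutative quot_add.
Proof. by move=> p q; rewrite -(quot_clK p) -(quot_clK q) !quot_clD addrC. Qed.
Lemma quot_add0 : left_id (quot_cl 0) quot_add.
Proof. by move=> p; rewrite -(quot_clK p) !quot_clD add0r. Qed.
Lemma quot_addN : left_inverse (quot_cl 0) quot_opp quot_add.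
Proof. by move=> p; rewrite -(quot_clK p) quot_clN quot_clD addNr. Qed.
HB.instance Definition _ :=
  GRing.isZmodule.Build Q quot_addA quot_addC quot_add0 quot_addN.

Lemma quot_scaleA a b p : quot_scale a (quot_scale b p) = quot_scale (a * b) p.
Proof. by rewrite -(quot_clK p) !quot_clZ scalerA. Qed.
Lemma quot_scale1 : left_id 1 quot_scale.
Proof. by move=> p; rewrite -(quot_clK p) quot_clZ scale1r. Qed.
Lemma quot_scaleDr : right_distributive quot_scale +%R.
Proof.
move=> a p q; rewrite -(quot_clK p) -(quot_clK q) /GRing.add /= -/quot_add.
by rewrite !(quot_clZ, quot_clD) scalerDr.
Qed.
Lemma quot_scaleDl p : {morph quot_scale^~ p : a b / a + b}.
Proof.
move=> a b; rewrite -(quot_clK p) [RHS]/GRing.add /= -/quot_add.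
by rewrite !(quot_clZ, quot_clD) scalerDl.
Qed.
HB.instance Definition _ :=
  GRing.Zmodule_isLmodule.Build R Q quot_scaleA quot_scale1 quot_scaleDr quot_scaleDl.

Lemma quot_cl_linear : linear quot_cl.
Proof. by move=> a x y; rewrite -quot_clD -quot_clZ. Qed.

Definition quot_proj : {linear M -> Q} := mklin quot_cl_linear.

Lemma quot_proj_surj (q : Q) : exists x, quot_proj x = q.
Proof. by exists (val q); rewrite /= quot_clK. Qed.
Lemma quot_projP x : quot_proj x = 0 <-> S x.
Proof.
by rewrite -{2}[x]subr0; exact: quot_cl_eq.
Qed.
End Quot.

Section Factor.
Variables (R : pzRingType).
Implicit Types X Y Z : lmodType R.

Lemma fact_surj X Y Z (p : {linear X -> Y}) (f : {linear X -> Z}) :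
  (forall y, exists x, p x = y) -> (forall x, p x = 0 -> f x = 0) ->
  exists g : {linear Y -> Z}, forall x, g (p x) = f x.
Proof.
move=> sp H.
have ex y : exists x, p x == y by have [x <-] := sp y; exists x.
pose s y := xchoose (ex y).
have sE y : p (s y) = y by apply/eqP/(xchooseP (ex y)).
have gE x : f (s (p x)) = f x.
  by apply/eqP; rewrite -subr_eq0 -linearB H // linearB sE subrr.
have lg : linear (fun y => f (s y)).
  move=> a y1 y2; rewrite -{1}(sE y1) -{1}(sE y2) -linearP gE linearP //.
by exists (mklin lg) => x /=.
Qed.

Lemma fact_inj X Y Z (i : {linear Y -> Z}) (f : {linear X -> Z}) :
  injective i -> (forall x, exists y, i y = f x) ->
  exists g : {linear X -> Y}, forall x, i (g x) = f x.
Proof.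
move=> ii H.
have ex x : exists y, i y == f x by have [y <-] := H x; exists y.
pose g x := xchoose (ex x).
have gE x : i (g x) = f x by apply/eqP/(xchooseP (ex x)).
have lg : linear g by move=> a x y; apply: ii; rewrite linearP !gE linearP.
by exists (mklin lg) => x /=.
Qed.
End Factor.

(** * Dimension over the ground field *)

Section RowMaps.
Variable k : fieldType.

Lemma row_inj_le m n (f : {linear 'rV[k]_m -> 'rV[k]_n}) : injective f ->
  (m <= n)%N /\ (m = n -> forall y, exists x, f x = y).
Proof.
move=> fi; have fE x : f x = x *m lin1_mx f by rewrite mul_rV_lin1.
have rf : row_free (lin1_mx f).
  apply/inj_row_free => v; rewrite -fE => fv0.
  by apply: fi; rewrite fv0 linear0.
split; first by rewrite -(eqP rf) rank_leq_col.
move=> mn; have : row_full (lin1_mx f) by rewrite /row_full (eqP rf) mn.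
by move=> rF y; have /submxP[x ->] := submx_full y rF; exists x.
Qed.

Lemma row_surj_le m n (f : {linear 'rV[k]_m -> 'rV[k]_n}) :
  (forall y, exists x, f x = y) -> (n <= m)%N /\ (m = n -> injective f).
Proof.
move=> fs; have fE x : f x = x *m lin1_mx f by rewrite mul_rV_lin1.
have rf : row_full (lin1_mx f).
  rewrite -sub1mx; apply/row_subP => i; have [x] := fs (row i 1%:M).
  by rewrite fE => <-; exact: submxMl.
split; first by rewrite -(eqP rf) rank_leq_row.
move=> mn; have rF : row_free (lin1_mx f) by rewrite /row_free (eqP rf) mn.
by move=> x y; rewrite !fE => /(row_free_inj rF).
Qed.

(** A finite family in D of largest rank cannot be enlarged, so it spans. *)
Lemma span_fin n (D : 'rV[k]_n -> Prop) :
  exists m (B : 'M[k]_(m, n)), (forall i, D (row i B)) /\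
    forall v, D v -> (v <= B)%MS.
Proof.
pose has r := `[< exists m (B : 'M[k]_(m, n)), (forall i, D (row i B)) /\ \rank B = r >].
have h0 : exists r, has r.
  exists 0%N; apply/asboolP; exists 0%N, 0; split; first by case.
  by rewrite mxrank0.
have hle r : has r -> (r <= n)%N.
  by move=> /asboolP[m [B [_ <-]]]; exact: rank_leq_col.
case: (ex_maxnP h0 hle) => r /asboolP[m [B [BD Br]]] rmax.
exists m, B; split=> // v Dv.
have hv : has (\rank (col_mx B v)).
  apply/asboolP; exists (m + 1)%N, (col_mx B v); split=> // i.
  case: (split_ordP i) => j ->; first by rewrite rowKu.
  by rewrite rowKd ord1 row_id.
have := rmax _ hv; rewrite -Br => le.
have sB : (B <= col_mx B v)%MS by rewrite -(addsmxE B v) addsmxSl.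
have := geq_leqif (mxrank_leqif_sup sB); rewrite le => /esym sb.
by apply: submx_trans sb; rewrite -(addsmxE B v) addsmxSr.
Qed.
End RowMaps.

Section ScalarAction.
Context {k : fieldType} {A : falgType k}.

Definition kscale (X : lmodType A^c) (c : k) (x : X) : X := ((c%:A : A) : A^c) *: x.

Lemma kscaleA (X : lmodType A^c) a b (x : X) : kscale a (kscale b x) = kscale (a * b) x.
Proof.
rewrite /kscale scalerA; congr (_ *: _).
by rewrite /GRing.mul /= -[LHS]/((b%:A : A) * a%:A) -scalerAl mul1r scalerA mulrC.
Qed.
Lemma kscale1 (X : lmodType A^c) : left_id 1 (@kscale X).
Proof. by move=> x; rewrite /kscale scale1r [LHS]scale1r. Qed.
Lemma kscaleDr (X : lmodType A^c) : right_distributive (@kscale X) +%R.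
Proof. by move=> c x y; rewrite /kscale scalerDr. Qed.
Lemma kscaleDl (X : lmodType A^c) x : {morph (@kscale X)^~ x : a b / a + b}.
Proof. by move=> a b; rewrite /kscale scalerDl [LHS]scalerDl. Qed.
Lemma kscale_lin (X Y : lmodType A^c) (f : {linear X -> Y}) c x : f (kscale c x) = kscale c (f x).
Proof. by rewrite /kscale linearZ. Qed.
Lemma kscaleZ (X : lmodType A^c) (a : A^c) c (x : X) : kscale c (a *: x) = a *: kscale c x.
Proof.
rewrite /kscale !scalerA; congr (_ *: _).
rewrite /GRing.mul /= -[LHS]/((a : A) * c%:A) -[RHS]/((c%:A : A) * a).
by rewrite -scalerAl -scalerAr mul1r mulr1.
Qed.

(** A-modules come without a k-linear structure; this alias carries the one
    through the scalars of A. *)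
Definition kmod (X : lmodType A^c) : Type := X.
Section KMod.
Variable X : lmodType A^c.
HB.instance Definition _ := GRing.Zmodule.on (kmod X).
HB.instance Definition _ := GRing.Zmodule_isLmodule.Build k (kmod X)
  (@kscaleA X) (@kscale1 X) (@kscaleDr X) (@kscaleDl X).
End KMod.

Lemma kmod_scaleE (X : lmodType A^c) (c : k) (x : kmod X) : c *: x = kscale c (x : X).
Proof. by []. Qed.

Lemma kmod_lin_linear (X Y : lmodType A^c) (f : {linear X -> Y}) :
  linear (f : kmod X -> kmod Y).
Proof. by move=> c x y; rewrite kmod_scaleE [LHS](linearD f) (kscale_lin f). Qed.
Definition kmod_lin (X Y : lmodType A^c) (f : {linear X -> Y}) :
  {linear kmod X -> kmod Y} := mklin (@kmod_lin_linear X Y f).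

Definition kfin (X : lmodType A^c) := exists n (phi : {linear 'rV[k]_n -> kmod X}),
  forall x, exists v, phi v = x.

Lemma kfin_fg (X : lmodType A^c) : fin_gen X -> kfin X.
Proof.
case=> n [e eP].
pose m := \dim {:A}; pose b := vbasis {:A}.
pose w (B : 'M[k]_(n, m)) i : A := \sum_j B i j *: b`_j.
pose g (v : 'rV[k]_(n * m)) : kmod X := \sum_i (w (vec_mx v) i : A^c) *: e i.
have gl : linear g.
  move=> c u v; rewrite /g kmod_scaleE /kscale scaler_sumr -big_split /=.
  apply: eq_bigr => i _.
  transitivity ((((c%:A : A) : A^c) * w (vec_mx u) i + w (vec_mx v) i : A^c) *: e i);
    last by rewrite [LHS]scalerDl scalerA.
  apply: (congr1 (fun a : A^c => a *: e i)).
  rewrite /w -[RHS]/((\sum_j vec_mx u i j *: b`_j) * c%:A + \sum_j vec_mx v i j *: b`_j).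
  rewrite -scalerAr mulr1 scaler_sumr -big_split /=.
  by apply: eq_bigr => j _; rewrite linearP !mxE scalerDl scalerA.
exists _, (mklin gl) => x.
have [a ->] := eP x; exists (mxvec (\matrix_(i, j) coord b j (a i : A))).
rewrite /= /g mxvecK; apply: eq_bigr => i _; apply: (congr1 (fun a : A^c => a *: e i)).
rewrite /w [RHS](coord_vbasis (memvf (a i : A))).
by apply: eq_bigr => j _; rewrite mxE.
Qed.

(** A surjection from k^n with n least is injective: a kernel vector with
    nonzero i-th entry makes the i-th coordinate redundant. *)
Lemma kfin_bij (X : lmodType A^c) : kfin X ->
  exists n (phi : {linear 'rV[k]_n -> kmod X}),
   injective phi /\ forall x, exists v, phi v = x.
Proof.
move=> fx; pose has n := `[< exists phi : {linear 'rV[k]_n -> kmod X},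
  forall x, exists v, phi v = x >].
have h : exists n, has n by have [n H] := fx; exists n; apply/asboolP.
case: (ex_minnP h) => n /asboolP[phi phis] nmin; exists n, phi; split=> //.
suff: forall v, phi v = 0 -> v = 0.
  by move=> H u v e; apply/eqP; rewrite -subr_eq0; apply/eqP/H; rewrite linearB e subrr.
move=> v pv; apply/rowP => i; rewrite mxE; case: (eqVneq (v 0 i) 0) => // vi.
exfalso; case: n i phi phis v pv vi nmin => [[] //|n] i phi phis v pv vi nmin.
suff: has n by move=> /nmin; rewrite ltnn.
(* Insert a zero at position i. *)
pose ins (w : 'rV[k]_n) : 'rV[k]_n.+1 := \row_j oapp (w 0) 0 (unlift i j).
have insl : linear ins.
  move=> c a b; apply/rowP => j; rewrite !mxE.
  by case: (unlift i j) => [j'|] /=; rewrite ?mxE // mulr0 addr0.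
apply/asboolP; exists (phi \o mklin insl) => x.
have [u <-] := phis x.
pose u' := u - (u 0 i / v 0 i) *: v.
have -> : phi u = phi u' by rewrite linearB linearZ /= pv scaler0 subr0.
exists (\row_j u' 0 (lift i j)); congr (phi _).
apply/rowP => j; rewrite /= mxE; case: unliftP => [j' ->|->] /=; rewrite !mxE //.
by rewrite mulfVK ?subrr.
Qed.

Lemma fgmod_kfin (M : fgmod A) : kfin M.
Proof. exact/kfin_fg/fgmod_fin_gen. Qed.

Lemma kfin_fin_gen (X : lmodType A^c) : kfin X -> fin_gen X.
Proof.
case=> n [phi phis]; exists n, (fun i => phi (delta_mx 0 i)) => x.
have [v <-] := phis x; exists (fun i => (((v 0 i)%:A : A) : A^c)).
rewrite {1}(row_sum_delta v) linear_sum; apply: eq_bigr => i _.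
by rewrite linearZ.
Qed.

Lemma kfin_surj (X Y : lmodType A^c) (f : {linear X -> Y}) :
  kfin X -> (forall y, exists x, f x = y) -> kfin Y.
Proof.
case=> n [phi phis] fs; exists n, (kmod_lin f \o phi) => y.
by have [x <-] := fs y; have [v <-] := phis x; exists v.
Qed.

Lemma kfin_inj (X Y : lmodType A^c) (f : {linear X -> Y}) :
  kfin Y -> injective f -> kfin X.
Proof.
move=> /kfin_bij[n [phi [phii phis]]] fi.
have [m [B [BD BS]]] := span_fin (fun v => exists x, f x = phi v).
have bx i : {x | f x = phi (row i B)} by apply: cid.
pose g (v : 'rV[k]_m) : kmod X := \sum_i v 0 i *: (sval (bx i) : kmod X).
have gl : linear g.
  move=> c a b; rewrite /g scaler_sumr -big_split /=.
  by apply: eq_bigr => i _; rewrite !mxE scalerDl scalerA.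
exists m, (mklin gl) => x.
have [v vE] := phis (f x).
have /submxP[w wE] : (v <= B)%MS by apply: BS; exists x.
exists w; apply: fi; rewrite /= -[LHS]/(kmod_lin f (g w)) /g linear_sum -vE.
rewrite wE mulmx_sum_row linear_sum; apply: eq_bigr => i _.
by rewrite !linearZ /= (svalP (bx i)).
Qed.

Lemma kdim_ex (M : fgmod A) : exists n, exists phi : {linear 'rV[k]_n -> kmod M},
   injective phi /\ forall x, exists v, phi v = x.
Proof. exact/kfin_bij/fgmod_kfin. Qed.

Definition kdim (M : fgmod A) : nat := sval (cid (kdim_ex M)).

Lemma kcoord (M : fgmod A) : exists phi : {linear 'rV[k]_(kdim M) -> kmod M},
  exists psi : {linear kmod M -> 'rV[k]_(kdim M)}, cancel phi psi /\ cancel psi phi.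
Proof.
rewrite /kdim; case: cid => n [phi [phii phis]] /=.
have [psi psiE] := fact_inj (f := idlin (kmod M)) phii phis.
by exists phi, psi; split=> x //; apply: phii; rewrite psiE.
Qed.

Lemma kdim_inj (M N : fgmod A) (f : {linear M -> N}) : injective f ->
  (kdim M <= kdim N)%N /\ (kdim M = kdim N -> surj f).
Proof.
move=> fi; have [p [q [pq qp]]] := kcoord M; have [p' [q' [pq' qp']]] := kcoord N.
have Fi : injective (q' \o (kmod_lin f \o p)).
  by apply: inj_comp (can_inj qp') _; apply: inj_comp fi (can_inj pq).
have [le H] := row_inj_le Fi; split=> // e y.
by have [x xE] := H e (q' y); exists (p x); apply: (can_inj qp').
Qed.

Lemma kdim_surj (M N : fgmod A) (f : {linear M -> N}) : surj f ->
  (kdim N <= kdim M)%N /\ (kdim M = kdim N -> injective f).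
Proof.
move=> fs; have [p [q [pq qp]]] := kcoord M; have [p' [q' [pq' qp']]] := kcoord N.
have Fs : forall y, exists x, (q' \o (kmod_lin f \o p)) x = y.
  move=> y; have [x xE] := fs (p' y); exists (q x).
  by rewrite /= qp xE pq'.
have [le H] := row_surj_le Fs; split=> // e x y xy.
by apply: (can_inj qp); apply: (H e); rewrite /= !qp xy.
Qed.
End ScalarAction.

(** * Coinduced modules are injective *)

Section Coinduced.
Context {k : fieldType} {A : falgType k}.
Variable N : fgmod A.
Let m := \dim {:A}.
Let b := vbasis {:A}.

(** The module Hom_k(A, N), each map being given by its values on a basis
    of A; coind_ev recovers the map. *)
Definition coind_type : Type := {ffun 'I_m -> N}.
HB.instance Definition _ := GRing.Zmodule.on coind_type.

Definition coind_ev (phi : coind_type) (x : A) : N :=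
  \sum_j kscale (coord b j x) (phi j).

Lemma coind_ev_lin phi : linear (coind_ev phi : A -> kmod N).
Proof.
move=> c x y; rewrite /coind_ev kmod_scaleE -[kscale _ _]/(c *: (_ : kmod N)).
rewrite [in RHS]scaler_sumr -big_split /=.
by apply: eq_bigr => j _; rewrite linearP /= kscaleDl -kscaleA.
Qed.

Lemma coind_ev_basis phi (i : 'I_m) : coind_ev phi b`_i = phi i.
Proof.
rewrite /coind_ev (bigD1 i) //= coord_free ?(basis_free (vbasisP _)) // eqxx kscale1.
rewrite big1 ?addr0 // => j ji.
by rewrite coord_free ?(basis_free (vbasisP _)) // eq_sym (negPf ji) /kscale scale0r scale0r.
Qed.

Lemma kmod_expand (V : lmodType A^c) (f : A -> kmod V) (x : A) : linear f ->
  f x = \sum_j kscale (coord b j x) (f b`_j).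
Proof.
move=> fl; rewrite {1}(coord_vbasis (memvf x)) -[f]/(mklin fl : _ -> _) linear_sum.
by apply: eq_bigr => j _; rewrite linearZ.
Qed.

Definition coind_scale (a : A^c) (phi : coind_type) : coind_type :=
  [ffun i : 'I_m => coind_ev phi ((a : A) * b`_i)].

Lemma coind_ev_scale a phi x : coind_ev (coind_scale a phi) x = coind_ev phi ((a : A) * x).
Proof.
have fl : linear (fun x : A => coind_ev phi ((a : A) * x) : kmod N).
  by move=> c y z; rewrite mulrDr -scalerAr coind_ev_lin.
rewrite [RHS](kmod_expand x fl); apply: eq_bigr => j _.
by rewrite ffunE.
Qed.

Lemma coind_scaleA a c p : coind_scale a (coind_scale c p) = coind_scale (a * c) p.
Proof. by apply/ffunP => i; rewrite !ffunE coind_ev_scale mulrA. Qed.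
Lemma coind_scale1 : left_id 1 coind_scale.
Proof. by move=> p; apply/ffunP => i; rewrite ffunE mul1r coind_ev_basis. Qed.
Lemma coind_scaleDr : right_distributive coind_scale +%R.
Proof.
move=> a p q; apply/ffunP => i; rewrite !ffunE /coind_ev -big_split /=.
by apply: eq_bigr => j _; rewrite ffunE kscaleDr.
Qed.
Lemma coind_scaleDl p : {morph coind_scale^~ p : a c / a + c}.
Proof.
move=> a c; apply/ffunP => i; rewrite !ffunE.
rewrite -[LHS]/(coind_ev p (((a : A) + (c : A)) * b`_i)) mulrDl.
by have := coind_ev_lin p 1 ((a : A) * b`_i) ((c : A) * b`_i); rewrite !scale1r.
Qed.
HB.instance Definition _ := GRing.Zmodule_isLmodule.Build A^c coind_type
  coind_scaleA coind_scale1 coind_scaleDr coind_scaleDl.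

Lemma coind_kfin : kfin (coind_type : lmodType A^c).
Proof.
have [p [q [pq qp]]] := kcoord N.
pose g (v : 'rV[k]_(m * kdim N)) : kmod (coind_type : lmodType A^c) :=
  [ffun i : 'I_m => p (row i (vec_mx v))].
have gl : linear g.
  move=> c u v; rewrite kmod_scaleE /kscale; apply/ffunP => i.
  rewrite !ffunE linearP [in LHS]linearP linearP kmod_scaleE.
  congr (_ + _); rewrite -scalerAl mul1r.
  have := coind_ev_lin (g u) c b`_i 0; rewrite addr0 coind_ev_basis => ->.
  have -> : coind_ev (g u) 0 = 0.
    by rewrite /coind_ev big1 // => j _; rewrite linear0 /kscale scale0r scale0r.
  by rewrite addr0 ffunE.
exists _, (mklin gl) => x.
exists (mxvec (\matrix_(i, j) q (x i) 0 j)); apply/ffunP => i.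
rewrite /= ffunE mxvecK (_ : row i _ = q (x i)) ?qp //.
by apply/rowP => j; rewrite !mxE.
Qed.

Definition coind : fgmod A := FGMod (kfin_fin_gen coind_kfin).

Definition coind_in_fun (x : N) : coind := [ffun i : 'I_m => (b`_i : A^c) *: x].

Lemma coind_in_ev x y : coind_ev (coind_in_fun x) y = (y : A^c) *: x.
Proof.
have fl : linear (fun y : A => (y : A^c) *: x : kmod N).
  move=> c u v; rewrite kmod_scaleE /kscale scalerA.
  transitivity (((c *: u : A) : A^c) *: x + (v : A^c) *: x); first exact: (@scalerDl A^c _ _ (c *: u : A) (v : A^c)).
  congr (_ + _); apply: (congr1 (fun a : A^c => a *: x)).
  by rewrite -[RHS]/((u : A) * c%:A) -scalerAr mulr1.
rewrite [RHS](kmod_expand y fl); apply: eq_bigr => j _; by rewrite ffunE.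
Qed.

Lemma coind_in_linear : linear coind_in_fun.
Proof.
move=> a x y; apply/ffunP => i; rewrite !ffunE coind_in_ev scalerDr scalerA.
by [].
Qed.
Definition coind_in : {linear N -> coind} := mklin coind_in_linear.

Lemma coind_in_inj : injective coind_in.
Proof.
move=> x y /(congr1 (fun phi => coind_ev phi 1)); rewrite /= !coind_in_ev => e.
by rewrite -(scale1r x) -(scale1r y).
Qed.
End Coinduced.
Arguments coind_in : simpl never.

Section Injectivity.
Context {k : fieldType} {A : falgType k}.
Implicit Types M N P Q X Y Z : fgmod A.

(** In coordinates, v factors through u by way of a partial inverse of the
    matrix of u. *)
Lemma kmod_extend X Y N (u : {linear kmod X -> kmod Y}) (v : {linear kmod X -> kmod N}) :
  (forall x, u x = 0 -> v x = 0) ->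
  exists w : {linear kmod Y -> kmod N}, forall x, w (u x) = v x.
Proof.
move=> H; have [p [q [pq qp]]] := kcoord X.
have [p' [q' [pq' qp']]] := kcoord Y; have [p'' [q'' [pq'' qp'']]] := kcoord N.
pose U := lin1_mx (q' \o (u \o p)); pose V := lin1_mx (q'' \o (v \o p)).
have UE x : x *m U = q' (u (p x)) by rewrite mul_rV_lin1.
have VE x : x *m V = q'' (v (p x)) by rewrite mul_rV_lin1.
have UV (x : 'rV[k]_(kdim X)) : x *m U = 0 -> x *m V = 0.
  rewrite UE VE => /(congr1 p'); rewrite qp' linear0 => /H ->.
  by rewrite linear0.
have VW : V = U *m (pinvmx U *m V).
  apply/eqP; rewrite -subr_eq0; apply/eqP/row_matrixP => i.
  rewrite row0 mulmxA -{1}[V]mul1mx -mulmxBl row_mul; apply: UV.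
  by rewrite -row_mul mulmxBl mul1mx mulmxKpV // subrr row0.
exists (p'' \o (mulmxr (pinvmx U *m V) \o q')) => x.
rewrite /= -{1}(qp x) -UE -mulmxA -VW VE qp qp''. by [].
Qed.

(** The map i need not be injective: the condition is injectivity of N
    applied to the image of i, in the form in which it is used. *)
Definition injmod N := forall X Y (i : {linear X -> Y}) (f : {linear X -> N}),
  (forall x, i x = 0 -> f x = 0) -> exists g : {linear Y -> N}, forall x, g (i x) = f x.

(** By the adjunction Hom_A(X, Hom_k(A, N)) = Hom_k(X, N), an extension
    problem for A-linear maps becomes one for k-linear maps. *)
Lemma coind_injmod N : injmod (coind N).
Proof.
move=> X Y i f H; pose b := vbasis {:A}.
have vl : linear ((fun x => coind_ev (f x) 1) : kmod X -> kmod N).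
  move=> c x y; rewrite kmod_scaleE /kscale linearP.
  transitivity (coind_ev ((c%:A : A^c) *: f x) 1 + coind_ev (f y) 1).
    rewrite /coind_ev -big_split; apply: eq_bigr => j _ /=.
    by rewrite !ffunE kscaleDr.
  congr (_ + _); rewrite [LHS]coind_ev_scale mulr1.
  by have := coind_ev_lin (f x) c 1 0; rewrite !addr0 => ->;
    rewrite [X in _ + X](_ : _ = 0) ?addr0 // /coind_ev big1 // => j _;
    rewrite linear0 /kscale scale0r scale0r.
have [w wE] := @kmod_extend X Y N (kmod_lin i) (mklin vl) (fun x ix =>
  ltac:(rewrite /= H //; rewrite /coind_ev big1 // => j _; by rewrite ffunE /kscale scaler0)).
have wl y : linear (fun a : A => w ((a : A^c) *: (y : Y)) : kmod N).
  move=> c u v; rewrite -linearP; congr (w _).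
  rewrite kmod_scaleE /kscale scalerA.
  transitivity (((c *: u : A) : A^c) *: y + (v : A^c) *: y); first exact: (@scalerDl A^c _ _ (c *: u : A) (v : A^c)).
  congr (_ + _); apply: (congr1 (fun a : A^c => a *: y)).
  by rewrite -[RHS]/((u : A) * c%:A) -scalerAr mulr1.
pose g (y : Y) : coind N := [ffun j : 'I_(\dim {:A}) => w ((b`_j : A^c) *: y)].
have gev y a : coind_ev (g y) a = w ((a : A^c) *: y).
  rewrite [RHS](kmod_expand a (wl y)); apply: eq_bigr => j _; by rewrite ffunE.
have gl : linear g.
  move=> a y z; apply/ffunP => j; rewrite !ffunE gev scalerDr scalerA.
  exact: (linearD w).
exists (mklin gl) => x; apply/ffunP => j; rewrite /= ffunE.
rewrite -linearZ wE /= linearZ /= [LHS]coind_ev_scale mulr1.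
exact: coind_ev_basis.
Qed.
End Injectivity.

(** * Exact sequences, retracts, projective modules and Fitting decompositions *)

Section Modules.
Context {k : fieldType} {A : falgType k}.
Implicit Types C E F G I J K M N P Q T V W X Y Z : fgmod A.

Lemma sub_fin_gen M (S : M -> Prop) (cl : smod_closed S) : fin_gen (submodule cl).
Proof. exact/kfin_fin_gen/(kfin_inj (fgmod_kfin M) (sub_incl_inj (S_cl := cl))). Qed.
Lemma quot_fin_gen M (S : M -> Prop) (cl : smod_closed S) : fin_gen (quotient cl).
Proof. exact/kfin_fin_gen/(kfin_surj (fgmod_kfin M) (quot_proj_surj (S_cl := cl))). Qed.
Definition subm M (S : M -> Prop) (cl : smod_closed S) : fgmod A := FGMod (sub_fin_gen cl).
Definition quom M (S : M -> Prop) (cl : smod_closed S) : fgmod A := FGMod (quot_fin_gen cl).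

Lemma sub_ex M (S : M -> Prop) : smod_closed S ->
  exists K (i : {linear K -> M}), injective i /\ forall x, S x <-> exists y, i y = x.
Proof.
move=> cl; exists (subm cl), (sub_incl cl); split; first exact: sub_incl_inj.
exact: sub_inclP.
Qed.

Lemma smod_ker X Y (f : {linear X -> Y}) : smod_closed (fun x => f x = 0).
Proof.
by split=> [|a x y fx fy]; rewrite ?linear0 // linearP fx fy scaler0 addr0.
Qed.

Lemma smod_img X Y (f : {linear X -> Y}) : smod_closed (fun y => exists x, f x = y).
Proof.
split; first by exists 0; rewrite linear0.
by move=> a _ _ [x <-] [y <-]; exists (a *: x + y); rewrite linearP.
Qed.

Lemma ker_ex X Y (f : {linear X -> Y}) :
  exists K (i : {linear K -> X}), injective i /\ exact_at i f.
Proof. exact: sub_ex (smod_ker f). Qed.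

Lemma img_ex X Y (f : {linear X -> Y}) :
  exists I (p : {linear X -> I}) (i : {linear I -> Y}),
   [/\ surj p, injective i & forall x, i (p x) = f x].
Proof.
have [I [i [ii iP]]] := sub_ex (smod_img f).
have [p pE] := fact_inj (f := f) ii (fun x => (iP (f x)).1 (ex_intro _ x erefl)).
exists I, p, i; split=> // y; have [x xE] := (iP (i y)).2 (ex_intro _ y erefl).
by exists x; apply: ii; rewrite pE.
Qed.

Lemma quo_ex M (S : M -> Prop) : smod_closed S ->
  exists C (p : {linear M -> C}), surj p /\ forall x, p x = 0 <-> S x.
Proof.
move=> cl; exists (quom cl), (quot_proj cl).
by split; [exact: quot_proj_surj | move=> x; exact: quot_projP].
Qed.

Lemma coker_ex X Y (f : {linear X -> Y}) :
  exists C (p : {linear Y -> C}), surj p /\ exact_at f p.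
Proof. exact: quo_ex (smod_img f). Qed.

Definition ses X Y Z (i : {linear X -> Y}) (p : {linear Y -> Z}) :=
  [/\ injective i, exact_at i p & surj p].

Lemma ker_ses X Y (f : {linear X -> Y}) : surj f ->
  exists K (i : {linear K -> X}), ses i f.
Proof. by move=> sf; have [K [i [ii ie]]] := ker_ex f; exists K, i; split. Qed.

Lemma coker_ses X Y (f : {linear X -> Y}) : injective f ->
  exists C (p : {linear Y -> C}), ses f p.
Proof. by move=> sf; have [C [p [ps pe]]] := coker_ex f; exists C, p; split. Qed.

Lemma exact_comp X Y Z (i : {linear X -> Y}) (p : {linear Y -> Z}) x :
  exact_at i p -> p (i x) = 0.
Proof. by move=> e; apply/e; exists x. Qed.

Lemma inj0 X Y (f : {linear X -> Y}) : (forall x, f x = 0 -> x = 0) -> injective f.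
Proof.
move=> H x y e; apply/eqP; rewrite -subr_eq0; apply/eqP/H.
by rewrite linearB e subrr.
Qed.
Lemma inj_eq0 X Y (f : {linear X -> Y}) x : injective f -> f x = 0 -> x = 0.
Proof. by move=> fi; rewrite -(linear0 f) => /fi. Qed.

Lemma fact_coker X Y Z W (i : {linear X -> Y}) (p : {linear Y -> Z}) (f : {linear Y -> W}) :
  exact_at i p -> surj p -> (forall x, f (i x) = 0) ->
  exists g : {linear Z -> W}, forall y, g (p y) = f y.
Proof. by move=> e s H; apply: fact_surj => // y /e[x <-]. Qed.

Lemma fact_ker X Y Z W (i : {linear X -> Y}) (p : {linear Y -> Z}) (f : {linear W -> Y}) :
  injective i -> exact_at i p -> (forall x, p (f x) = 0) ->
  exists g : {linear W -> X}, forall y, i (g y) = f y.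
Proof. by move=> ii e H; apply: fact_inj => // x; apply/e. Qed.

Definition sub_lin X Y (f g : {linear X -> Y}) : {linear X -> Y} := f \- g.
Definition add_lin X Y (f g : {linear X -> Y}) : {linear X -> Y} := f \+ g.
Definition opp_lin X Y (f : {linear X -> Y}) : {linear X -> Y} := \- f.
Definition zero_lin X Y : {linear X -> Y} := \0.

Definition inl_lin X Y : {linear X -> dsum2 X Y} := pair_lin (idlin X) (zero_lin X Y).
Definition inr_lin X Y : {linear Y -> dsum2 X Y} := pair_lin (zero_lin Y X) (idlin Y).
Definition copair X Y Z (f : {linear X -> Z}) (g : {linear Y -> Z}) :
  {linear dsum2 X Y -> Z} := add_lin (lcomp f (fst_lin X Y)) (lcomp g (snd_lin X Y)).
Lemma copairE X Y Z (f : {linear X -> Z}) (g : {linear Y -> Z}) x :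
  copair f g x = f x.1 + g x.2.
Proof. by []. Qed.
Lemma pair_linE X Y Z (f : {linear X -> Y}) (g : {linear X -> Z}) x :
  pair_lin f g x = (f x, g x).
Proof. by []. Qed.

Lemma pullback_ex X Y Z (f : {linear X -> Z}) (g : {linear Y -> Z}) :
  exists E (p : {linear E -> X}) (q : {linear E -> Y}),
   [/\ forall e, f (p e) = g (q e),
       forall x y, f x = g y -> exists e, p e = x /\ q e = y,
       forall e, p e = 0 -> q e = 0 -> e = 0
     & forall W (u : {linear W -> X}) (v : {linear W -> Y}), (forall w, f (u w) = g (v w)) ->
        exists h : {linear W -> E}, forall w, p (h w) = u w /\ q (h w) = v w].
Proof.
have [E [i [ii ie]]] := ker_ex (copair f (opp_lin g)).
exists E, (lcomp (fst_lin X Y) i), (lcomp (snd_lin X Y) i); split.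
- move=> e; have /eqP := exact_comp e ie.
  by rewrite copairE /= subr_eq0 => /eqP.
- move=> x y fg; have [|e ee] := (ie (x, y)).1; last by exists e; rewrite /= ee.
  by rewrite copairE /= fg subrr.
- move=> e /= e1 e2; apply: (inj_eq0 ii); move: e1 e2.
  by case: (i e) => a c /= -> ->.
- move=> W u v uv; have [|h hE] := fact_ker (f := pair_lin u v) ii ie.
    by move=> x; rewrite copairE /= uv subrr.
  by exists h => w; rewrite /= hE.
Qed.

(** Direct summands without reference to a complement; see summand_retract
    and retract_summand. *)
Definition retract X Y := exists (i : {linear X -> Y}) (r : {linear Y -> X}),
  forall x, r (i x) = x.

Lemma iso_sym X Y : iso X Y -> iso Y X.
Proof.
move=> [f [g fK gK]].
have gl : linear g by move=> a x y; apply: (can_inj fK); rewrite linearP !gK.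
by exists (mklin gl), f.
Qed.

Lemma iso_bij X Y (f : {linear X -> Y}) : injective f -> surj f -> 
  exists g : {linear Y -> X}, cancel f g /\ cancel g f.
Proof.
move=> fi fs; have [g gE] := fact_inj (f := idlin Y) fi fs.
by exists g; split=> // x; apply: fi; rewrite gE.
Qed.

Lemma summand_retract X Y : summand X Y -> retract X Y.
Proof.
move=> [Z /iso_sym[f fb]]; have [g fK gK] := fb.
have [f' [fK' _]] := iso_bij (bij_inj fb) (fun y => ex_intro _ (g y) (gK y)).
exists (lcomp f (inl_lin X Z)), (lcomp (fst_lin X Z) f') => x.
by rewrite /= fK'.
Qed.

Lemma retract_iso X Y (i : {linear X -> Y}) (r : {linear Y -> X}) :
  (forall x, r (i x) = x) -> exists Z, iso Y (dsum2 X Z).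
Proof.
move=> ri; have [Z [j [ji je]]] := ker_ex r.
have [|s sE] := fact_ker (f := sub_lin (idlin Y) (lcomp i r)) ji je.
  by move=> y; rewrite /= linearB ri subrr.
exists Z, (pair_lin r s); exists (copair i j) => x.
  by rewrite copairE /= sE /= addrC subrK.
case: x => x z; rewrite copairE /= /pair_lin_fun; congr (_, _).
  by rewrite linearD ri (exact_comp z je) addr0.
by apply: ji; rewrite sE /= linearD ri (exact_comp z je) addr0 addrC addKr.
Qed.

Lemma retract_summand X Y : retract X Y -> summand X Y.
Proof. by move=> [i [r ri]]; exact: retract_iso ri. Qed.

Lemma iso_retract X Y : iso X Y -> retract X Y.
Proof.
by move=> [f fb]; have [g fK gK] := fb;
  have [f' [fK' _]] := iso_bij (bij_inj fb) (fun y => ex_intro _ (g y) (gK y)); exists f, f'.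
Qed.

Definition add_closed (C : fgmod A -> Prop) :=
  [/\ forall X, is_zero X -> C X,
      forall X Y, retract X Y -> C Y -> C X
    & forall X Y, C X -> C Y -> C (dsum2 X Y)].

Lemma zeromod0 : is_zero (zeromod : fgmod A).
Proof. by move=> x; apply/rowP; case. Qed.

Lemma dsum2_zero M N : is_zero M -> is_zero N -> is_zero (dsum2 M N).
Proof. by move=> M0 N0 [x y]; rewrite (M0 x) (N0 y). Qed.

Lemma is_zero_retract X : is_zero X -> retract X zeromod.
Proof. by move=> z; exists (zero_lin _ _), (zero_lin _ _) => x; rewrite [RHS]z. Qed.

Lemma subcategory_add (C : fgmod A -> Prop) : subcategory C -> add_closed C.
Proof.
move=> [C0 Ci Cd Cs]; have Cr X Y : retract X Y -> C Y -> C X.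
  by move=> /retract_summand H; exact: Cs.
by split=> // X X0; apply: Cr C0; exact: is_zero_retract.
Qed.

Lemma in_add_closed (C : fgmod A -> Prop) M N : add_closed C -> C M -> in_add M N -> C N.
Proof.
move=> [C0 Cr Cd] CM [n /summand_retract]; suff: C (dsum (nseq n M)) by move=> H /Cr; apply.
by elim: n => [|n IH] /=; [apply/C0/zeromod0 | apply: Cd].
Qed.

Lemma retract_comp X Y Z : retract X Y -> retract Y Z -> retract X Z.
Proof.
move=> [i [r ri]] [i' [r' ri']]; exists (lcomp i' i), (lcomp r r') => x.
by rewrite /= ri' ri.
Qed.
Lemma retract_dsuml X Y : retract X (dsum2 X Y).
Proof. by exists (inl_lin X Y), (fst_lin X Y). Qed.
Lemma retract_dsumr X Y : retract Y (dsum2 X Y).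
Proof. by exists (inr_lin X Y), (snd_lin X Y). Qed.

(** In contrast to the defining property, p only has to reach the image of
    f. *)
Lemma proj_lift P X Y (p : {linear X -> Y}) (f : {linear P -> Y}) : projective P ->
  (forall x, exists x', p x' = f x) -> exists h : {linear P -> X}, forall x, p (h x) = f x.
Proof.
move=> Pp H; have [I [q [i [qs ii qi]]]] := img_ex p.
have [|g gE] := fact_inj (f := f) ii.
  by move=> x; have [x' <-] := H x; exists (q x'); rewrite qi.
by have [h hE] := Pp _ _ q g qs; exists h => x; rewrite -qi hE gE.
Qed.

Lemma proj_add : add_closed (@projective k A).
Proof.
split.
- by move=> X X0 M N g f _; exists (zero_lin _ _) => x; rewrite (X0 x) !linear0.
- move=> X Y [i [r ri]] Yp M N g f gs.
  have [h hE] := Yp M N g (lcomp f r) gs; exists (lcomp h i) => x.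
  by rewrite /= hE /= ri.
- move=> X Y Xp Yp M N g f gs.
  have [h hE] := Xp M N g (lcomp f (inl_lin X Y)) gs.
  have [h' hE'] := Yp M N g (lcomp f (inr_lin X Y)) gs.
  exists (copair h h') => x; rewrite copairE linearD hE hE' /= -linearD.
  congr (f _); case: x => a c; congr (_, _) => /=; [exact: addr0 | exact: add0r].
Qed.

Lemma free_fin_gen n : fin_gen 'rV[A^c]_n.
Proof.
exists n, (fun i => delta_mx 0 i) => x; exists (fun i => x 0 i).
exact: row_sum_delta.
Qed.
Definition free n : fgmod A := FGMod (free_fin_gen n).

Definition free_map_fun n M (e : 'I_n -> M) (v : free n) : M := 
  \sum_i (v : 'rV[A^c]_n) 0 i *: e i.
Lemma free_map_linear n M (e : 'I_n -> M) : linear (free_map_fun e).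
Proof.
move=> a x y; rewrite /free_map_fun scaler_sumr -big_split /=.
by apply: eq_bigr => i _; rewrite !mxE scalerDl scalerA.
Qed.
Definition free_map n M (e : 'I_n -> M) : {linear free n -> M} := mklin (free_map_linear e).
Lemma free_expand n M (f : {linear free n -> M}) x :
  f x = \sum_i (x : 'rV[A^c]_n) 0 i *: f (delta_mx 0 i).
Proof.
rewrite {1}(row_sum_delta (x : 'rV[A^c]_n)) linear_sum; apply: eq_bigr => i _.
by rewrite linearZ.
Qed.

Lemma free_projective n : projective (free n).
Proof.
move=> M N g f gs; have H i : {y | g y = f (delta_mx 0 i)} by apply/cid/gs.
exists (free_map (fun i => sval (H i))) => x.
rewrite [RHS]free_expand /= linear_sum; apply: eq_bigr => i _.
by rewrite linearZ /= (svalP (H i)).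
Qed.

Lemma free_cover M : exists n (p : {linear free n -> M}), surj p.
Proof.
have [n [e eP]] := fgmod_fin_gen M; exists n, (free_map e) => y.
have [a ->] := eP y; exists (\row_i a i : 'rV[A^c]_n).
by apply: eq_bigr => i _; rewrite mxE.
Qed.

Lemma proj_cover M : exists P (p : {linear P -> M}), projective P /\ surj p.
Proof.
by have [n [p ps]] := free_cover M; exists (free n), p; split=> //; exact: free_projective.
Qed.

Lemma proj_cover_ses M : exists K P (i : {linear K -> P}) (p : {linear P -> M}),
  projective P /\ ses i p.
Proof.
have [P [p [Pp ps]]] := proj_cover M; have [K [i ip]] := ker_ses ps.
by exists K, P, i, p.
Qed.

Fixpoint lpow X (f : {linear X -> X}) n : {linear X -> X} :=
  if n is n'.+1 then lcomp f (lpow f n') else idlin X.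
Lemma lpowE X (f : {linear X -> X}) n x : lpow f n x = iter n f x.
Proof. by elim: n => //= n ->. Qed.

(** Take n such that the image I of f^(n+1) has least dimension. Then
    f^(n+1) maps I onto itself, hence bijectively, and the inverse of this
    bijection splits off I. *)
Lemma fitting X (f : {linear X -> X}) :
  exists n I (i : {linear I -> X}) (r : {linear X -> I}),
   [/\ forall y, r (i y) = y, forall y, exists x, i y = lpow f n.+1 x &
       forall x, exists y, i y = lpow f n.+1 x].
Proof.
pose has m := `[< exists n I (p : {linear X -> I}) (i : {linear I -> X}),
   [/\ surj p, injective i, forall x, i (p x) = lpow f n.+1 x & kdim I = m] >].
have h0 : exists m, has m.
  have [I [p [i [ps ii ip]]]] := img_ex (lpow f 1).
  by exists (kdim I); apply/asboolP; exists 0%N, I, p, i.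
case: (ex_minnP h0) => m /asboolP[n [I [p [i [ps ii ip Im]]]]] mmin.
have [I2 [p2 [i2 [ps2 ii2 ip2]]]] := img_ex (lpow f (n + n.+1).+1).
have le : (kdim I <= kdim I2)%N.
  by rewrite Im; apply: mmin; apply/asboolP; exists (n + n.+1)%N, I2, p2, i2.
have E2 x : lpow f (n + n.+1).+1 x = lpow f n.+1 (lpow f n.+1 x).
  by rewrite !lpowE -addSn iterD.
have [|j jE] := fact_inj (f := i2) ii.
  move=> y; have [x <-] := ps2 y; exists (p (lpow f n.+1 x)).
  by rewrite ip ip2 E2.
have ji : injective j by move=> x y /(congr1 i); rewrite !jE => /ii2.
have [le' js] := kdim_inj ji.
have {}js : surj j by apply: js; apply/eqP; rewrite eqn_leq le'.
pose u := lcomp p i.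
have us : surj u.
  move=> y; have [z <-] := js y; have [x <-] := ps2 z; exists (p x); apply: ii.
  by rewrite jE /= ip2 ip [X in lpow f n.+1 X]ip -E2.
have ui : injective u by apply: (kdim_surj us).2.
have [w [uK wK]] := iso_bij ui us.
exists n, I, i, (lcomp w p); split.
- by move=> y; rewrite /= -[p (i y)]/(u y) uK.
- by move=> y; have [x <-] := ps y; exists x.
- by move=> x; exists (p x).
Qed.
End Modules.

(** * Vanishing of Ext by injective cosyzygies *)

Section Ext.
Context {k : fieldType} {A : falgType k}.
Implicit Types C E F G I J K M N P Q T V W X Y Z : fgmod A.

Lemma hull_ex N : exists J (i : {linear N -> J}), injective i /\ injmod J.
Proof.
by exists (coind N), (coind_in N); split; [exact: coind_in_inj | exact: coind_injmod].
Qed.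
Definition hull N : fgmod A := sval (cid (hull_ex N)).
Definition hull_in N : {linear N -> hull N} := sval (cid (svalP (cid (hull_ex N)))).
Lemma hull_inj N : injective (hull_in N).
Proof. exact: (svalP (cid (svalP (cid (hull_ex N))))).1. Qed.
Lemma hull_injmod N : injmod (hull N).
Proof. exact: (svalP (cid (svalP (cid (hull_ex N))))).2. Qed.

Definition cosyz N : fgmod A := sval (cid (coker_ses (@hull_inj N))).
Definition cosyz_proj N : {linear hull N -> cosyz N} :=
  sval (cid (svalP (cid (coker_ses (@hull_inj N))))).
Lemma cosyz_ses N : ses (hull_in N) (cosyz_proj N).
Proof. exact: (svalP (cid (svalP (cid (coker_ses (@hull_inj N)))))). Qed.

(** Ext^1(X, N) is the cokernel of Hom(X, hull N) -> Hom(X, cosyz N). *)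
Definition ext1_van X N := forall u : {linear X -> cosyz N},
  exists v : {linear X -> hull N}, forall x, cosyz_proj N (v x) = u x.

(** Shifting the second variable leaves the first one free, so that long
    exact sequences in the first variable come directly from ext1_van. *)
Definition ext_van n X N :=
  if n is n'.+1 then ext1_van X (iter n' cosyz N) else forall (f : {linear X -> N}) x, f x = 0.

Lemma ext_vanS n X N : ext_van n.+2 X N = ext_van n.+1 X (cosyz N).
Proof. by rewrite /ext_van iterSr. Qed.

(** The module N2 embeds in N3 + hull N1, which turns the lifting problem
    along p into one along hull N1 -> cosyz N1. *)
Lemma ext1_van_lift X N1 N2 N3 (i : {linear N1 -> N2}) (p : {linear N2 -> N3})
    (f : {linear X -> N3}) : ext1_van X N1 -> ses i p ->
  exists h : {linear X -> N2}, forall x, p (h x) = f x.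
Proof.
move=> eX [ii ie ps]; have [ji je js] := cosyz_ses N1.
have [|a aE] := @hull_injmod N1 _ _ i (hull_in N1).
  by move=> x /(inj_eq0 ii) ->; rewrite linear0.
have [|b bE] := fact_coker (f := lcomp (cosyz_proj N1) a) ie ps.
  by move=> x; rewrite [LHS]/= aE (exact_comp x je).
have [v vE] := eX (lcomp b f).
(* The embedding of N2 in N3 + hull N1. *)
have ki : injective (pair_lin p a).
  apply: inj0 => y; rewrite pair_linE => -[/ie[x <-]].
  by rewrite aE => /(inj_eq0 ji) ->; rewrite linear0.
have [|h hE] := fact_inj (f := pair_lin f v) ki.
  move=> x; have [y yE] := ps (f x).
  have /je[n nE] : cosyz_proj N1 (v x - a y) = 0.
    by rewrite linearB vE /= -yE bE subrr.
  exists (y + i n); rewrite !pair_linE linearD (exact_comp n ie) addr0 yE.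
  by rewrite linearD aE nE addrC subrK.
by exists h => x; have := hE x; rewrite !pair_linE => -[].
Qed.

(** A map u into cosyz N lifts to hull N as soon as the extension pulled
    back along u splits. *)
Lemma ext1_van_split X N :
  (forall E (i : {linear N -> E}) (p : {linear E -> X}), ses i p ->
     exists s : {linear X -> E}, forall x, p (s x) = x) -> ext1_van X N.
Proof.
move=> H u; have [ji je js] := cosyz_ses N.
have [E [p [q [pq E1 E2 E3]]]] := pullback_ex u (cosyz_proj N).
have [|i iE] := E3 _ (zero_lin N X) (hull_in N).
  by move=> n; rewrite linear0 (exact_comp n je).
have [|s sE] := H E i p.
  split.
  - by apply: inj0 => n n0; apply: (inj_eq0 ji); rewrite -(iE n).2 n0 linear0.
  - move=> e; split=> [e0|[n <-]]; last by rewrite (iE n).1.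
    have [|n nE] := (je (q e)).1; first by rewrite -pq e0 linear0.
    exists n; apply/eqP; rewrite -subr_eq0; apply/eqP; apply: E2.
      by rewrite linearB (iE n).1 e0 subrr.
    by rewrite linearB (iE n).2 nE subrr.
  - move=> x; have [y yE] := js (u x).
    by have [|e [<- _]] := E1 x y; [rewrite yE | exists e].
by exists (lcomp q s) => x; rewrite [LHS]/= -pq sE.
Qed.

Lemma ext1_van_extend X1 X2 X3 N (i : {linear X1 -> X2}) (p : {linear X2 -> X3})
    (f : {linear X1 -> N}) : ext1_van X3 N -> ses i p ->
  exists g : {linear X2 -> N}, forall x, g (i x) = f x.
Proof.
move=> eX [ii ie ps]; have [ji je js] := cosyz_ses N.
have [|a aE] := @hull_injmod N _ _ i (lcomp (hull_in N) f).
  by move=> x /(inj_eq0 ii) ->; rewrite linear0.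
have [|b bE] := fact_coker (f := lcomp (cosyz_proj N) a) ie ps.
  by move=> x; rewrite [LHS]/= aE (exact_comp _ je).
have [v vE] := eX b.
have [|g gE] := fact_ker (f := sub_lin a (lcomp v p)) ji je.
  by move=> y; rewrite /= linearB vE bE subrr.
exists g => x; apply: ji.
by rewrite gE /= (exact_comp x ie) linear0 subr0 aE.
Qed.

(** The suffixes _mid, _coker and _ker, here and in the lemmas on ext_van,
    name the term of a short exact sequence in the first variable that
    inherits the vanishing from the neighbouring terms of the long exact
    sequence. *)
Lemma ext1_van_fst_mid X1 X2 X3 N (i : {linear X1 -> X2}) (p : {linear X2 -> X3}) :
  ses i p -> ext1_van X1 N -> ext1_van X3 N -> ext1_van X2 N.
Proof.
move=> [ii ie ps] e1 e3 u; have [v vE] := e1 (lcomp u i).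
have [|w wE] := @hull_injmod N _ _ i v.
  by move=> x /(inj_eq0 ii) ->; rewrite linear0.
have [|b bE] := fact_coker (f := sub_lin u (lcomp (cosyz_proj N) w)) ie ps.
  by move=> x; rewrite /= wE vE subrr.
have [c cE] := e3 b; exists (add_lin (lcomp c p) w) => x.
by rewrite /= linearD cE bE /= subrK.
Qed.

Lemma ext1_van_fst_coker X1 X2 X3 N (i : {linear X1 -> X2}) (p : {linear X2 -> X3}) :
  ses i p -> (forall f : {linear X1 -> N}, exists g : {linear X2 -> N}, forall x, g (i x) = f x) ->
  ext1_van X2 N -> ext1_van X3 N.
Proof.
move=> [ii ie ps] e1 e2 u; have [ji je js] := cosyz_ses N.
have [v vE] := e2 (lcomp u p).
have [|f fE] := fact_ker (f := lcomp v i) ji je.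
  by move=> x; rewrite [LHS]/= vE /= (exact_comp x ie) linear0.
have [g gE] := e1 f.
have [|w wE] := fact_coker (f := sub_lin v (lcomp (hull_in N) g)) ie ps.
  by move=> x; rewrite [LHS]/= gE fE subrr.
exists w => x; have [y <-] := ps x; rewrite wE /= linearB vE.
by rewrite (exact_comp _ je) subr0.
Qed.

Lemma ext1_van_extend_cosyz X1 X2 N (i : {linear X1 -> X2}) : injective i -> ext1_van X1 N ->
  forall f : {linear X1 -> cosyz N}, exists g : {linear X2 -> cosyz N}, forall x, g (i x) = f x.
Proof.
move=> ii e1 f; have [v vE] := e1 f.
have [|w wE] := @hull_injmod N _ _ i v.
  by move=> x /(inj_eq0 ii) ->; rewrite linear0.
by exists (lcomp (cosyz_proj N) w) => x; rewrite [LHS]/= wE vE.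
Qed.

Lemma ext1_van_fst_ker X1 X2 X3 N (i : {linear X1 -> X2}) (p : {linear X2 -> X3}) :
  ses i p -> ext1_van X2 N -> ext1_van X3 (cosyz N) -> ext1_van X1 N.
Proof.
move=> s e2 e3 u; have [w wE] := ext1_van_extend u e3 s.
have [v vE] := e2 w; exists (lcomp v i) => x.
by rewrite [LHS]/= vE wE.
Qed.

Lemma ext1_van_retract X Y N : retract X Y -> ext1_van Y N -> ext1_van X N.
Proof.
move=> [i [r ri]] eY u; have [v vE] := eY (lcomp u r).
by exists (lcomp v i) => x; rewrite [LHS]/= vE /= ri.
Qed.

Lemma ext1_van_proj X N : projective X -> ext1_van X N.
Proof. by move=> Xp u; apply: Xp; case: (cosyz_ses N). Qed.

Lemma injmod_retract X Y : retract X Y -> injmod Y -> injmod X.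
Proof.
move=> [i [r ri]] Yi U V j f H; have [|g gE] := Yi U V j (lcomp i f).
  by move=> x /H /= ->; rewrite linear0.
by exists (lcomp r g) => x; rewrite /= gE /= ri.
Qed.

Lemma injmod_cosyz_section N : injmod N -> exists s : {linear cosyz N -> hull N},
  forall x, cosyz_proj N (s x) = x.
Proof.
move=> Ni; have [ji je js] := cosyz_ses N.
have [|r rE] := Ni _ _ (hull_in N) (idlin N).
  by move=> x /(inj_eq0 ji) ->; rewrite linear0.
have [|s sE] := fact_coker (f := sub_lin (idlin _) (lcomp (hull_in N) r)) je js.
  by move=> x; rewrite /= rE subrr.
exists s => x; have [y <-] := js x; rewrite sE /= linearB.
by rewrite (exact_comp _ je) subr0.
Qed.

Lemma injmod_cosyz N : injmod N -> injmod (cosyz N).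
Proof.
move=> Ni; have [s sE] := injmod_cosyz_section Ni.
apply: injmod_retract (@hull_injmod N).
by exists s, (cosyz_proj N).
Qed.

Lemma ext1_van_inj X N : injmod N -> ext1_van X N.
Proof.
move=> Ni u; have [s sE] := injmod_cosyz_section Ni.
by exists (lcomp s u) => x; rewrite [LHS]/= sE.
Qed.

Lemma ext_van_inj n X N : injmod N -> ext_van n.+1 X N.
Proof.
move=> Ni; apply: ext1_van_inj; elim: n => //= n; exact: injmod_cosyz.
Qed.
Lemma ext_van_proj n X N : projective X -> ext_van n.+1 X N.
Proof. by move=> Xp; apply: ext1_van_proj. Qed.

Lemma ext_van_fst_mid n X1 X2 X3 N (i : {linear X1 -> X2}) (p : {linear X2 -> X3}) :
  ses i p -> ext_van n X1 N -> ext_van n X3 N -> ext_van n X2 N.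
Proof.
case: n => [|n] s; last exact: ext1_van_fst_mid s.
move=> e1 e3 f x; have [ii ie ps] := s.
by have [y|g gE] := fact_coker (f := f) ie ps; [apply: (e1 (lcomp f i)) | rewrite -gE e3].
Qed.

Lemma ext_van_fst_coker n X1 X2 X3 N (i : {linear X1 -> X2}) (p : {linear X2 -> X3}) :
  ses i p -> ext_van n X1 N -> ext_van n.+1 X2 N -> ext_van n.+1 X3 N.
Proof.
move=> s e1; apply: (ext1_van_fst_coker s); case: n e1 => [|n] e1 f.
  by exists (zero_lin _ _) => x; rewrite [RHS]e1.
by case: s => ii _ _; exact: ext1_van_extend_cosyz.
Qed.

Lemma ext_van_fst_quot X1 X2 X3 N (i : {linear X1 -> X2}) (p : {linear X2 -> X3}) :
  ses i p -> ext_van 0 X2 N -> ext_van 0 X3 N.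
Proof.
move=> [_ _ ps] e2 f x; have [y <-] := ps x; exact: (e2 (lcomp f p)).
Qed.

Lemma ext_van_fst_ker n X1 X2 X3 N (i : {linear X1 -> X2}) (p : {linear X2 -> X3}) :
  ses i p -> ext_van n X2 N -> ext_van n.+1 X3 N -> ext_van n X1 N.
Proof.
case: n => [|n] s; last exact: ext1_van_fst_ker s.
move=> e2 e3 f x; have [g gE] := ext1_van_extend f e3 s.
by rewrite -gE e2.
Qed.

Lemma ext_van_retract n X Y N : retract X Y -> ext_van n Y N -> ext_van n X N.
Proof.
case: n => [|n]; last exact: ext1_van_retract.
by move=> [i [r ri]] H f x; rewrite -(ri x); apply: (H (lcomp f r)).
Qed.

End Ext.

(** * Cohomology of Hom complexes and projective resolutions *)

Section HomCohomology.
Context {k : fieldType} {A : falgType k}.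
Implicit Types C E F G I J K M N P Q T V W X Z : fgmod A.
Implicit Types Y : complex A.

(** The neighbours h and j of i are quantified, not written as i - 1 and i
    + 1, so that degrees need not be rewritten inside types. *)
Definition coh_van Y N (i : int) := forall h j : int, h + 1 = i -> i + 1 = j ->
  forall f : {linear Y i -> N}, (forall x, f (cx_d Y h i x) = 0) ->
  exists g : {linear Y j -> N}, forall x, f x = g (cx_d Y i j x).

Lemma coh_vanP Y N i : (forall f : {linear Y i -> N}, (forall x, f (cx_d Y (i - 1) i x) = 0) ->
  exists g : {linear Y (i + 1) -> N}, forall x, f x = g (cx_d Y i (i + 1) x)) <-> coh_van Y N i.
Proof.
split=> [H h j hi ij|H]; last by apply: H => //; rewrite subrK.
have e : h = i - 1 by rewrite -hi addrK.
by subst h; subst j.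
Qed.

Definition cxproj Y := forall i, projective (Y i).

(** Since Y consists of projectives, a short exact sequence of modules
    gives a long exact sequence for the cohomology of Hom(Y, -); the
    suffixes _mid, _left and _right name the module that inherits the
    vanishing. *)
Lemma coh_van_mid Y N1 N2 N3 (a : {linear N1 -> N2}) (p : {linear N2 -> N3}) i :
  cxproj Y -> ses a p -> coh_van Y N1 i -> coh_van Y N3 i -> coh_van Y N2 i.
Proof.
move=> Yp [ai ae ps] h1 h3 h j hi ij f fd.
have [|g gE] := h3 h j hi ij (lcomp p f); first by move=> x; rewrite /= fd linear0.
have [g' gE'] := Yp j _ _ p g ps.
have [|f1 fE] := fact_ker (f := sub_lin f (lcomp g' (cx_d Y i j))) ai ae.
  by move=> x; rewrite /= linearB (gE x : p (f x) = _) gE' subrr.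
have [|g1 gE1] := h1 h j hi ij f1.
  by move=> x; apply: ai; rewrite fE /= fd cx_dd !linear0 ?subr0 ?addr0.
exists (add_lin (lcomp a g1) g') => x.
by rewrite /= -gE1 fE subrK.
Qed.

Lemma coh_van_left Y N1 N2 N3 (a : {linear N1 -> N2}) (p : {linear N2 -> N3}) i j :
  cxproj Y -> ses a p -> i + 1 = j -> coh_van Y N2 i -> coh_van Y N3 j -> coh_van Y N1 i.
Proof.
move=> Yp [ai ae ps] ij h2 h3 h j' hi ij' f fd; subst j; subst j'.
have [|g gE] := h2 h (i + 1) hi erefl (lcomp a f); first by move=> x; rewrite /= fd linear0.
have [|g3 gE3] := h3 i (i + 1 + 1) erefl erefl (lcomp p g).
  by move=> x; rewrite /= -(gE x : a (f x) = _) (exact_comp _ ae).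
have [g' gE'] := Yp (i + 1 + 1) _ _ p g3 ps.
have [|g1 gE1] := fact_ker (f := sub_lin g (lcomp g' (cx_d Y (i + 1) (i + 1 + 1)))) ai ae.
  by move=> x; rewrite /= linearB gE' -(gE3 x : p (g x) = _) subrr.
by exists g1 => x; apply: ai; rewrite gE1 /= -(gE x : a (f x) = _) cx_dd linear0 ?subr0 ?addr0.
Qed.

Lemma coh_van_right Y N1 N2 N3 (a : {linear N1 -> N2}) (p : {linear N2 -> N3}) h i :
  cxproj Y -> ses a p -> h + 1 = i -> coh_van Y N2 i -> coh_van Y N1 h -> coh_van Y N3 i.
Proof.
move=> Yp [ai ae ps] hi h2 h1 h' j hi' ij f fd.
have e : h' = h by apply: (addIr 1); rewrite hi'.
subst h'; have [f' fE'] := Yp i _ _ p f ps.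
have [|g gE] := fact_ker (f := lcomp f' (cx_d Y h i)) ai ae.
  by move=> x; rewrite /= fE'.
have [|g1 gE1] := h1 (h - 1) i (subrK _ _) hi g.
  by move=> x; apply: ai; rewrite gE /= cx_dd !linear0.
have [|g2 gE2] := h2 h j hi ij (sub_lin f' (lcomp a g1)).
  by move=> x; rewrite /= -gE1 gE /= subrr.
exists (lcomp p g2) => x; rewrite /= -gE2 /= linearB fE'.
by rewrite (exact_comp _ ae) subr0.
Qed.

Lemma coh_van_add Y i : add_closed (fun N => coh_van Y N i).
Proof.
split.
- move=> N N0 h j hi ij f _; exists (zero_lin _ _) => x; exact: N0.
- move=> N N' [a [r ra]] H h j hi ij f fd.
  have [|g gE] := H h j hi ij (lcomp a f); first by move=> x; rewrite /= fd linear0.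
  by exists (lcomp r g) => x; rewrite /= -gE /= ra.
- move=> N N' H H' h j hi ij f fd.
  have [|g gE] := H h j hi ij (lcomp (fst_lin N N') f); first by move=> x; rewrite /= fd.
  have [|g' gE'] := H' h j hi ij (lcomp (snd_lin N N') f); first by move=> x; rewrite /= fd.
  by exists (pair_lin g g') => x; rewrite pair_linE -gE -gE' /=; case: (f x).
Qed.
End HomCohomology.

Section Resolutions.
Context {k : fieldType} {A : falgType k}.
Implicit Types C E F G I J K M N Q T V W X Z : fgmod A.
Implicit Types P : complex A.

Lemma res_exact M P (eps : {linear P 0 -> M}) (h i j : int) :
  proj_resolution eps -> h + 1 = i -> i + 1 = j -> i < 0 ->
  exact_at (cx_d P h i) (cx_d P i j).
Proof.
move=> [_ _ _ _ e] hi ij i0; have hE : h = i - 1 by rewrite -hi addrK.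
by subst h; subst j; exact: e.
Qed.

Lemma res_exact0 M P (eps : {linear P 0 -> M}) (h : int) :
  proj_resolution eps -> h + 1 = 0 -> exact_at (cx_d P h 0) eps.
Proof.
move=> [_ _ _ e _] h0; have hE : h = -1 by lia.
by subst h.
Qed.

Lemma coh_van_injmod M P (eps : {linear P 0 -> M}) J n : proj_resolution eps -> injmod J ->
  coh_van P J (- n.+1%:Z).
Proof.
move=> Pe Ji h j hi ij f fd.
have i0 : - n.+1%:Z < 0 by lia.
have [|g gE] := Ji _ _ (cx_d P (- n.+1%:Z) j) f.
  by move=> x /(res_exact Pe hi ij i0)[y <-]; exact: fd.
by exists g => x; rewrite gE.
Qed.

Lemma coh_van_hom M P (eps : {linear P 0 -> M}) N : proj_resolution eps ->
  coh_van P N 0 <-> ext_van 0 M N.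
Proof.
move=> Pe; have [P1 Pp es e0 _] := Pe; split.
  move=> H f y; have [|g gE] := H (-1) 1 erefl erefl (lcomp f eps).
    by move=> x; rewrite /= (exact_comp x e0) linear0.
  by have [x <-] := es y; rewrite (gE x : f (eps x) = _) (P1 1 _ (cx_d P 0 1 x)) ?linear0.
move=> H h j h0 ij f fd; exists (zero_lin _ _) => x.
have [y|g gE] := fact_coker (f := f) (res_exact0 Pe h0) es; first exact: fd.
by rewrite -gE H.
Qed.

Lemma coh_van_ext1 M P (eps : {linear P 0 -> M}) N : proj_resolution eps ->
  coh_van P N (-1) <-> ext1_van M N.
Proof.
move=> Pe; have [P1 Pp es e0 _] := Pe; have [ji je js] := cosyz_ses N.
split=> [H u|H h j hi ij f fd].
  have [a aE] := Pp 0 _ _ (cosyz_proj N) (lcomp u eps) js.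
  have [|f fE] := fact_ker (f := lcomp a (cx_d P (-1) 0)) ji je.
    by move=> x; rewrite [LHS]/= aE /= (exact_comp x e0) linear0.
  have [|g gE] := H (-2) 0 erefl erefl f.
    by move=> x; apply: ji; rewrite fE /= cx_dd !linear0.
  have [|v vE] := fact_coker (f := sub_lin a (lcomp (hull_in N) g)) e0 es.
    by move=> x; rewrite /= -gE fE subrr.
  exists v => x; have [y <-] := es x; rewrite vE /= linearB aE.
  by rewrite (exact_comp _ je) subr0.
have j0 : j = 0 by rewrite -ij.
subst j; have [|b bE] := @hull_injmod _ _ N _ _ (cx_d P (-1) 0) (lcomp (hull_in N) f).
  by move=> x /(res_exact Pe hi j0 isT)[y <-] /=; rewrite fd linear0.
have [|u uE] := fact_coker (f := lcomp (cosyz_proj N) b) e0 es.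
  by move=> x; rewrite [LHS]/= bE (exact_comp _ je).
have [v vE] := H u.
have [|g gE] := fact_ker (f := sub_lin b (lcomp v eps)) ji je.
  by move=> x; rewrite /= linearB vE uE subrr.
exists g => x; apply: ji; rewrite gE /= (exact_comp x e0) linear0 subr0.
by rewrite bE.
Qed.

(** Both sides shift along 0 -> N -> hull N -> cosyz N -> 0, because Hom(P,
    hull N) is exact in negative degrees; this reduces the claim to n at
    most 1. In particular the vanishing does not depend on the resolution. *)
Lemma coh_van_extP M P (eps : {linear P 0 -> M}) n N : proj_resolution eps ->
  coh_van P N (- n%:Z) <-> ext_van n M N.
Proof.
move=> Pe; have Pp : cxproj P by case: Pe.
case: n => [|n]; first by rewrite oppr0; exact: coh_van_hom Pe.
elim: n N => [|n IH] N; first exact: coh_van_ext1 Pe.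
rewrite ext_vanS -IH; have Hi m := coh_van_injmod (n := m) Pe (@hull_injmod _ _ N).
have e : - n.+2%:Z + 1 = - n.+1%:Z by lia.
split=> H; first exact: (coh_van_right Pp (cosyz_ses N) e (Hi _) H).
exact: (coh_van_left Pp (cosyz_ses N) e (Hi _) H).
Qed.

Definition cov M : fgmod A := sval (cid (proj_cover M)).
Definition cov_map M : {linear cov M -> M} := sval (cid (svalP (cid (proj_cover M)))).
Lemma cov_proj M : projective (cov M).
Proof. exact: (svalP (cid (svalP (cid (proj_cover M))))).1. Qed.
Lemma cov_surj M : surj (cov_map M).
Proof. exact: (svalP (cid (svalP (cid (proj_cover M))))).2. Qed.

Definition syz M : fgmod A := sval (cid (ker_ses (@cov_surj M))).
Definition syz_in M : {linear syz M -> cov M} :=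
  sval (cid (svalP (cid (ker_ses (@cov_surj M))))).
Lemma syz_ses M : ses (syz_in M) (cov_map M).
Proof. exact: (svalP (cid (svalP (cid (ker_ses (@cov_surj M)))))). Qed.

Section CanonicalResolution.
Variable M : fgmod A.
Definition crF n : fgmod A := cov (iter n syz M).
Definition crD n : {linear crF n.+1 -> crF n} :=
  lcomp (syz_in (iter n syz M)) (cov_map (iter n.+1 syz M)).
(** Extended by zero to all pairs of indices, as required of the
    differential of a complex. *)
Definition crD' m n : {linear crF m -> crF n} :=
  match m =P n.+1 with
  | ReflectT e => lcomp (crD n) (match e in _ = m' return {linear crF m -> crF m'} with
                                | erefl => idlin _ end)
  | ReflectF _ => \0
  end.
Lemma crD'E n x : crD' n.+1 n x = crD n x.
Proof. by rewrite /crD'; case: eqP => // e; rewrite (eq_axiomK e). Qed.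
Lemma crD'0 m n x : m != n.+1 -> crD' m n x = 0.
Proof. by rewrite /crD'; case: eqP. Qed.

Lemma crD_exact n : exact_at (crD n.+1) (crD n).
Proof.
have [ii ie ps] := syz_ses (iter n syz M).
have [ii' ie' ps'] := syz_ses (iter n.+1 syz M).
move=> y; split=> [/(inj_eq0 ii)/ie'[x <-]|[x <-]].
  by have [z <-] := @cov_surj (iter n.+2 syz M) x; exists z.
by rewrite /= (exact_comp _ ie') linear0.
Qed.

Definition cr_obj (i : int) : fgmod A :=
  match i with Posz 0 => crF 0 | Posz _.+1 => zeromod | Negz n => crF n.+1 end.
Definition cr_d (i j : int) : {linear cr_obj i -> cr_obj j} :=
  match i, j return {linear cr_obj i -> cr_obj j} with
  | Negz m, Negz n => crD' m.+1 n.+1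
  | Negz m, Posz 0 => crD' m.+1 0
  | _, _ => \0
  end.
Lemma cr_shape (i j : int) : j != i + 1 -> forall x, cr_d i j x = 0.
Proof.
case: i => [[|i]|i]; case: j => [[|j]|j] //= ij x; apply: crD'0; move: ij.
  by apply: contra_neq => -[->].
by apply: contra_neq => -[->]; rewrite !NegzE; lia.
Qed.
Lemma crD'_comp m n l x : crD' n l (crD' m n x) = 0.
Proof.
case: (eqVneq n l.+1) => [?|nl]; last by rewrite crD'0.
subst n; case: (eqVneq m l.+2) => [?|ml]; last by rewrite (crD'0 _ ml) linear0.
by subst m; rewrite !crD'E; apply: exact_comp; exact: crD_exact.
Qed.
Lemma cr_dd (i j l : int) x : cr_d j l (cr_d i j x) = 0.
Proof.
case: i x => [[|i]|i] x; case: j => [[|j]|j]; case: l => [[|l]|l] //=;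
  rewrite ?linear0 //; exact: crD'_comp.
Qed.
Definition canres : complex A := Complex cr_shape cr_dd.
Definition canres_aug : {linear canres 0 -> M} := cov_map M.

Lemma canresP : proj_resolution canres_aug.
Proof.
have [ii ie ps] := syz_ses M; split.
- by case=> [[|i]|i] // _; exact: zeromod0.
- case=> [[|i]|i]; [exact: cov_proj| |exact: cov_proj].
  by case: (@proj_add k A) => H _ _; apply/H/zeromod0.
- exact: ps.
- move=> y; rewrite ie; split=> -[x <-].
    have [z <-] := @cov_surj (syz M) x; exists z.
    exact: crD'E.
  by exists (cov_map (syz M) x); rewrite [RHS]crD'E.
- case=> // n _; have -> : Negz n - 1 = Negz n.+1 by rewrite !NegzE; lia.
  have e m : exact_at (crD' m.+2 m.+1) (crD' m.+1 m).
    move=> y; rewrite crD'E crD_exact.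
    by split=> -[x <-]; exists x; rewrite crD'E.
  case: n => [|n]; first exact: e.
  have -> : Negz n.+1 + 1 = Negz n by rewrite !NegzE; lia.
  exact: e.
Qed.
End CanonicalResolution.

Lemma res_ex M : exists P (eps : {linear P 0 -> M}), proj_resolution eps.
Proof. by exists (canres M), (canres_aug M); exact: canresP. Qed.

Lemma ext_zeroP n X N : ext_zero n X N <-> ext_van n X N.
Proof.
split=> [[P [eps [Pe H]]]|H]; first by rewrite -(coh_van_extP n N Pe) -coh_vanP.
have [P [eps Pe]] := res_ex X; exists P, eps; split=> //.
by move: H; rewrite -(coh_van_extP n N Pe) -coh_vanP.
Qed.

Lemma ext_van_left n X N1 N2 N3 (a : {linear N1 -> N2}) (p : {linear N2 -> N3}) :
  ses a p -> ext_van n.+1 X N2 -> ext_van n X N3 -> ext_van n.+1 X N1.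
Proof.
move=> s; have [P [eps Pe]] := res_ex X; have Pp : cxproj P by case: Pe.
rewrite -!(coh_van_extP _ _ Pe); apply: coh_van_left s _ => //; lia.
Qed.

(** An extension of X by N1 becomes split over N2. The splitting induces a
    map X -> N3, and subtracting a lift of it to N2 makes the splitting
    take values in N1. *)
Lemma ext1_van_left X N1 N2 N3 (a : {linear N1 -> N2}) (p : {linear N2 -> N3}) :
  ses a p -> ext_van 1 X N2 ->
  (forall f : {linear X -> N3}, exists g : {linear X -> N2}, forall x, p (g x) = f x) ->
  ext_van 1 X N1.
Proof.
move=> [ai ae ps] e2 H; apply: ext1_van_split => E i q [ii ie qs].
have [|r rE] := ext1_van_extend (X2 := E) a (_ : ext1_van X N2) (And3 ii ie qs).
  exact: e2.
have [|u uE] := fact_coker (f := lcomp p r) ie qs.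
  by move=> n; rewrite [LHS]/= rE (exact_comp _ ae).
have [v vE] := H u.
have [|w wE] := fact_ker (f := sub_lin r (lcomp v q)) ai ae.
  by move=> y; rewrite /= linearB vE uE subrr.
have wi n : w (i n) = n.
  by apply: ai; rewrite wE /= (exact_comp n ie) linear0 subr0 rE.
have [|s sE] := fact_coker (f := sub_lin (idlin E) (lcomp i w)) ie qs.
  by move=> n; rewrite /= wi subrr.
exists s => x; have [y <-] := qs x; rewrite sE /= linearB.
by rewrite (exact_comp _ ie) subr0.
Qed.
End Resolutions.

(** * Modules perpendicular to a d-torsion class *)

Section Torsion.
Context {k : fieldType} {A : falgType k}.
Implicit Types B C E F G I J K N Q T V W X Y Z : fgmod A.
Variables (d : nat) (M U : fgmod A -> Prop).
Hypotheses (d_gt0 : (1 <= d)%N) (M_ct : cluster_tilting d M) (U_tors : torsion_class d M U).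

Lemma M_ext X N i : M X -> M N -> (0 < i < d)%N -> ext_van i X N.
Proof.
move=> MX MN id; apply/ext_zeroP; case: M_ct => _ _ H _.
by apply: (H X).1 => //; lia.
Qed.

Lemma M_of_ext_l X : (forall N i, M N -> (0 < i < d)%N -> ext_van i X N) -> M X.
Proof.
move=> H; case: M_ct => _ _ H' _; apply/H' => N i MN id.
by apply/ext_zeroP/H => //; lia.
Qed.

Lemma M_of_ext_r X : (forall N i, M N -> (0 < i < d)%N -> ext_van i N X) -> M X.
Proof.
move=> H; case: M_ct => _ _ _ H'; apply/H' => N i MN id.
by apply/ext_zeroP/H => //; lia.
Qed.

Lemma M_inj J : injmod J -> M J.
Proof. by move=> Ji; apply: M_of_ext_r => N [|i] // _ _; exact: ext_van_inj. Qed.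

Lemma M_proj X : projective X -> M X.
Proof. by move=> Xp; apply: M_of_ext_l => N [|i] // _ _; exact: ext_van_proj. Qed.

Lemma U_sub_M X : U X -> M X. Proof. by case: U_tors => _ H _; exact: H. Qed.
Lemma U_add : add_closed U. Proof. by case: U_tors => /subcategory_add. Qed.
Lemma U_retract X Y : retract X Y -> U Y -> U X.
Proof. by case: U_add => _ H _; exact: H. Qed.

(** The substitute for the torsion-free class: it contains the quotient of
    an object of M by its torsion part, which for d > 1 may lie outside M. *)
Definition right_perp G := forall X n, U X -> (n < d)%N -> ext_van n X G.

(** The quotient G is the kernel of V 0 -> V 1. For the kernel K of any V j
    -> V j.+1, exactness of Hom(Y, V) for Y in U gives Ext^1(Y, K) = 0, and
    higher Ext are shifted along 0 -> K -> V j -> K' -> 0, where K' is the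
    next kernel and Ext^i(Y, V j) = 0 for 0 < i < d. *)
Lemma torsion_ses X : M X -> exists T G (i : {linear T -> X}) (q : {linear X -> G}),
  [/\ U T, right_perp G & ses i q].
Proof.
move=> MX; case: U_tors => _ _ /(_ X MX)[T [V [i [p [v [[UT MV V0] [ii ie pe ve] Uv]]]]]].
have [G [q [j [qs ji jq]]]] := img_ex p.
have je : exact_at j (v 0%N).
  move=> y; rewrite pe; split=> -[x <-]; first by exists (q x); rewrite jq.
  by have [z <-] := qs x; exists z; rewrite jq.
have key i' : forall j' K (c : {linear K -> V j'}) Y, U Y -> (i'.+1 + j' < d)%N ->
    injective c -> exact_at c (v j') -> ext_van i'.+1 Y K.
  elim: i' => [|i' IH] j' K c Y UY lt ci ce.
  - have [K' [c' [ci' ce']]] := ker_ex (v j'.+1).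
    have [|w wE] := fact_ker (f := v j') ci' ce'.
      by move=> x; exact: exact_comp (ve j').
    apply: (@ext1_van_left _ _ Y _ _ _ c w).
    + split=> // [y|y].
        by rewrite -ce -wE; split=> [->|/(inj_eq0 ci') //]; rewrite linear0.
      have /ve[x xE] : v j'.+1 (c' y) = 0 by exact: exact_comp.
      by exists x; apply: ci'; rewrite wE.
    + by apply: M_ext; [exact: U_sub_M | apply: MV; lia | lia].
    + move=> f; have [_ /(_ j' (lcomp c' f))[|g gE]] := Uv Y UY.
        by move=> x; exact: exact_comp ce'.
      by exists g => x; apply: ci'; rewrite wE -gE.
  - have [K' [c' [ci' ce']]] := ker_ex (v j'.+1).
    have [|w wE] := fact_ker (f := v j') ci' ce'.
      by move=> x; exact: exact_comp (ve j').
    apply: (@ext_van_left _ _ i'.+1 Y _ _ _ c w).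
    + split=> // [y|y].
        by rewrite -ce -wE; split=> [->|/(inj_eq0 ci') //]; rewrite linear0.
      have /ve[x xE] : v j'.+1 (c' y) = 0 by exact: exact_comp.
      by exists x; apply: ci'; rewrite wE.
    + by apply: M_ext; [exact: U_sub_M | apply: MV; lia | lia].
    + by apply: (IH _ _ c') => //; lia.
exists T, G, i, q; split=> //.
  move=> Y [|n] UY nd; last by apply: (key n 0%N G j) => //; lia.
  move=> f x; apply: (inj_eq0 ji).
  have [H _] := Uv Y UY; apply: (H (lcomp j f)) => y.
  exact: exact_comp je.
split=> // y; rewrite -ie -jq; split=> [->|/(inj_eq0 ji) //].
by rewrite linear0.
Qed.

(** The extensions and cokernels that occur along a chain of approximations
    stay in this class, and its members are resolved by modules of U
    (left_perp_ures). *)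
Definition left_perp Y := forall G n, right_perp G -> (n < d)%N -> ext_van n Y G.

Lemma U_left_perp X : U X -> left_perp X. Proof. by move=> UX G n; exact. Qed.

Lemma left_perp_coker Z T W (i : {linear Z -> T}) (p : {linear T -> W}) :
  ses i p -> left_perp Z -> left_perp T -> left_perp W.
Proof.
move=> s pZ pT G [|n] gG nd; first by apply: ext_van_fst_quot s _; exact: pT.
by apply: ext_van_fst_coker s _ _; [apply: pZ => //; lia | exact: pT].
Qed.

Lemma left_perp_ext Z T W (i : {linear Z -> T}) (p : {linear T -> W}) :
  ses i p -> left_perp Z -> left_perp W -> left_perp T.
Proof.
by move=> s pZ pW G n gG nd; apply: ext_van_fst_mid s _ _; [exact: pZ | exact: pW].
Qed.

Definition FacU X := exists T (p : {linear T -> X}), U T /\ surj p.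

(** The torsion part of N receives every map from a module generated by U. *)
Lemma Fac_into C N (f : {linear C -> N}) : FacU C -> M N ->
  exists T (i : {linear T -> N}) (g : {linear C -> T}),
    [/\ U T, injective i & forall x, i (g x) = f x].
Proof.
move=> [X [p [UX ps]]] MN; have [T [G [i [q [UT gG [ii ie qs]]]]]] := torsion_ses MN.
have [|g gE] := fact_ker (f := f) ii ie; last by exists T, i, g.
move=> x; have [y <-] := ps x.
exact: (gG X 0%N UX d_gt0 (lcomp q (lcomp f p))).
Qed.

(** Let T be the torsion part of an injective module J containing C. Then
    Ext^(n+1)(X, T) is a quotient of Ext^n(X, J / T), which vanishes. *)
Lemma Fac_embed C : FacU C -> exists T (i : {linear C -> T}),
  [/\ U T, injective i & forall X n, U X -> (n < d)%N -> ext_van n.+1 X T].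
Proof.
move=> [X [p [UX ps]]].
have [T [G [i [q [UT gG s]]]]] := torsion_ses (M_inj (@hull_injmod _ _ C)).
have [ii ie qs] := s.
have [|g gE] := fact_ker (f := hull_in C) ii ie.
  move=> x; have [y <-] := ps x.
  exact: (gG X 0%N UX d_gt0 (lcomp q (lcomp (hull_in C) p))).
exists T, g; split=> // [x y e|Y n UY nd].
  by apply: (@hull_inj _ _ C); rewrite -!gE e.
by apply: ext_van_left s _ _; [apply: ext_van_inj; exact: hull_injmod | exact: gG].
Qed.

Lemma Fac_M C : FacU C -> M C -> U C.
Proof.
move=> FC MC; have [T [i [g [UT ii gE]]]] := Fac_into (idlin C) FC MC.
by apply: (U_retract _ UT); exists g, i.
Qed.

Lemma M_rapprox Y : exists E (e : {linear E -> Y}), [/\ M E, surj e &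
  forall X (f : {linear X -> Y}), M X -> exists h : {linear X -> E}, forall x, e (h x) = f x].
Proof.
case: M_ct => _ [Mc _] _ _; have [E [e [ME eP]]] := Mc Y.
exists E, e; split=> // [|X f MX]; last by have [h hE] := eP X f MX; exists h.
have [P [p [Pp ps]]] := proj_cover Y; have [h hE] := eP P p (M_proj Pp).
by move=> y; have [x <-] := ps y; exists (h x).
Qed.

(** Resolutions of K of length n by right M-approximations. Only the last
    map e of the resolution appears in the type; the earlier ones are
    existential. *)
Inductive mres : nat -> forall K E, {linear E -> K} -> Prop :=
| mres0 K E (e : {linear E -> K}) : M E -> injective e -> surj e -> mres 0 e
| mresS n K E (e : {linear E -> K}) K1 (i : {linear K1 -> E}) E1 (e1 : {linear E1 -> K1}) :
    M E -> ses i e ->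
    (forall X (f : {linear X -> K}), M X -> exists h : {linear X -> E}, forall x, e (h x) = f x) ->
    mres n e1 -> mres n.+1 e.

(** Passing to the kernel of a right M-approximation gains one degree of
    vanishing of Ext(M, -), and a module with Ext^i(M, -) = 0 for all 0 < i
    < d lies in M. *)
Lemma mres_ex n : (n < d)%N -> forall Y,
  (forall N i, M N -> (0 < i)%N -> (i + n < d)%N -> ext_van i N Y) ->
  exists E (e : {linear E -> Y}), mres n e.
Proof.
elim: n => [|n IH] nd Y H.
  exists Y, (idlin Y); apply: mres0 => // [|y]; last by exists y.
  by apply: M_of_ext_r => N i MN id; apply: H => //; lia.
have [E [e [ME es eP]]] := M_rapprox Y; have [K [i s]] := ker_ses es.
have [||E1 [e1 re1]] := IH _ K; first lia; last first.
  by exists E, e; exact: mresS s eP re1.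
move=> N [|[|j]] MN // _ jn.
  apply: (ext1_van_left s); first by apply: (M_ext (i := 1)) => //; lia.
  by move=> f; exact: eP.
by apply: (ext_van_left s); [apply: M_ext => //; lia | apply: H => //; lia].
Qed.

Lemma mres_M n K E (e : {linear E -> K}) : mres n e -> M E.
Proof. by case. Qed.

(** The conclusion says that (phi, h) sends Y into the image of E -> K + G.
    It is used with pi the quotient of E by its torsion part: if also
    Hom(Y, G) = 0, then h = 0 and every phi y comes from the torsion part
    of E.

    In the proof phi is lifted to a projective cover P of Y and, on the
    syzygy, to the next stage of the resolution of K. The induction
    hypothesis provides a map from the syzygy to the torsion-free quotient
    G1 of that stage, which extends to P because Ext^1(Y, G1) = 0; it
    corrects the map P -> G so that it factors through Y. *)
Lemma mres_lift n K E (e : {linear E -> K}) : mres n e ->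
  forall G (pi : {linear E -> G}), right_perp G -> forall Y (phi : {linear Y -> K}),
  (forall G' m, right_perp G' -> (0 < m <= n)%N -> ext_van m Y G') ->
  exists h : {linear Y -> G}, forall y, exists x, e x = phi y /\ pi x = h y.
Proof.
elim=> {n K E e} [K E e ME ei es|n K E e K1 i E1 e1 ME s eP r1 IH] G pi gG Y phi H.
  have [e' [eK eK']] := iso_bij ei es.
  by exists (lcomp pi (lcomp e' phi)) => y; exists (e' (phi y)); rewrite eK'.
have [ii ie es] := s.
have [T1 [G1 [i1 [q1 [UT1 gG1 [ii1 ie1 qs1]]]]]] := torsion_ses (mres_M r1).
(* The torsion part of E1 is killed by E1 -> E -> G, since Hom(U, G) = 0,
   so that this map factors through G1. *)
have [|D DE] := fact_coker (f := lcomp pi (lcomp i e1)) ie1 qs1.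
  by move=> x; exact: (gG T1 0%N UT1 d_gt0 (lcomp pi (lcomp i (lcomp e1 i1)))).
have [K' [P [c [p [Pp sc]]]]] := proj_cover_ses Y; have [ci ce ps] := sc.
have [a aE] := Pp _ _ e (lcomp phi p) es.
have [|phi' phiE] := fact_ker (f := lcomp a c) ii ie.
  by move=> x; rewrite /= aE /= (exact_comp x ce) linear0.
have [|h1 h1E] := IH G1 q1 gG1 K' phi'.
  move=> G' m gG' mn; apply: (ext_van_fst_ker sc); last by apply: H => //; lia.
  by case: m mn => // m _; exact: ext_van_proj.
have [|s1 s1E] := ext1_van_extend h1 _ sc; first by apply: (H G1 1%N).
have [|h hE] := fact_coker (f := sub_lin (lcomp pi a) (lcomp D s1)) ce ps.
  move=> x; have [z [z1 z2]] := h1E x.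
  by rewrite /= s1E -z2 DE /= -[a (c x)]/(lcomp a c x) -phiE z1 subrr.
exists h => y; have [z <-] := ps y; have [x1 x1E] := qs1 (s1 z).
exists (a z - i (e1 x1)); split.
  by rewrite linearB aE (exact_comp _ ie) subr0.
by rewrite linearB hE /= -x1E DE.
Qed.

(** These are the modules to which maps extend along a chain of left
    U-approximations (approx_chain_extend). *)
Inductive ures : nat -> fgmod A -> Prop :=
| ures0 Y : U Y -> ures 0 Y
| uresS n K T Y (i : {linear K -> T}) (p : {linear T -> Y}) : U T -> ses i p ->
    (forall X (f : {linear X -> Y}), U X -> exists h : {linear X -> T}, forall x, p (h x) = f x) ->
    ures n K -> ures n.+1 Y.

(** The torsion parts of the terms of an M-resolution of K resolve Y. Each
    stage is surjective by mres_lift, and passing to its kernel costs one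
    degree of perpendicularity, in step with the length n. For Y = K this
    gives left_perp_ures; the induction needs Y to be the part of K reached
    from U. *)
Lemma mres_ures n K E (e : {linear E -> K}) : mres n e -> (n < d)%N ->
  forall Y (phi : {linear Y -> K}), injective phi ->
  (forall X (f : {linear X -> K}), U X ->
     exists g : {linear X -> Y}, forall x, phi (g x) = f x) ->
  (forall G m, right_perp G -> (m <= n)%N -> ext_van m Y G) -> ures n Y.
Proof.
elim=> {n K E e} [K E e ME ei es|n K E e K1 i E1 e1 ME s eP r1 IH] nd Y phi phii tr H.
  have [e' [eK eK']] := iso_bij ei es.
  have [T [G [j [q [UT gG [ji je qs]]]]]] := torsion_ses ME.
  have [|a aE] := fact_ker (f := lcomp e' phi) ji je.
    by move=> x; exact: (H G 0%N gG isT (lcomp q (lcomp e' phi))).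
  have [b bE] := tr T (lcomp e j) UT.
  apply: ures0; apply: (U_retract _ UT); exists a, b => x.
  by apply: phii; rewrite bE /= aE /= eK'.
have [ii ie es] := s.
have [T [G [j [q [UT gG [ji je qs]]]]]] := torsion_ses ME.
have [r rE] := tr T (lcomp e j) UT.
(* The map r is what becomes of e on the torsion part T of E. *)
have rs : surj r.
  have [|h hE] := mres_lift (mresS ME s eP r1) q gG phi.
    by move=> G' m gG' mn; apply: H => //; lia.
  move=> y; have [x [xE qx]] := hE y.
  have [|t tE] := (je x).1; first by rewrite qx (H G 0%N gG isT h).
  by exists t; apply: phii; rewrite rE /= tE xE.
have [Y1 [c sc]] := ker_ses rs; have [ci ce _] := sc.
apply: (uresS UT sc).
  move=> X f UX; have [g gE] := eP X (lcomp phi f) (U_sub_M UX).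
  have [|h hE] := fact_ker (f := g) ji je.
    by move=> x; exact: (gG X 0%N UX d_gt0 (lcomp q g)).
  by exists h => x; apply: phii; rewrite rE /= hE gE.
have [|phi1 phi1E] := fact_ker (f := lcomp j c) ii ie.
  by move=> x; rewrite /= -[e (j _)]/(lcomp e j (c x)) -rE (exact_comp x ce) linear0.
apply: (IH _ Y1 phi1); first lia.
- by move=> x y xy; apply: ci; apply: ji; rewrite -![j _]/(lcomp j c _) -!phi1E xy.
- move=> X f UX.
  have [|g gE] := fact_ker (f := lcomp i f) ji je.
    by move=> x; exact: (gG X 0%N UX d_gt0 (lcomp q (lcomp i f))).
  have [|h hE] := fact_ker (f := g) ci ce.
    move=> x; apply: (inj_eq0 phii).
    by rewrite rE /= gE /= (exact_comp _ ie).
  by exists h => x; apply: ii; rewrite phi1E /= hE gE.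
- move=> G' m gG' mn; apply: (ext_van_fst_ker sc); last by apply: H.
  by apply: gG' => //; lia.
Qed.

Lemma left_perp_ures Y : left_perp Y -> exists n, ures n Y.
Proof.
move=> pY; have [||E [e re]] := @mres_ex d.-1 _ Y; first lia.
  by move=> N i MN i0; lia.
exists d.-1; apply: (@mres_ures _ Y E e re _ Y (idlin Y)) => //; first lia.
  by move=> X f UX; exists f.
by move=> G m gG md; apply: pY => //; lia.
Qed.

Lemma left_perp_Fac Y : left_perp Y -> FacU Y.
Proof.
move=> /left_perp_ures[n]; case=> [Z UZ|_ K T Z i p UT [_ _ ps] _ _]; last by exists T, p.
by exists Z, (idlin Z); split=> // y; exists y.
Qed.
End Torsion.

(** * Coresolutions of projectives by Ext-projectives *)

Section Chains.
Context {k : fieldType} {A : falgType k}.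
Implicit Types B C E F G I J K N Q T V W X Y Z : fgmod A.
Variables (d : nat) (M U : fgmod A -> Prop).
Hypotheses (d_gt0 : (1 <= d)%N) (M_ct : cluster_tilting d M) (U_tors : torsion_class d M U).
Hypothesis U_cov : covariantly_finite U.
Notation left_perp := (left_perp d U).
Notation FacU := (FacU U).
Notation ures := (ures U).

Definition lapprox C T (f : {linear C -> T}) := U T /\
  forall N (g : {linear C -> N}), U N -> exists h : {linear T -> N}, forall x, h (f x) = g x.
Definition minlapprox C T (f : {linear C -> T}) := lapprox f /\
  forall t : {linear T -> T}, (forall x, t (f x) = f x) -> injective t /\ surj t.

(** Take a left approximation f of least dimension. If t f = f, then f
    factors through the image of a high power of t; this image is a
    retract, again the target of a left approximation, so by minimality it
    is everything. *)
Lemma minlapprox_ex C : exists T (f : {linear C -> T}), minlapprox f.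
Proof.
pose has m := `[< exists T (f : {linear C -> T}), lapprox f /\ kdim T = m >].
have h0 : exists m, has m.
  have [T [f [UT fP]]] := U_cov C; exists (kdim T); apply/asboolP; exists T, f.
  by split=> //; split=> // N g UN; have [h hE] := fP N g UN; exists h.
case: (ex_minnP h0) => m /asboolP[T [f [[UT fP] Tm]]] mmin.
exists T, f; split=> // t tf.
have [n [I [i [r [ri iP iP']]]]] := fitting t.
have tn m' x : lpow t m' (f x) = f x.
  by rewrite lpowE; elim: m' => //= m' ->.
have irf x : i (r (f x)) = f x.
  by have [y yE] := iP' (f x); rewrite tn in yE; rewrite -yE ri.
have ii : injective i by exact: can_inj ri.
have UI : U I by apply: (U_retract U_tors _ UT); exists i, r.
have le : (kdim T <= kdim I)%N.
  rewrite Tm; apply: mmin; apply/asboolP; exists I, (lcomp r f); split=> //; split=> // N g UN.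
  have [h hE] := fP N g UN; exists (lcomp h i) => x.
  by rewrite /= irf hE.
have [le' isj] := kdim_inj ii.
have {}isj : surj i by apply: isj; apply/eqP; rewrite eqn_leq le le'.
have ts : surj t.
  by move=> y; have [z <-] := isj y; have [x ->] := iP z; exists (lpow t n x).
by split=> //; exact: (kdim_surj ts).2.
Qed.

(** A run of minimal left U-approximations F -> T_0, C_1 -> T_1, ..., C_j
    -> T_j with C_1 the cokernel of F -> T_0 and C_(i+1) that of C_i ->
    T_i. Only the last one appears in the type. *)
Inductive approx_chain F : nat -> forall C T, {linear C -> T} -> Prop :=
| approx_chain0 T (f : {linear F -> T}) : minlapprox f -> approx_chain F 0 f
| approx_chainS j C T (f : {linear C -> T}) C' (p : {linear T -> C'}) T' (f' : {linear C' -> T'}) :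
    approx_chain F j f -> surj p -> exact_at f p -> minlapprox f' -> approx_chain F j.+1 f'.

Lemma approx_chain_min F j C T (f : {linear C -> T}) : approx_chain F j f -> minlapprox f.
Proof. by case. Qed.
Lemma approx_chain_U F j C T (f : {linear C -> T}) : approx_chain F j f -> U T.
Proof. by move=> /approx_chain_min[[]]. Qed.

(** It suffices to lift g to the first term T0 of the resolution of Z,
    because maps to U extend along f. For j = 0 the lift exists since F is
    projective. For j > 0 compose g with T_(j-1) -> C_j and lift to T0; the
    obstruction to factoring the lift through C_j is a map C_(j-1) -> K,
    which extends to T_(j-1) because K has a shorter resolution. *)
Lemma approx_chain_extend F n Z : projective F -> ures n Z ->
  forall j C T (f : {linear C -> T}), approx_chain F j f ->
  forall g : {linear C -> Z}, exists h : {linear T -> Z}, forall x, h (f x) = g x.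
Proof.
move=> Fp; elim=> {n Z} [Z UZ|n K T0 Z i p UT0 [ii ie ps] pP _ IH] j C T f ch g.
  by have [[_ H] _] := approx_chain_min ch; exact: H.
suff [c cE] : exists c : {linear C -> T0}, forall x, p (c x) = g x.
  have [[_ H] _] := approx_chain_min ch; have [h hE] := H _ c UT0.
  by exists (lcomp p h) => x; rewrite /= hE cE.
case: ch g => {j C T f} [T f _|j C T f C' q T' f' ch qs qe _] g.
  by have [c cE] := Fp _ _ p g ps; exists c.
have [h hE] := pP T (lcomp g q) (approx_chain_U ch).
have [|a aE] := fact_ker (f := lcomp h f) ii ie.
  by move=> x; rewrite /= hE /= (exact_comp _ qe) linear0.
have [b bE] := IH _ _ _ _ ch a.
have [|c cE] := fact_coker (f := sub_lin h (lcomp i b)) qe qs.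
  by move=> x; rewrite /= bE aE subrr.
exists c => x; have [y <-] := qs x.
by rewrite cE /= linearB (exact_comp _ ie) subr0 hE.
Qed.

(** Let Y be an extension of T_j by Z. The approximation C_j -> T_j lifts
    to Y, for j = 0 by projectivity of F, for j > 0 by induction and
    approx_chain_extend. As Y is again left perpendicular, the lift extends
    to a map T_j -> Y, and by minimality the composite T_j -> Y -> T_j is
    invertible. *)
Lemma approx_chain_ext1 F : projective F -> forall j C T (f : {linear C -> T}), approx_chain F j f ->
  forall Z, left_perp Z -> ext1_van T Z.
Proof.
move=> Fp j C T f ch; elim: ch => {j C T f} [T f fm|j C T f C' q T' f' ch IH qs qe fm] Z pZ;
  apply: ext1_van_split => Y i p s; have [ii ie ps] := s.
- have [l lE] := Fp _ _ p f ps.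
  have ch := approx_chain0 fm; have pY := left_perp_ext s pZ (U_left_perp (approx_chain_U ch)).
  have [n rY] := left_perp_ures d_gt0 M_ct U_tors pY.
  have [h hE] := approx_chain_extend Fp rY ch l.
  have [|ti ts] := fm.2 (lcomp p h); first by move=> x; rewrite /= hE lE.
  have [u [uK uK']] := iso_bij ti ts.
  by exists (lcomp h u) => x; exact: uK'.
- have [h hE] := ext1_van_lift (lcomp f' q) (IH Z pZ) s.
  have [|a aE] := fact_ker (f := lcomp h f) ii ie.
    by move=> x; rewrite [LHS]hE /= (exact_comp _ qe) linear0.
  have [m rZ] := left_perp_ures d_gt0 M_ct U_tors pZ.
  have [b bE] := approx_chain_extend Fp rZ ch a.
  have [|l lE] := fact_coker (f := sub_lin h (lcomp i b)) qe qs.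
    by move=> x; rewrite /= bE aE subrr.
  have lE' x : p (l x) = f' x.
    have [y <-] := qs x.
    by rewrite lE /= linearB (exact_comp _ ie) subr0 hE.
  have ch' := approx_chainS ch qs qe fm; have pY := left_perp_ext s pZ (U_left_perp (approx_chain_U ch')).
  have [n rY] := left_perp_ures d_gt0 M_ct U_tors pY.
  have [g gE] := approx_chain_extend Fp rY ch' l.
  have [|ti ts] := fm.2 (lcomp p g); first by move=> x; rewrite /= gE lE'.
  have [u [uK uK']] := iso_bij ti ts.
  by exists (lcomp g u) => x; exact: uK'.
Qed.

(** Shift along 0 -> Z -> T1 -> W -> 0 with T1 from Fac_embed: the cokernel
    W is again left perpendicular. *)
Lemma approx_chain_ext F j C T (f : {linear C -> T}) : projective F -> approx_chain F j f ->
  forall n Z, (n < d)%N -> left_perp Z -> ext_van n.+1 T Z.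
Proof.
move=> Fp ch; elim=> [|n IH] Z nd pZ; first exact: approx_chain_ext1 ch _ pZ.
have [T1 [i [UT1 ii T1e]]] := Fac_embed d_gt0 M_ct U_tors (left_perp_Fac d_gt0 M_ct U_tors pZ).
have [W [p s]] := coker_ses ii.
apply: (ext_van_left s); first by apply: T1e => //; exact: approx_chain_U ch.
apply: IH; first lia.
by apply: (left_perp_coker d_gt0 s) => //; exact: U_left_perp.
Qed.

Lemma approx_chain_ext_projective F j C T (f : {linear C -> T}) : projective F -> approx_chain F j f ->
  ext_projective d U T.
Proof.
move=> Fp ch; split=> [|N UN]; first exact: approx_chain_U ch.
apply/ext_zeroP; case: d d_gt0 (approx_chain_ext Fp ch) => // d' _ H.
apply: (H d') => //; exact: U_left_perp.
Qed.

(** The cokernels in a chain of left approximations gain one degree at each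
    step (Fac_orth_step); from j = d - 1 on such a module lies in U
    (Fac_orth_top), and the chain stops. *)
Definition Fac_orth j C := FacU C /\ forall N i, M N -> (0 < i <= j)%N -> (i < d)%N -> ext_van i C N.

Lemma Fac_approx_inj C T (f : {linear C -> T}) : FacU C -> lapprox f -> injective f.
Proof.
move=> FC [UT H]; have [T' [i [UT' ii _]]] := Fac_embed d_gt0 M_ct U_tors FC.
have [h hE] := H _ i UT'.
by apply: inj0 => x x0; apply: (inj_eq0 ii); rewrite -hE x0 linear0.
Qed.

Lemma Fac_approx_M C T (f : {linear C -> T}) N (g : {linear C -> N}) :
  FacU C -> lapprox f -> M N -> exists h : {linear T -> N}, forall x, h (f x) = g x.
Proof.
move=> FC [UT H] MN; have [T' [i [u [UT' _ uE]]]] := Fac_into d_gt0 M_ct U_tors g FC MN.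
have [h hE] := H _ u UT'; exists (lcomp i h) => x.
by rewrite /= hE uE.
Qed.

Lemma Fac_orth_step j C T (f : {linear C -> T}) C' (p : {linear T -> C'}) :
  Fac_orth j C -> lapprox f -> ses f p -> Fac_orth j.+1 C'.
Proof.
move=> [FC eC] fa s; have [fi fe ps] := s; have [UT _] := fa; split; first by exists T, p.
move=> N [|[|i]] MN // ij id.
  apply: (ext1_van_fst_coker s); first by move=> g; exact: Fac_approx_M FC fa MN.
  by apply: (@M_ext _ _ d M d_gt0 M_ct _ _ 1 (U_sub_M U_tors UT) MN); lia.
apply: (ext_van_fst_coker s); first by apply: eC => //; lia.
by apply: (M_ext d_gt0 M_ct (U_sub_M U_tors UT) MN); lia.
Qed.

Lemma Fac_orth_top j C : Fac_orth j C -> (d <= j.+1)%N -> U C.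
Proof.
move=> [FC eC] dj; apply: (Fac_M d_gt0 M_ct U_tors FC); apply: (M_of_ext_l d_gt0 M_ct).
by move=> N i MN id; apply: eC => //; lia.
Qed.

(** Coresolve C by left U-approximations. This shifts Ext^d(X, C) down to
    Ext^1(X, -) of a cokernel that lies in U. *)
Lemma ext_projective_Fac X : ext_projective d U X -> forall C, FacU C -> ext_van d X C.
Proof.
move=> [UX eX].
suff H r : forall j C, Fac_orth j C -> (j + r.+1)%N = d -> ext_van r.+1 X C.
  move=> C FC; case: d d_gt0 H => // d' _ H; apply: (H d' 0%N C) => //.
  by split=> // N i _ /andP[i0 i1]; lia.
elim: r => [|r IH] j C rC e.
  have UC := Fac_orth_top rC (_ : (d <= j.+1)%N); case: (eqVneq d 1%N) => [d1|d1].
    by have /ext_zeroP := eX C (UC ltac:(lia)); rewrite d1.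
  by apply: (@M_ext _ _ d M d_gt0 M_ct _ _ 1 (U_sub_M U_tors UX) (U_sub_M U_tors (UC ltac:(lia)))); lia.
have [T [f [fa _]]] := minlapprox_ex C; have fi := Fac_approx_inj rC.1 fa.
have [C' [p s]] := coker_ses fi; have rC' := Fac_orth_step rC fa s.
apply: (ext_van_left s); last by apply: (IH j.+1) => //; lia.
have [UT _] := fa; case: (ltnP r.+2 d) => rd.
  by apply: (M_ext d_gt0 M_ct (U_sub_M U_tors UX) (U_sub_M U_tors UT)); lia.
have <- : d = r.+2 by lia.
by apply/ext_zeroP/eX.
Qed.

(** The image I of F -> T_0 has a finite coresolution 0 -> I -> T_0 -> ...
    -> T_d -> 0 by Ext^d-projectives, along which the cohomology of Hom(Y,
    I) in degree i0 is shifted to that of the Hom(Y, T_m) in degrees i0 +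
    m. *)
Lemma coh_van_approx_chain (Y : complex A) (i0 : int) F : cxproj Y -> projective F ->
  (forall T m, ext_projective d U T -> (m <= d)%N -> coh_van Y T (i0 + m%:Z)) ->
  forall T (f : {linear F -> T}), minlapprox f ->
  forall I (p : {linear F -> I}) (i : {linear I -> T}), surj p -> injective i ->
   (forall x, i (p x) = f x) -> coh_van Y I i0.
Proof.
move=> Yp Fp HT.
have key r : forall j C T (f : {linear C -> T}), approx_chain F j.+1 f -> Fac_orth j C ->
    (j.+1 + r)%N = d -> forall m, (m <= j.+1)%N -> coh_van Y C (i0 + m%:Z).
  elim: r => [|r IH] j C T f ch rC e m mj.
    apply: HT; last lia.
    have UC := Fac_orth_top rC (_ : (d <= j.+1)%N).
    split; first by apply: UC; lia.
    have [UT eT] := approx_chain_ext_projective Fp ch.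
    have [[_ H] _] := approx_chain_min ch; have [h hE] := H _ (idlin C) (UC ltac:(lia)).
    move=> N UN; apply/ext_zeroP; apply: (@ext_van_retract _ _ d C T); first by exists f, h.
    exact/ext_zeroP/eT.
  have [fa _] := approx_chain_min ch; have fi := Fac_approx_inj rC.1 fa.
  have [C' [p s]] := coker_ses fi; have rC' := Fac_orth_step rC fa s.
  have [T' [f' fm]] := minlapprox_ex C'; have [_ pe ps] := s.
  have ch' := approx_chainS ch ps pe fm.
  apply: (coh_van_left (j := i0 + m.+1%:Z) Yp s); first lia.
    by apply: HT; [exact: approx_chain_ext_projective ch | lia].
  by apply: (IH _ _ _ _ ch') => //; lia.
move=> T f fm I p i ps ii ip.
have ch := approx_chain0 fm; have [C [q s]] := coker_ses ii; have [_ qe qs] := s.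
have [T' [f' fm']] := minlapprox_ex C.
have ch' : approx_chain F 1 f'.
  apply: (approx_chainS ch qs _ fm') => y; rewrite qe; split=> -[x <-].
    by have [z <-] := ps x; exists z; rewrite ip.
  by exists (p x); rewrite ip.
apply: (coh_van_left (j := i0 + 1) Yp s) => //.
  by rewrite -[i0]addr0; apply: (HT T 0%N) => //; exact: approx_chain_ext_projective ch.
apply: (key d.-1 0%N C T' f' ch' _ _ 1%N) => //; last lia.
split; last by move=> N j _ /andP[j0 j1]; lia.
by exists T, q; split=> //; exact: approx_chain_U ch.
Qed.
End Chains.

(** * Rigidity of minimal resolutions *)

Section Rigidity.
Context {k : fieldType} {A : falgType k}.
Implicit Types B C E F G I J K N Q T V W X : fgmod A.
Variables (d : nat) (M U : fgmod A -> Prop).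
Hypotheses (d_gt0 : (1 <= d)%N) (M_ct : cluster_tilting d M) (U_tors : torsion_class d M U).
Hypothesis U_cov : covariantly_finite U.

(** Let D be the kernel of P i -> P j. Since Ext^d(X, -) vanishes on the
    quotient N / f(D) of N, the map f extends to P j modulo f(D); after
    subtracting this extension, f takes values in f(D). If the image has
    become smaller, conclude by induction on its dimension. Otherwise f(D)
    is the whole image of the original f, so Ker f + D = P i, and f = 0
    because D is superfluous. *)
Lemma rigid_extend X (P : complex A) (eps : {linear P 0 -> X}) N :
  ext_projective d U X -> min_proj_resolution eps -> U N ->
  forall (i j : int), i = - d%:Z -> i + 1 = j -> forall f : {linear P i -> N},
  exists g : {linear P j -> N}, forall x, f x = g (cx_d P i j x).
Proof.
move=> Xp [Pe _ Psup] UN i j iE ij f; have i0 : i < 0 by lia.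
have Pp : cxproj P by case: Pe.
have ee := res_exact Pe (subrK 1 i) ij i0.
have [I [p [ii [ps iii ip]]]] := img_ex f.
have [m mE] : exists m, (kdim I < m)%N by exists (kdim I).+1.
elim: m f I p ii ps iii ip mE => // m IH f I p ii ps iii ip mE.
pose S y := exists x, cx_d P i j x = 0 /\ f x = y.
have Scl : smod_closed S.
  split; first by exists 0; rewrite !linear0.
  move=> a y z [x [dx <-]] [x' [dx' <-]]; exists (a *: x + x').
  by rewrite !linearP dx dx' scaler0 addr0.
have [C [c [cs cP]]] := quo_ex Scl.
have FC : FacU U C by exists N, c.
have hC : coh_van P C i.
  rewrite iE; apply/(coh_van_extP d C Pe).
  exact: (ext_projective_Fac d_gt0 M_ct U_tors U_cov Xp FC).
have [|g gE] := hC _ _ (subrK 1 i) ij (lcomp c f).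
  move=> x; apply/cP; exists (cx_d P (i - 1) i x).
  by split=> //; apply/ee; exists x.
have [g' gE'] := Pp j _ _ c g cs.
pose f' := sub_lin f (lcomp g' (cx_d P i j)).
have f'S x : S (f' x).
  by apply/cP; rewrite /f' /= linearB gE' (gE x : c (f x) = _) subrr.
have [I' [p' [ii' [ps' iii' ip']]]] := img_ex f'.
have [q qE] : exists q : {linear I' -> I}, forall x, ii (q x) = ii' x.
  apply: fact_inj => // y; have [x <-] := ps' y.
  by have [z [_ zE]] := f'S x; exists (p z); rewrite ip zE ip'.
have qi : injective q by move=> x y /(congr1 ii); rewrite !qE => /iii'.
have [le qs] := kdim_inj qi.
case: (eqVneq (kdim I') (kdim I)) => [e|ne].
  exists (zero_lin _ _) => x.
  have Sf : GRing.submod_closed [pred x : P i | f x == 0].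
    split; first by rewrite inE linear0.
    by move=> a y z; rewrite !inE linearP => /eqP -> /eqP ->; rewrite scaler0 addr0.
  (* Here f(D) is the whole image of f, so that Ker f and D together span
     P i. *)
  have := Psup i i0 _ Sf _ x; rewrite inE => H; apply/eqP/H => {H} y.
  have [z zE] := qs e (p y); have [w wE] := ps' z.
  have [t [dt tE]] := f'S w; exists (y - t).
    by rewrite inE linearB subr_eq0 tE -ip' wE -qE zE ip.
  by rewrite (_ : y - (y - t) = t) ?ij // opprB addrC subrK.
have [|g1 gE1] := IH f' I' p' ii' ps' iii' ip'; first by lia.
by exists (add_lin g1 g') => x; rewrite /= -gE1 /f' /= subrK.
Qed.
End Rigidity.

(** * Maps of complexes of arbitrary degree *)

Section GradedMaps.
Context {k : fieldType} {A : falgType k}.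
Implicit Types N : fgmod A.
Implicit Types X Y Z R : complex A.

(** Components are indexed by all pairs of degrees, but only those from i
    to i + n matter for a map of degree n. Commutation and homotopy are
    stated without the signs of a shift; these are accounted for once, in
    hom_van_shift. *)
Definition gmap X Y := forall i j : int, {linear X i -> Y j}.

Definition gchain X Y (n : int) (f : gmap X Y) := forall i j i' j' : int,
  i + n = j -> i + 1 = i' -> j + 1 = j' ->
  forall x, f i' j' (cx_d X i i' x) = cx_d Y j j' (f i j x).

Definition gnull_at X Y (n : int) (f h : gmap X Y) (i : int) := forall i' j' j : int,
  i + n = j -> i + 1 = i' -> j' + 1 = j ->
  forall x, f i j x = cx_d Y j' j (h i j' x) + h i' j (cx_d X i i' x).

Definition gnull X Y n (f : gmap X Y) := exists h, forall i, gnull_at n f h i.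

(** Hom(X, Y[n]) = 0 in the homotopy category. *)
Definition hom_van X Y n := forall f : gmap X Y, gchain n f -> gnull n f.

(** Transport along an equality of degrees, extended by zero. *)
Definition gid X (i j : int) : {linear X i -> X j} :=
  match i =P j with ReflectT e => cx_cast X e | ReflectF _ => \0 end.
Lemma gidE X i x : gid X i i x = x.
Proof. by rewrite /gid; case: eqP => // e; rewrite (eq_axiomK e). Qed.
Lemma gid0 X i j x : i != j -> gid X i j x = 0.
Proof. by rewrite /gid; case: eqP. Qed.
Lemma gid_d X i j i' j' x : i = i' -> j = j' ->
  cx_d X i' j' (gid X i i' x) = gid X j j' (cx_d X i j x).
Proof. by move=> <- <-; rewrite !gidE. Qed.

Definition gupd X Y (h : gmap X Y) i0 j0 (w : {linear X i0 -> Y j0}) : gmap X Y :=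
  fun i j => add_lin (h i j) (lcomp (gid Y j0 j) (lcomp (sub_lin w (h i0 j0)) (gid X i i0))).
Lemma gupdE X Y (h : gmap X Y) i0 j0 (w : {linear X i0 -> Y j0}) x :
  gupd h w i0 j0 x = w x.
Proof. by rewrite /gupd /= !gidE /= addrC subrK. Qed.
Lemma gupd_other X Y (h : gmap X Y) i0 j0 (w : {linear X i0 -> Y j0}) i j x :
  i != i0 -> gupd h w i j x = h i j x.
Proof. by move=> ii; rewrite /gupd /= (gid0 _ ii) !linear0 ?(subrr, addr0, linear0). Qed.

Lemma hom_van_zero X Y n : (forall i, is_zero (X i) \/ is_zero (Y (i + n))) -> hom_van X Y n.
Proof.
move=> H f _; exists (fun _ _ => zero_lin _ _) => i i' j' j e _ _ x.
subst j; rewrite linear0 addr0; case: (H i) => z; last exact: z.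
by rewrite (z x) linear0.
Qed.

(** A projective resolution of N with the terms below degree -d removed;
    exactness is lost in degree -d only. *)
Definition trunc_res (d : nat) N R (eps : {linear R 0 -> N}) :=
  [/\ forall j, 0 < j -> is_zero (R j), forall j, j < - d%:Z -> is_zero (R j), cxproj R,
      surj eps & (forall h, h + 1 = 0 -> exact_at (cx_d R h 0) eps) /\
      forall h i j, h + 1 = i -> i + 1 = j -> - d%:Z < i < 0 ->
        exact_at (cx_d R h i) (cx_d R i j)].

Lemma gnull_extend X Y n (f h : gmap X Y) i0 :
  gchain n f -> projective (X i0) -> (forall i, i0 < i -> gnull_at n f h i) ->
  (forall h j l, h + 1 = j -> j + 1 = l -> i0 + n = j -> forall (u : {linear X i0 -> Y j}) x,
     cx_d Y j l (u x) = 0 -> exists y, cx_d Y h j y = u x) ->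
  exists h', (forall i, i0 <= i -> gnull_at n f h' i) /\
    forall i, i0 < i -> forall j x, h' i j x = h i j x.
Proof.
move=> fc Xp hn ex.
pose j0 := i0 + n; pose u := sub_lin (f i0 j0) (lcomp (h (i0 + 1) j0) (cx_d X i0 (i0 + 1))).
have [|w wE] := @proj_lift _ _ (X i0) _ _ (cx_d Y (j0 - 1) j0) u Xp.
  move=> x; apply: (ex (j0 - 1) j0 (j0 + 1) (subrK _ _) erefl erefl u x).
  rewrite /u /= linearB /= -(fc i0 j0 (i0 + 1) (j0 + 1) erefl erefl erefl).
  have e1 : i0 < i0 + 1 by lia.
  have e2 : i0 + 1 + n = j0 + 1 by rewrite /j0; lia.
  rewrite (hn _ e1 _ j0 _ e2 erefl erefl).
  by rewrite cx_dd linear0 addr0 subrr.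
exists (gupd h w); split; last first.
  by move=> i ii j x; rewrite gupd_other //; lia.
move=> i ii i' j' j e1 e2 e3 x; case: (eqVneq i i0) => [?|ne].
  subst i; have e : j' = j0 - 1 by rewrite /j0; lia.
  subst j'; subst i'; have e : j0 = j by [].
  subst j; rewrite gupdE wE gupd_other; last by lia.
  by rewrite /u /= subrK.
by rewrite !gupd_other; try lia; apply: hn => //; lia.
Qed.
End GradedMaps.

Section TruncatedResolutions.
Context {k : fieldType} {A : falgType k}.
Implicit Types N Q : fgmod A.
Implicit Types X Y Z R : complex A.

(** The homotopy is built downwards in the degree i of X. For i > -n the
    target R (i + n) is zero. In degree -n the cocycle X (-n) -> N is a
    coboundary, and a lift of the resulting map X (-n + 1) -> N starts the
    homotopy. Below, exactness of R in degrees > -d provides the next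
    component, and X is zero below -d. *)
Lemma hom_van_trunc_res d N R (eps : {linear R 0 -> N}) X n :
  trunc_res d eps -> cxproj X -> (forall i, i < - d%:Z -> is_zero (X i)) -> 0 < n ->
  coh_van X N (- n) -> hom_van X R n.
Proof.
move=> [R1 R0 Rp es [e0 e1]] Xp X0 n0 hX f fc.
suff H m : exists h, forall i, - n - m%:Z <= i -> gnull_at n f h i.
  have [h hP] := H d; exists h => i; case: (lerP (- n - d%:Z) i) => [|ii]; first exact: hP.
  move=> i' j' j _ _ _ x; have x0 : x = 0 by apply: X0; lia.
  by rewrite x0 !linear0 addr0.
elim: m => [|m [h hP]]; last first.
  have [|||h' [h'P _]] := @gnull_extend _ _ X R n f h (- n - m%:Z - 1) fc.
  - exact: Xp.
  - by move=> i ii; apply: hP; lia.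
  - move=> a j l aj jl ej u x ux; case: (ltrP (- n - m%:Z - 1) (- d%:Z)) => id.
      by exists 0; rewrite (X0 _ id x) !linear0.
    by apply/(e1 a j l aj jl) => //; lia.
  - by exists h' => i ii; apply: h'P; lia.
have fn x : eps (f (- n) 0 (cx_d X (- n - 1) (- n) x)) = 0.
  rewrite (fc (- n - 1) (-1) (- n) 0) ?subrK //; try lia.
  exact: exact_comp (e0 (-1) erefl).
have [g gE] := hX _ _ (subrK 1 _) erefl (lcomp eps (f (- n) 0)) fn.
have [g' gE'] := Xp (- n + 1) _ _ eps g es.
have [h0 h0E] : exists h0 : gmap X R, forall x, h0 (- n + 1) 0 x = g' x.
  exists (gupd (fun _ _ => zero_lin _ _) g') => x; exact: gupdE.
have [w wE] : exists w : {linear X (- n) -> R (-1)}, forall x,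
    cx_d R (-1) 0 (w x) = f (- n) 0 x - g' (cx_d X (- n) (- n + 1) x).
  apply: (@proj_lift _ _ _ _ _ (cx_d R (-1) 0)
    (sub_lin (f (- n) 0) (lcomp g' (cx_d X (- n) (- n + 1))))) => // x.
  by apply/(e0 (-1) erefl); rewrite /= linearB gE' (gE x : eps _ = _) subrr.
exists (gupd h0 w) => i ii i' j' j e2 e3 e4 x.
case: (eqVneq i (- n)) => [?|ne]; last by rewrite [LHS](R1 j) ?[RHS](R1 j) //; lia.
subst i; subst i'; have ej : j = 0 by lia.
have ej' : j' = -1 by lia.
clear e2 e4; subst j; subst j'; rewrite gupdE wE gupd_other; last by lia.
by rewrite h0E subrK.
Qed.

Definition gchain_at X Y (n : int) (f : gmap X Y) i := forall j i' j' : int,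
  i + n = j -> i + 1 = i' -> j + 1 = j' ->
  forall x, f i' j' (cx_d X i i' x) = cx_d Y j j' (f i j x).

Lemma gchain_extend X Y n (f : gmap X Y) i1 i0 :
  i1 + 1 = i0 -> projective (X i1) -> (forall i, i0 <= i -> gchain_at n f i) ->
  (forall j l, i1 + n = j -> j + 1 = l -> 
     forall x, exists y, cx_d Y j l y = f i0 l (cx_d X i1 i0 x)) ->
  exists f', (forall i, i1 <= i -> gchain_at n f' i) /\
    forall i, i0 <= i -> forall j x, f' i j x = f i j x.
Proof.
move=> e10 Xp fn ex; subst i0; pose j0 := i1 + n.
have [|w wE] := @proj_lift _ _ (X i1) _ _ (cx_d Y j0 (j0 + 1))
   (lcomp (f (i1 + 1) (j0 + 1)) (cx_d X i1 (i1 + 1))) Xp.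
  by move=> x; exact: ex.
exists (gupd f w); split; last first.
  by move=> i ii j x; rewrite gupd_other //; lia.
move=> i ii j i' j' e1 e2 e3 x; case: (eqVneq i i1) => [?|ne].
  subst i; subst i'; have ej : j0 = j by [].
  by subst j; subst j'; rewrite gupdE wE gupd_other //; lia.
by rewrite !gupd_other; try lia; apply: fn => //; lia.
Qed.

(** A cocycle X (-n) -> N lifts to a chain map X -> R[n], and a homotopy
    for the latter exhibits the cocycle as a coboundary. The lift is built
    downwards by projectivity; only in the lowest degree of R, where R is
    not exact, is there an obstruction, a cocycle of degree -n - d - 1 with
    values in the kernel of the lowest differential of R. *)
Lemma hom_van_trunc_res_coh_van d N R (eps : {linear R 0 -> N}) X n :
  (0 < d)%N -> trunc_res d eps -> cxproj X -> (forall Q, coh_van X Q (- n - d%:Z - 1)) ->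
  hom_van X R n -> coh_van X N (- n).
Proof.
move=> d0 [R1 R0 Rp es [e0 e1]] Xp Xz H a b ha hb phi phid.
have [v vE] := Xp _ _ _ eps phi es.
suff [f [fv fs]] : exists f : gmap X R, (forall x, f (- n) 0 x = v x) /\
    forall i, gchain_at n f i.
  have [h hP] : gnull n f by apply: H => i j i' j' e2 e3 e4 x; apply: fs.
  exists (lcomp eps (h b 0)) => x.
  rewrite -vE -fv (hP (- n) b (-1) 0) //; last by lia.
  by rewrite linearD (exact_comp _ (e0 (-1) erefl)) add0r.
have step m : (m < d)%N -> exists f : gmap X R, (forall x, f (- n) 0 x = v x) /\
    forall i, - n - m.+1%:Z <= i -> gchain_at n f i.
  elim: m => [|m IH] md.
    pose f0 : gmap X R := gupd (fun _ _ => zero_lin _ _) v.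
    have [||j l e2 e3 x|f [fs fE]] := @gchain_extend X R n f0 a (- n) ha.
    - exact: Xp.
    - by move=> i ii j i' j' e2 e3 e4 x; rewrite [LHS](R1 j') ?[RHS](R1 j') //; lia.
    - have el : l = 0 by lia.
      have e4 : j + 1 = 0 by lia.
      clear e3; subst l; apply/(e0 j e4); rewrite gupdE vE.
      exact: phid.
    - exists f; split=> [x|i ii]; last by apply: fs; lia.
      by rewrite fE // gupdE.
  have [f [fv fs]] := IH (ltnW md).
  have [||||f' [fs' fE]] := @gchain_extend X R n f (- n - m.+2%:Z) (- n - m.+1%:Z).
  - by lia.
  - exact: Xp.
  - exact: fs.
  - move=> j l e2 e3 x; apply/(e1 j l (l + 1) e3 erefl); first by lia.
    rewrite -(fs (- n - m.+1%:Z) (lexx _) l _ _ _ erefl erefl); last by lia.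
    by rewrite cx_dd linear0.
  - exists f'; split=> [x|i ii]; last by apply: fs'; lia.
    by rewrite fE ?fv //; lia.
have dd : (d.-1 < d)%N by lia.
have [f [fv fs]] := step _ dd; rewrite prednK // in fs.
pose i0 := - n - d%:Z; pose j0 : int := - d%:Z.
(* The lift commutes down to degree i0 of X, which is mapped to the lowest
   degree j0 of R; it remains to make it vanish on the boundaries coming
   from degree i0 - 1. *)
have [K [c [ci ce]]] := ker_ex (cx_d R j0 (j0 + 1)).
have [|g gE] := fact_ker (f := lcomp (f i0 j0) (cx_d X (i0 - 1) i0)) ci ce.
  move=> x; rewrite /= -(fs i0 _ _ (i0 + 1)) //; last by rewrite /i0 /j0; lia.
  by rewrite cx_dd linear0.
have [|g1 gE1] := Xz K (i0 - 1 - 1) i0 (subrK _ _) (subrK _ _) g.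
  by move=> x; apply: ci; rewrite gE /= cx_dd !linear0.
exists (gupd f (sub_lin (f i0 j0) (lcomp c g1))); split.
  by move=> x; rewrite gupd_other ?fv //; rewrite /i0; lia.
move=> i j i' j' e2 e3 e4 x; case: (ltrP i (i0 - 1)) => ii.
  by rewrite [LHS](R0 j') ?[RHS](R0 j') //; rewrite /i0 in ii; lia.
case: (eqVneq i (i0 - 1)) => [?|ne].
  subst i; have ei' : i' = i0 by rewrite -e3 subrK.
  have ej' : j' = j0 by rewrite /j0 /i0 in e2 *; lia.
  clear e3 e4; subst i'; subst j'; rewrite gupdE [RHS](_ : _ = 0).
    by rewrite /= -gE1 gE /= subrr.
  by rewrite (R0 j _ (gupd f _ _ j x)) ?linear0 //; rewrite /i0 in e2; lia.
case: (eqVneq i i0) => [?|ne0].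
  subst i; have ej : j = j0 by rewrite /j0 /i0 in e2 *; lia.
  clear e2; subst j; subst i'; subst j'; rewrite gupdE gupd_other; last by lia.
  rewrite /= linearB (exact_comp _ ce) subr0; apply: fs => //; rewrite /i0; lia.
rewrite !gupd_other //; last by lia.
by apply: fs => //; rewrite /i0 in ii ne ne0; lia.
Qed.
End TruncatedResolutions.

(** * Truncations, direct sums, shifts and stalks *)

Section IfMod.
Context {k : fieldType} {A : falgType k}.
Implicit Types M N Q : fgmod A.
Implicit Types P X Y Z R : complex A.

Definition ifin (b : bool) M : {linear M -> ifmod b M} :=
  match b return {linear M -> ifmod b M} with true => idlin M | false => \0 end.
Definition ifout (b : bool) M : {linear ifmod b M -> M} :=
  match b return {linear ifmod b M -> M} with true => idlin M | false => \0 end.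
Lemma ifinK (b : bool) M x : b -> ifout b M (ifin b M x) = x. Proof. by case: b. Qed.
Lemma ifoutK (b : bool) M x : ifin b M (ifout b M x) = x.
Proof. by case: b x => //= x; rewrite [RHS](zeromod0 x). Qed.
Lemma ifout_hom (b c : bool) M N (f : {linear M -> N}) x : c ->
  ifout c N (ifhom b c f x) = f (ifout b M x).
Proof. by case: b x; case: c => //= x; rewrite linear0. Qed.
Lemma ifmod_zero (b : bool) M : ~~ b -> is_zero (ifmod b M).
Proof. by case: b => // _; exact: zeromod0. Qed.
Lemma ifmod_proj (b : bool) M : projective M -> projective (ifmod b M).
Proof. by case: b => // _; case: (@proj_add k A) => H _ _; exact/H/zeromod0. Qed.

Lemma trunc_out n X i j x : n <= j ->
  ifout (n <= j) (X j) (cx_d (trunc n X) i j x) = cx_d X i j (ifout (n <= i) (X i) x).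
Proof. exact: ifout_hom. Qed.

Lemma ifout_inj b M : injective (ifout b M). Proof. exact: can_inj (@ifoutK b M). Qed.

Lemma trunc_res_trunc (d : nat) P N (eps : {linear P 0 -> N}) :
  (0 < d)%N -> proj_resolution eps ->
  exists eps' : {linear trunc (- d%:Z) P 0 -> N}, trunc_res d eps'.
Proof.
move=> d0 Pe; have [P1 Pp es _ _] := Pe; set n := - d%:Z.
have n0 : n <= 0 by lia.
have zero j : is_zero (P j) -> is_zero (trunc n P j).
  by move=> z x; apply: (@ifout_inj (n <= j)); rewrite linear0; exact: z.
exists (lcomp eps (ifout (n <= 0) (P 0))); split.
- by move=> j /P1; exact: zero.
- by move=> j jd; apply: ifmod_zero; lia.
- by move=> j; exact: ifmod_proj.
- move=> y; have [x <-] := es y; exists (ifin (n <= 0) (P 0) x).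
  by rewrite /= -[ifout _ _ _]/(ifout (n <= 0) (P 0) (ifin (n <= 0) (P 0) x)) ifinK.
split=> [h h0 y|h i j hi ij id y].
- rewrite /= (res_exact0 Pe h0); split=> -[x xE].
    exists (ifin (n <= h) (P h) x); apply: (@ifout_inj (n <= 0)).
    by rewrite trunc_out // ifinK //; lia.
  by exists (ifout (n <= h) (P h) x); rewrite -xE trunc_out.
- have nj : n <= j by lia.
  have ni : n <= i by lia.
  have nh : n <= h by lia.
  have i0 : i < 0 by lia.
  have -> : cx_d (trunc n P) i j y = 0 <-> cx_d P i j (ifout (n <= i) (P i) y) = 0.
    rewrite -trunc_out //; split=> [->|e]; first by rewrite linear0.
    by apply: (@ifout_inj (n <= j)); rewrite e linear0.
  rewrite (res_exact Pe hi ij i0); split=> -[x xE].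
    exists (ifin (n <= h) (P h) x); apply: (@ifout_inj (n <= i)).
    by rewrite trunc_out // ifinK.
  by exists (ifout (n <= h) (P h) x); rewrite -xE trunc_out.
Qed.

Lemma coh_van_trunc n P N i : n < i -> coh_van P N i -> coh_van (trunc n P) N i.
Proof.
move=> ni H h j hi ij f fd.
have [|g gE] := H h j hi ij (lcomp f (ifin (n <= i) (P i))).
  move=> x /=; rewrite -(fd (ifin (n <= h) (P h) x)); congr (f _).
  apply: (@ifout_inj (n <= i)); rewrite trunc_out; last by lia.
  by rewrite !ifinK //; lia.
exists (lcomp g (ifout (n <= j) (P j))) => x.
rewrite /= trunc_out; last by lia.
by rewrite -gE /= ifoutK.
Qed.

(** Nothing maps into the lowest degree, so that every map out of it is a
    cocycle. *)
Lemma coh_van_trunc_bot n P N i : n = i ->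
  (forall j, i + 1 = j -> forall f : {linear P i -> N}, exists g : {linear P j -> N},
     forall x, f x = g (cx_d P i j x)) -> coh_van (trunc n P) N i.
Proof.
move=> ni H h j hi ij f _.
have [g gE] := H j ij (lcomp f (ifin (n <= i) (P i))).
exists (lcomp g (ifout (n <= j) (P j))) => x.
rewrite /= trunc_out; last by lia.
by rewrite -gE /= ifoutK.
Qed.

Lemma coh_van_zero X N i : is_zero (X i) -> coh_van X N i.
Proof.
by move=> z h j _ _ f _; exists (zero_lin _ _) => x; rewrite (z x) linear0.
Qed.

Lemma coh_van_nohom X N i : (forall (f : {linear X i -> N}) x, f x = 0) -> coh_van X N i.
Proof. by move=> z h j _ _ f _; exists (zero_lin _ _) => x; rewrite z. Qed.

Lemma coh_van_sum X Y N i : coh_van X N i -> coh_van Y N i -> coh_van (cx_sum X Y) N i.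
Proof.
move=> HX HY h j hi ij f fd.
have [|g gE] := HX h j hi ij (lcomp f (inl_lin (X i) (Y i))).
  move=> x; rewrite /= -(fd (inl_lin (X h) (Y h) x)); congr (f _).
  by rewrite /= /pair_lin_fun /= linear0.
have [|g' gE'] := HY h j hi ij (lcomp f (inr_lin (X i) (Y i))).
  move=> x; rewrite /= -(fd (inr_lin (X h) (Y h) x)); congr (f _).
  by rewrite /= /pair_lin_fun /= linear0.
exists (copair g g') => -[x y].
rewrite copairE /= -gE -gE' /= -linearD; congr (f _).
by rewrite /pair_lin_fun /=; congr (_, _); rewrite /= ?addr0 ?add0r.
Qed.

Lemma hom_van_suml X Y Z n : hom_van X (cx_sum Y Z) n -> hom_van X Y n.
Proof.
move=> H f fc.
have [|h hP] := H (fun i j => lcomp (inl_lin (Y j) (Z j)) (f i j)).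
  move=> i j i' j' e1 e2 e3 x; rewrite /= /pair_lin_fun /= linear0.
  by congr (_, _); exact: fc.
exists (fun i j => lcomp (fst_lin _ _) (h i j)) => i i' j' j e1 e2 e3 x.
by have /(congr1 fst) := hP i i' j' j e1 e2 e3 x.
Qed.

Lemma hom_van_sumr X Y Z n : hom_van X (cx_sum Y Z) n -> hom_van X Z n.
Proof.
move=> H f fc.
have [|h hP] := H (fun i j => lcomp (inr_lin (Y j) (Z j)) (f i j)).
  move=> i j i' j' e1 e2 e3 x; rewrite /= /pair_lin_fun /= linear0.
  by congr (_, _); exact: fc.
exists (fun i j => lcomp (snd_lin _ _) (h i j)) => i i' j' j e1 e2 e3 x.
by have /(congr1 snd) := hP i i' j' j e1 e2 e3 x.
Qed.

Lemma hom_van_sum X Y Z n : hom_van X Y n -> hom_van X Z n -> hom_van X (cx_sum Y Z) n.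
Proof.
move=> HY HZ f fc.
have [|h hP] := HY (fun i j => lcomp (fst_lin (Y j) (Z j)) (f i j)).
  by move=> i j i' j' e1 e2 e3 x; rewrite /= (fc i j i' j').
have [|h' hP'] := HZ (fun i j => lcomp (snd_lin (Y j) (Z j)) (f i j)).
  by move=> i j i' j' e1 e2 e3 x; rewrite /= (fc i j i' j').
exists (fun i j => pair_lin (h i j) (h' i j)) => i i' j' j e1 e2 e3 x.
have /= := hP i i' j' j e1 e2 e3 x; have /= := hP' i i' j' j e1 e2 e3 x.
by rewrite /pair_lin_fun; case: (f i j x) => /= a b -> ->.
Qed.

Definition sgl (b : bool) M N (f : {linear M -> N}) : {linear M -> N} :=
  if b then opp_lin f else f.
Lemma sglE b M N (f : {linear M -> N}) x : sgl b f x = if b then - f x else f x.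
Proof. by case: b. Qed.
Definition oddz (i : int) := odd `|i|%N.
Lemma oddz1 i : oddz (i + 1) = ~~ oddz i.
Proof. by rewrite /oddz; lia. Qed.

(** Multiplying the component out of degree i by (-1)^i turns an
    anticommuting family into a commuting one. *)
Lemma hom_van_anti X Y n (f : gmap X Y) : hom_van X Y n ->
  (forall i j i' j', i + n = j -> i + 1 = i' -> j + 1 = j' ->
   forall x, f i' j' (cx_d X i i' x) = - cx_d Y j j' (f i j x)) ->
  exists s : gmap X Y, forall i i' j' j, i + n = j -> i + 1 = i' -> j' + 1 = j ->
   forall x, f i j x = cx_d Y j' j (s i j' x) - s i' j (cx_d X i i' x).
Proof.
move=> H fc; have [|h hP] := H (fun i j => sgl (oddz i) (f i j)).
  move=> i j i' j' e1 e2 e3 x; rewrite !sglE -e2 oddz1 e2 (fc i j i' j') //.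
  by case: oddz; rewrite /= ?opprK ?linearN.
exists (fun i j => sgl (oddz i) (h i j)) => i i' j' j e1 e2 e3 x.
have := hP i i' j' j e1 e2 e3 x; rewrite !sglE -e2 oddz1 e2.
case: oddz => /= [e|->]; last by rewrite opprK.
by rewrite -[LHS]opprK e opprD linearN.
Qed.

Lemma shift_dE Y n i j x : cx_d (shift Y n) i j x =
  (if oddz n then - cx_d Y (i + n) (j + n) x else cx_d Y (i + n) (j + n) x).
Proof. by rewrite /= /shift_d /oddz; case: odd. Qed.

(** The differential of shift Y n carries the sign (-1)^n; the family
    (-1)^(n i) f_i commutes with the differentials of X and Y. *)
Lemma hom_van_shift X Y n : hom_van X Y n -> forall f : cmap X (shift Y n), nullhomotopic f.
Proof.
move=> H f.
have [g gE] : exists g : (forall i : int, {linear X i -> Y (i + n)}), forall i x, g i x = f i x.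
  by exists (fun i => f i).
pose b (i : int) := oddz n && oddz i.
pose F : gmap X Y := fun i j => lcomp (gid Y (i + n) j) (sgl (b i) (g i)).
have bS (i : int) : b (i + 1) = oddz n (+) b i.
  by rewrite /b oddz1; case: (oddz n); case: (oddz i).
have gd (i : int) x : g (i + 1) (cx_d X i (i + 1) x) =
    (if oddz n then - cx_d Y (i + n) (i + 1 + n) (g i x)
     else cx_d Y (i + n) (i + 1 + n) (g i x)).
  by rewrite !gE [LHS](cmap_comm f (i + 1) x) shift_dE.
have [|h hP] := H F.
  move=> i j i' j' e1 e2 e3 x; subst i' j; have ej : i + 1 + n = j' by rewrite -e3 addrAC.
  subst j'; rewrite /F /= !gidE !sglE bS gd.
  have E : gid Y (i + 1 + n) (i + n + 1) (cx_d Y (i + n) (i + 1 + n) (g i x)) =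
      cx_d Y (i + n) (i + n + 1) (g i x) by rewrite -(gid_d _ erefl ej) gidE.
  by case: (oddz n); case: (b i); rewrite //= ?opprK ?linearN E.
exists (fun i j => sgl (oddz n (+) b i) (h i (j + n)) : {linear X i -> shift Y n j}) => i x.
rewrite shift_dE [X in X + _](_ : _ = 0) // add0r.
have e : i - 1 + n + 1 = i + n by lia.
have := hP i (i + 1) (i - 1 + n) (i + n) erefl erefl e x.
rewrite /F /= gidE sglE gE !sglE bS => hE.
have {hE}-> : f i x = (if b i then - (cx_d Y (i - 1 + n) (i + n) (h i (i - 1 + n) x)
    + h (i + 1) (i + n) (cx_d X i (i + 1) x))
   else cx_d Y (i - 1 + n) (i + n) (h i (i - 1 + n) x)
    + h (i + 1) (i + n) (cx_d X i (i + 1) x)).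
  by case: (b i) hE => [<-|<-] //; rewrite opprK.
by case: (oddz n); case: (b i); rewrite /= ?linearN ?opprK ?opprD.
Qed.
End IfMod.

Section Concentrated.
Context {k : fieldType} {A : falgType k}.
Implicit Types N Q : fgmod A.
Implicit Types P X Y Z R : complex A.

(** A cocycle X (c - n) -> Z c is itself a chain map X -> Z[n]. *)
Lemma hom_van_concentrated X Z (c n : int) : (forall j, j != c -> is_zero (Z j)) ->
  hom_van X Z n -> coh_van X (Z c) (c - n).
Proof.
move=> Z0 H h l hc cl phi phid.
have [|s sP] := H (fun i j => lcomp (gid Z c j) (lcomp phi (gid X i (c - n)))).
  move=> i j i' j' e1 e2 e3 x.
  case: (eqVneq j' c) => jc; last by rewrite [LHS](Z0 _ jc) ?[RHS](Z0 _ jc).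
  have jc' : j != c by lia.
  rewrite [X in cx_d Z j j' X](Z0 _ jc') linear0 /= -(gid_d (i := i) (i' := h)); try lia.
  by rewrite phid linear0.
exists (s l c) => x.
have e1 : c - n + n = c by rewrite subrK.
have := sP (c - n) l (c - 1) c e1 cl (subrK _ _) x; rewrite /= !gidE => ->.
by rewrite [X in cx_d Z (c - 1) c X](Z0 (c - 1)) ?linear0 ?add0r //; lia.
Qed.

Lemma retract_ifmod (b : bool) Q : retract (ifmod b Q) Q.
Proof. by exists (ifout b Q), (ifin b Q) => x; rewrite ifoutK. Qed.
Lemma ifmod_retract (b : bool) Q : b -> retract Q (ifmod b Q).
Proof. by exists (ifin b Q), (ifout b Q) => x; rewrite ifinK. Qed.

Definition shifted_stalk Q (d : nat) := shift (stalk Q) d%:Z.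
Lemma shifted_stalk_zero Q d j : j != - d%:Z -> is_zero (shifted_stalk Q d j).
Proof. by move=> jd; apply: ifmod_zero; lia. Qed.
Lemma shifted_stalk_proj Q d : projective Q -> cxproj (shifted_stalk Q d).
Proof. by move=> Qp j; apply: ifmod_proj. Qed.
Lemma shifted_stalk_retract Q d j : j = - d%:Z -> retract Q (shifted_stalk Q d j).
Proof. by move=> ->; apply: ifmod_retract; rewrite addNr. Qed.
Lemma shifted_stalk_retract' Q d j : retract (shifted_stalk Q d j) Q.
Proof. exact: retract_ifmod. Qed.
Lemma coh_van_retract X N N' i : retract N N' -> coh_van X N' i -> coh_van X N i.
Proof. by case: (coh_van_add X i) => _ H _; exact: H. Qed.

Lemma hom_van_shifted_stalk X Q d n : hom_van X (shifted_stalk Q d) n -> coh_van X Q (- d%:Z - n).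
Proof.
move=> H; apply: (coh_van_retract (shifted_stalk_retract Q (d := d) erefl)).
by apply: hom_van_concentrated H => j; exact: shifted_stalk_zero.
Qed.

(** Induct on the dimension of Q. If Q decomposes, its parts are smaller.
    If Q is indecomposable and not among the summands of PU, then Q + PU is
    basic, which contradicts the maximality of PU. *)
Lemma proj_perp_add (U C : fgmod A -> Prop) PU : maximal_basic_proj_perp U PU ->
  add_closed C -> C PU -> forall Q, projective Q ->
  (forall N, U N -> forall (f : {linear Q -> N}) x, f x = 0) -> C Q.
Proof.
move=> [[[s [sI sind siso]] PUp PU0] PUmax] [C0 Cr Cd] CPU Q.
have [m mE] : exists m, (kdim Q < m)%N by exists (kdim Q).+1.
elim: m Q mE => // m IH Q mE Qp Q0.
have [/C0 //|Qnz] := pselect (is_zero Q).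
have [[_ Qi]|nQi] := pselect (indecomposable Q).
  have [[j js jiso]|nj] := pselect (exists2 j, (j < size s)%N & iso Q (nth zeromod s j)).
    apply: Cr CPU; apply: retract_comp (iso_retract jiso) _.
    apply: retract_comp (iso_retract (iso_sym sI)).
    elim: s j js {sI sind siso jiso} => // N s IHs [|j] /= js; first exact: retract_dsuml.
    exact: retract_comp (IHs _ _) (retract_dsumr _ _).
  have bQ : basic_proj_perp U (dsum2 Q PU).
    split.
    - exists (Q :: s); split=> /=.
      + have [f fb] := sI; have [g fK gK] := fb.
        exists (pair_lin (fst_lin Q PU) (lcomp f (snd_lin Q PU))).
        by exists (fun z => (z.1, g z.2)) => -[x y]; rewrite ?pair_linE /= ?fK ?gK // ;
          rewrite /pair_lin_fun /= ?fK ?gK.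
      + case=> [|i] /= ilt; last exact: sind.
        by split.
      + case=> [|i] [|j] //= ij; last exact: siso.
        by move=> Qs; apply: nj; exists j.
    - by case: (@proj_add k A) => _ _; apply.
    - move=> N UN f [x y].
      have := Q0 N UN (lcomp f (inl_lin Q PU)) x; have := PU0 N UN (lcomp f (inr_lin Q PU)) y.
      move=> /= fy fx; rewrite -[RHS]addr0 -{1}fx -fy -linearD; congr (f _).
      by congr (_, _); rewrite /= ?addr0 ?add0r.
  have [f fb] := PUmax _ bQ (retract_summand (retract_dsumr Q PU)).
  have [g fK gK] := fb; exfalso; apply: Qnz => x.
  have ss : surj (lcomp (snd_lin Q PU) f) by move=> y; exists (g (0, y)); rewrite /= gK.
  have si := (kdim_surj ss).2 erefl.
  (* An isomorphism of PU with Q + PU followed by the projection is a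
     surjective endomorphism of PU, hence injective; so Q = 0. *)
  have gx0 : g (x, 0) = 0 by apply: (inj_eq0 si); rewrite /= gK.
  by have := gK (x, 0); rewrite gx0 linear0 => -[<-].
have [N [Z [QNZ [Nnz Znz]]]] : exists N (Z : fgmod A), iso Q (dsum2 N Z) /\ ~ is_zero N /\ ~ is_zero Z.
  apply: contrapT => H; apply: nQi; split=> // N Z QNZ.
  have [|Nnz] := pselect (is_zero N); first by left.
  have [|Znz] := pselect (is_zero Z); first by right.
  by case: H; exists N, Z.
have small N' (Z' : fgmod A) : retract N' Q -> iso Q (dsum2 N' Z') \/ iso Q (dsum2 Z' N') ->
    ~ is_zero Z' -> C N'.
  move=> rN' isoQ Z'nz; apply: IH.
  - apply: (@leq_trans (kdim Q)) => //; rewrite ltnNge; apply/negP => le; apply: Z'nz => z.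
    have [i [ii [j [ij [r [rs rz]]]]]] : exists i : {linear N' -> Q}, injective i /\
        exists j : {linear Z' -> Q}, injective j /\ exists r : {linear Q -> Z'},
        (forall z, r (j z) = z) /\ forall n, r (i n) = 0.
      case: isoQ => -[f fb]; have [g fK gK] := fb;
        have [g' [gK1 gK2]] := iso_bij (bij_inj fb) (fun y => ex_intro _ (g y) (gK y)).
      + exists (lcomp g' (inl_lin _ _)); split.
          by apply: inj0 => x /= /(inj_eq0 (can_inj gK2)) [].
        exists (lcomp g' (inr_lin _ _)); split.
          by apply: inj0 => x /= /(inj_eq0 (can_inj gK2)) [].
        by exists (lcomp (snd_lin _ _) f); split=> x; rewrite /= gK2.
      + exists (lcomp g' (inr_lin _ _)); split.
          by apply: inj0 => x /= /(inj_eq0 (can_inj gK2)) [].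
        exists (lcomp g' (inl_lin _ _)); split.
          by apply: inj0 => x /= /(inj_eq0 (can_inj gK2)) [].
        by exists (lcomp (fst_lin _ _) f); split=> x; rewrite /= gK2.
    have [le' isj] := kdim_inj ii.
    have [|n nE] := isj _ (j z); first by apply/eqP; rewrite eqn_leq le le'.
    by rewrite -(rs z) -nE rz.
  - by case: (@proj_add k A) => _ H _; exact: H rN' Qp.
  - have [i [r ri]] := rN'; move=> N1 UN1 f x.
    by rewrite -(ri x); exact: (Q0 N1 UN1 (lcomp f r)).
have rQ := iso_retract (iso_sym QNZ).
apply: (Cr _ _ (iso_retract QNZ)); apply: Cd.
  by apply: (small N Z) => //; [exact: retract_comp (retract_dsuml _ _) rQ | left].
by apply: (small Z N) => //; [exact: retract_comp (retract_dsumr _ _) rQ | right].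
Qed.
End Concentrated.

(** * The silting complex and its left orthogonal *)

Section Silting.
Context {k : fieldType} {A : falgType k}.
Implicit Types F I J K N Q T V W : fgmod A.
Implicit Types X Y Z R : complex A.
Variables (d : nat) (M U : fgmod A -> Prop).
Hypotheses (d_gt0 : (1 <= d)%N) (M_ct : cluster_tilting d M) (U_tors : torsion_class d M U).
Hypothesis U_cov : covariantly_finite U.
Variables (MU PU : fgmod A) (P : complex A) (eps : {linear P 0 -> MU}).
Hypotheses (MU_gen : ext_projective_generator d U MU) (PU_max : maximal_basic_proj_perp U PU)
  (P_min : min_proj_resolution eps).

Let R := trunc (- d%:Z) P.
Let S := cx_sum R (shifted_stalk PU d).

Lemma silt_proj : cxproj S.
Proof.
have [[_ Pp _ _ _] _ _] := P_min; have [[_ PUp _] _] := PU_max.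
move=> i; case: (@proj_add k A) => _ _ H; apply: H; first exact: ifmod_proj.
exact: shifted_stalk_proj.
Qed.

Lemma silt_low i : i < - d%:Z -> is_zero (S i).
Proof.
move=> id; apply: dsum2_zero; first by apply: (@ifmod_zero _ _ (- d%:Z <= i) (P i)); lia.
by apply: shifted_stalk_zero; lia.
Qed.

Lemma silt_res : exists e : {linear R 0 -> MU}, trunc_res d e.
Proof. by case: P_min => Pe _ _; exact: (trunc_res_trunc d_gt0 Pe). Qed.

Lemma silt_high i : 0 < i -> is_zero (S i).
Proof.
have [e [R1 _ _ _ _]] := silt_res.
by move=> id; apply: dsum2_zero; [exact: R1 | apply: shifted_stalk_zero; lia].
Qed.

Lemma silt_Kb : in_Kb_proj S.
Proof.
split; last exact: silt_proj.
exists d => i di; case: (ltrP 0 i) => i0; first exact: silt_high.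
by apply: silt_low; lia.
Qed.

(** For 0 < n < d this is Ext^n(MU, MU) = 0, and for n = d it is
    rigid_extend. *)
Lemma silt_coh_van n : 0 < n -> coh_van S MU (- n).
Proof.
move=> n0; have [Pe _ _] := P_min; have [[UMU eMU] _] := MU_gen.
apply: coh_van_sum.
  case: (ltrP (- n) (- d%:Z)) => nd; first by
    apply: coh_van_zero; apply: (@ifmod_zero _ _ (- d%:Z <= - n) (P (- n))); lia.
  case: (eqVneq n d%:Z) => [e|ne].
    apply: coh_van_trunc_bot; first by rewrite e.
    move=> j ij f.
    apply: (rigid_extend d_gt0 M_ct U_tors U_cov MU_gen.1 P_min UMU _ ij).
    by rewrite e.
  apply: coh_van_trunc; first by lia.
  have -> : n = `|n|%N%:Z by lia.
  apply/(coh_van_extP _ _ Pe); apply: (M_ext d_gt0 M_ct); try exact: (U_sub_M U_tors).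
  by lia.
case: (eqVneq (- n) (- d%:Z)) => ne; last by apply/coh_van_zero/shifted_stalk_zero.
apply: coh_van_nohom => f x; have [[_ _ PU0] _] := PU_max.
have [i [r ri]] := shifted_stalk_retract' PU d (- n).
by rewrite -(ri x); exact: (PU0 MU UMU (lcomp f r)).
Qed.

Lemma silt_hom_van n : 0 < n -> hom_van S S n.
Proof.
move=> n0; have [e eR] := silt_res; apply: hom_van_sum.
  apply: (hom_van_trunc_res eR) => //; first exact: silt_proj.
    by move=> i; exact: silt_low.
  exact: silt_coh_van.
apply: hom_van_zero => i; case: (ltrP i (- d%:Z)) => id; first by left; exact: silt_low.
by right; apply: shifted_stalk_zero; lia.
Qed.

(** Downward induction on the degree. If there is no cohomology below
    degree -m, then vanishing in degree -m passes to quotients and to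
    extensions of modules. Let p : F -> N be a surjection from a projective
    module, and let I and K be the image and the kernel of the minimal left
    U-approximation of F. Vanishing holds for I by coh_van_approx_chain,
    hence for N / p(K), a quotient of I. If p(K) is a proper submodule,
    induct on the dimension of N. If p(K) = N, then N is a quotient of a
    summand of F contained in K; such a summand has no maps to U, so it
    lies in add PU, where vanishing is given by the hypothesis on X. *)
Lemma silt_coh X : in_Kb_proj X -> (forall n, 0 < n -> hom_van X S n) ->
  forall m N, (d < m)%N -> coh_van X N (- m%:Z).
Proof.
move=> [[b Xb] Xp] XS.
suff H r m N : (d < m)%N -> (b < m + r)%N -> coh_van X N (- m%:Z).
  by move=> m N dm; apply: (H b) => //; lia.
elim: r m N => [|r IH] m N dm br; first by apply: coh_van_zero; apply: Xb; lia.
have Z j Q : (m < j)%N -> coh_van X Q (- j%:Z) by move=> mj; apply: IH; lia.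
have [e eR] := silt_res.
(* Chain maps to R[j] compute Hom(X, MU) in degree -j, provided that Hom(X,
   -) has no cohomology in degree -j - d - 1; this is where j + d >= m
   enters. *)
have HMU j : (j <= m <= j + d)%N -> coh_van X MU (- j%:Z).
  move=> jm; apply: (hom_van_trunc_res_coh_van d_gt0 eR Xp).
    move=> Q; have -> : - j%:Z - d%:Z - 1 = - (j + d).+1%:Z by lia.
    by apply: Z; lia.
  by apply: hom_van_suml (XS j%:Z _); lia.
have HT T j : ext_projective d U T -> (j <= d)%N -> coh_van X T (- m%:Z + j%:Z).
  move=> Tp jd; have -> : - m%:Z + j%:Z = - (m - j)%N%:Z by lia.
  apply: (in_add_closed (coh_van_add X _) _ (MU_gen.2 T Tp)).
  by apply: HMU; lia.
have HPU : coh_van X PU (- m%:Z).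
  have -> : - m%:Z = - d%:Z - (m - d)%N%:Z by lia.
  by apply: hom_van_shifted_stalk; apply: hom_van_sumr (XS _ _); lia.
have quot N1 N2 (p : {linear N1 -> N2}) : surj p -> coh_van X N1 (- m%:Z) -> coh_van X N2 (- m%:Z).
  move=> ps H; have [K [i s]] := ker_ses ps.
  apply: (coh_van_right (h := - m.+1%:Z) Xp s) => //; first lia.
  exact: Z.
have [l lE] : exists l, (kdim N < l)%N by exists (kdim N).+1.
elim: l N lE => // l IHl N lE.
have [F [p [Fp ps]]] := proj_cover N.
have [T [f fm]] := minlapprox_ex U_tors U_cov F.
have [I [q [i [qs ii iq]]]] := img_ex f.
have HI := coh_van_approx_chain d_gt0 M_ct U_tors U_cov Xp Fp HT fm qs ii iq.
have [K [c [ci ce]]] := ker_ex f.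
have [N' [a [j [as_ ji ja]]]] := img_ex (lcomp p c).
have [C [pC s]] := coker_ses ji; have [_ re rs] := s.
have [|t tE] := @fact_surj _ _ _ _ q (lcomp pC p) qs.
  move=> x qx; have /ce[y yE] : f x = 0 by rewrite -iq qx linear0.
  by rewrite /= -yE; apply/re; exists (a y); rewrite ja.
have HC : coh_van X C (- m%:Z).
  apply: (quot _ _ t) HI => y; have [x <-] := rs y; have [z <-] := ps x.
  by exists (q z); rewrite tE.
have [le js] := kdim_inj ji.
case: (eqVneq (kdim N') (kdim N)) => [eq|ne]; last first.
  by apply: (coh_van_mid Xp s) => //; apply: IHl; lia.
have {}js := js eq.
(* As p maps K onto N, there is th with p c th = p, and p factors through
   the image of any power of the endomorphism c th of F. By Fitting, some
   such image is a direct summand of F; it lies in K, the image of c. *)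
have [th thE] : exists th : {linear F -> K}, forall x, p (c (th x)) = p x.
  apply: (@proj_lift _ _ F _ _ (lcomp p c) p Fp) => x.
  by have [z zE] := js (p x); have [y yE] := as_ z; exists y; rewrite -ja yE zE.
have [n [F' [i' [r' [ri iP iP']]]]] := fitting (lcomp c th).
have pE n' x : p (lpow (lcomp c th) n' x) = p x.
  by elim: n' => //= n' IHn; rewrite thE.
apply: (quot F' N (lcomp p i')).
  move=> y; have [x <-] := ps y; have [z zE] := iP' x; exists z.
  by rewrite /= zE pE.
apply: (proj_perp_add PU_max (coh_van_add X _) HPU).
  by case: (@proj_add k A) => _ H _; apply: H Fp; exists i', r'.
move=> V UV g y; have [[UT fa] _] := fm.
have [h hE] := fa V (lcomp g r') UV.
have [x xE] := iP y.
rewrite -(ri y) -[g _]/(lcomp g r' (i' y)) -hE xE /= (exact_comp _ ce).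
exact: linear0.
Qed.
End Silting.

(** * Cones, homotopy retracts and thick subcategories *)

Section Cones.
Context {k : fieldType} {A : falgType k}.
Implicit Types M N Q : fgmod A.
Implicit Types P R S X Y Z : complex A.

Lemma cmap_ext_d X Y (f : cmap X Y) i j i' j' x : i = j -> i' = j' ->
  cmap_ext f i' j' (cx_d X i i' x) = cx_d Y j j' (cmap_ext f i j x).
Proof. by move=> <- <-; rewrite !cmap_ext_diag cmap_comm. Qed.

Lemma cone_dE X Y (f : cmap X Y) i j z : cx_d (cone f) i j z =
  (- cx_d X (i + 1) (j + 1) z.1, cmap_ext f (i + 1) j z.1 + cx_d Y i j z.2).
Proof. by []. Qed.

Lemma cx_sum_dE X Y i j z : cx_d (cx_sum X Y) i j z = (cx_d X i j z.1, cx_d Y i j z.2).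
Proof. by []. Qed.

(** Exactness of Hom(Z, -) on the triangle of f, in components. *)
Lemma hom_van_cone_into X Y (f : cmap X Y) Z n :
  hom_van Z X (n + 1) -> hom_van Z Y n -> hom_van Z (cone f) n.
Proof.
move=> HX HY u uc.
have [a [b uE]] : exists (a : gmap Z X) (b : gmap Z Y), forall i j x,
    u i j x = (a i (j + 1) x, b i j x).
  exists (fun i j => lcomp (gid X (j - 1 + 1) j) (lcomp (fst_lin _ _) (u i (j - 1)))).
  exists (fun i j => lcomp (snd_lin _ _) (u i j)) => i j x.
  rewrite /= [LHS]surjective_pairing; congr (_, _).
  have : j + 1 - 1 = j by rewrite addrK.
  by move: (j + 1 - 1) => j0 e; subst j0; rewrite gidE.
have [|s sP] := hom_van_anti (f := a) HX.
  move=> i j i' j' e1 e2 e3 x; subst j'.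
  have e : i + n = j - 1 by lia.
  have := uc i (j - 1) i' j e e2 (subrK _ _) x; rewrite !uE cone_dE /= => -[+ _].
  by rewrite subrK.
have [|t tP] := HY (fun i j => add_lin (b i j) (lcomp (cmap_ext f j j) (s i j))).
  move=> i j i' j' e1 e2 e3 x.
  have := uc i j i' j' e1 e2 e3 x; rewrite !uE cone_dE /= => -[_ E].
  rewrite /= linearD E -(cmap_ext_d f _ erefl erefl).
  have e4 : i + (n + 1) = j' by rewrite -e3 -e1 addrA.
  subst j'; rewrite (sP i i' j _ e4 e2 erefl) linearB /=.
  by rewrite addrAC subrK addrC.
exists (fun i j => pair_lin (opp_lin (s i (j + 1))) (t i j)) => i i' j' j e1 e2 e3 x.
rewrite uE cone_dE; congr (_, _); rewrite /= /pair_lin_fun /=.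
  rewrite linearN opprK; apply: sP; lia.
have := tP i i' j' j e1 e2 e3 x; rewrite /= => /(canRL (addrK _)) ->.
by clear e1; subst j; rewrite [in RHS]linearN -[RHS]addrA [RHS]addrC.
Qed.

Definition ganti X Y (n : int) (f : gmap X Y) := forall i j i' j' : int,
  i + n = j -> i + 1 = i' -> j + 1 = j' ->
  forall x, f i' j' (cx_d X i i' x) = - cx_d Y j j' (f i j x).

Lemma cone_from_dec X Y (f : cmap X Y) Z (u : gmap (cone f) Z) :
  exists (a : gmap X Z) (b : gmap Y Z), forall i j z, u i j z = a (i + 1) j z.1 + b i j z.2.
Proof.
have [a aE] : exists a : gmap X Z, forall i j x, a (i + 1) j x = u i j (x, 0).
  exists (fun i j => lcomp (u (i - 1) j) (lcomp (inl_lin _ _) (gid X i (i - 1 + 1)))).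
  move=> i j x; have : i + 1 - 1 = i by rewrite addrK.
  rewrite /= /pair_lin_fun /=; move: (i + 1 - 1) => i0 e; subst i0.
  by rewrite gidE.
exists a, (fun i j => lcomp (u i j) (inr_lin _ _)) => i j [x y].
rewrite aE /= -linearD; congr (u i j _).
by rewrite /pair_lin_fun; congr (_, _); rewrite /= ?addr0 ?add0r.
Qed.

(** Exactness of Hom(-, Z) on the triangle of f. A map u out of the cone is
    null on Y; subtracting a homotopy leaves an anticommuting family a on
    X, that is, a map X[1] -> Z[n]. By the last hypothesis a factors
    through f up to homotopy, so that it becomes null on the cone. *)
Lemma hom_van_cone_from X Y (f : cmap X Y) Z n m : m + 1 = n -> hom_van Y Z n ->
  (forall a : gmap X Z, ganti m a -> exists (s : gmap X Z) (b : gmap Y Z), ganti m b /\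
     forall i i' j' j, i + m = j -> i + 1 = i' -> j' + 1 = j -> forall x,
     a i j x = cx_d Z j' j (s i j' x) - s i' j (cx_d X i i' x) + b i j (f i x)) ->
  hom_van (cone f) Z n.
Proof.
move=> mn HY HX u uc; have [a0 [b uE]] := cone_from_dec u.
have [|h hP] := HY b.
  move=> i j i' j' e1 e2 e3 y.
  have := uc i j i' j' e1 e2 e3 (0, y); rewrite !uE cone_dE /=.
  by rewrite !linear0 !add0r.
pose a : gmap X Z := fun i j => sub_lin (a0 i j) (lcomp (h i j) (f i)).
have [|s [c [ca sP]]] := HX a.
  move=> i1 j i2 j' e1 e2 e3 x.
  have [i e] : exists i, i + 1 = i1 by exists (i1 - 1); rewrite subrK.
  subst i1; have e4 : i + n = j by lia.
  have := uc i j (i + 1) j' e4 erefl e3 (x, 0); rewrite !uE cone_dE /=.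
  rewrite !linear0 !addr0 linearN e2 cmap_ext_diag.
  have e5 : i + 1 + n = j' by lia.
  rewrite (hP (i + 1) i2 j j' e5 e2 e3) -cmap_comm => E.
  rewrite /a /= linearB opprB -E.
  by rewrite opprD opprK opprD addrCA addNKr.
exists (fun i j => add_lin (lcomp (s (i + 1) j) (fst_lin _ _))
          (lcomp (add_lin (h i j) (c i j)) (snd_lin _ _))) => i i' j' j e1 e2 e3 [x y].
rewrite uE cone_dE /= -e2 cmap_ext_diag !linearD !linearN /=.
have e4 : i + 1 + m = j by lia.
have e6 : i + m = j' by lia.
have := sP (i + 1) (i + 1 + 1) j' j e4 erefl e3 x.
rewrite /a /= => /(canRL (subrK _)) ->.
rewrite (hP i (i + 1) j' j e1 erefl e3) (ca i j' (i + 1) j e6 erefl e3).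
rewrite !addrA [RHS](GRing.add.[ACl 1*4*7*5*2*6*(3*8)]) /=.
by rewrite subrr addr0.
Qed.
End Cones.

Section Thick.
Context {k : fieldType} {A : falgType k}.
Implicit Types M N Q : fgmod A.
Implicit Types P R S X Y Z : complex A.

Definition homotopy_retract X Y := exists (f : cmap X Y) (g : cmap Y X) (tau : gmap X X),
  forall j i l, j + 1 = i -> i + 1 = l -> forall x,
    x - g i (f i x) = tau l i (cx_d X i l x) + cx_d X j i (tau i j x).

Lemma homotopy_retract_strict X Y (f : cmap X Y) (g : cmap Y X) :
  (forall i x, g i (f i x) = x) -> homotopy_retract X Y.
Proof.
move=> gf; exists f, g, (fun _ _ => zero_lin _ _) => j i l _ _ x.
by rewrite gf subrr linear0 addr0.
Qed.

(** If the connecting map cone f -> X[1] is null-homotopic, the Y-component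
    of the homotopy is a left inverse of f up to homotopy, and the
    X-component is the homotopy that shows this. *)
Lemma hom_van_conn X Y (f : cmap X Y) : hom_van (cone f) X 1 -> homotopy_retract X Y.
Proof.
move=> H.
pose w : gmap (cone f) X := fun i j => lcomp (gid X (i + 1) j) (fst_lin (X (i + 1)) (Y i)).
have [|s sP] := hom_van_anti (f := w) H.
  move=> i j i' j' e1 e2 e3 z; subst i'; rewrite cone_dE /= linearN; congr (- _).
  by rewrite [RHS](gid_d (j := i + 1 + 1)) //; lia.
pose r i : {linear Y i -> X i} := opp_lin (lcomp (s i i) (inr_lin (X (i + 1)) (Y i))).
have rc i j x : r j (cx_d Y i j x) = cx_d X i j (r i x).
  case: (eqVneq j (i + 1)) => [->|ij]; last by rewrite !cx_shape ?linear0.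
  have := sP i (i + 1) i (i + 1) erefl erefl erefl (0, x).
  rewrite cone_dE /= !linear0 add0r => /esym/subr0_eq E.
  by rewrite /r /= /pair_lin_fun /= linearN -E.
exists f, (CMap rc), (fun i j => lcomp (s j j) (lcomp (inl_lin _ _) (gid X i (j + 1)))).
move=> j i l e1 e2 x; subst l; subst i.
have := sP j (j + 1) j (j + 1) erefl erefl erefl (x, 0).
rewrite cone_dE /= /pair_lin_fun /= !gidE cmap_ext_diag linear0 addr0 => E.
have E2 : s (j + 1) (j + 1) (- cx_d X (j + 1) (j + 1 + 1) x, f (j + 1) x)
    = - s (j + 1) (j + 1) (cx_d X (j + 1) (j + 1 + 1) x, 0) + s (j + 1) (j + 1) (0, f (j + 1) x).
  rewrite -(linearN (s _ _)) -(linearD (s _ _)); congr (s _ _ _).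
  by congr (_, _); rewrite /= ?addr0 ?oppr0 ?add0r.
rewrite E2 in E; rewrite opprK {1}E opprD opprK addrA subrK addrC.
by [].
Qed.

Lemma dsum2_proj M N : projective M -> projective N -> projective (dsum2 M N).
Proof. by case: (@proj_add k A) => _ _; apply. Qed.

Lemma cone_Kb X Y (f : cmap X Y) : in_Kb_proj X -> in_Kb_proj Y -> in_Kb_proj (cone f).
Proof.
move=> [[n Xn] Xp] [[m Ym] Yp]; split; last by move=> i; exact: dsum2_proj.
by exists (n + m).+1 => i ni; apply: dsum2_zero; [apply: Xn | apply: Ym]; lia.
Qed.

Lemma cx_sum_Kb X Y : in_Kb_proj X -> in_Kb_proj Y -> in_Kb_proj (cx_sum X Y).
Proof.
move=> [[n Xn] Xp] [[m Ym] Yp]; split; last by move=> i; exact: dsum2_proj.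
by exists (n + m)%N => i ni; apply: dsum2_zero; [apply: Xn | apply: Ym]; lia.
Qed.

Lemma shift_Kb X n : in_Kb_proj X -> in_Kb_proj (shift X n).
Proof.
move=> [[m Xm] Xp]; split; last by move=> i; exact: Xp.
by exists (m + `|n|)%N => i ni; apply: Xm; lia.
Qed.

Lemma homotopic_intro X Y (u v : forall i, {linear X i -> Y i}) (h : gmap X Y) :
  (forall j i l, j + 1 = i -> i + 1 = l -> forall x,
    u i x = v i x + (cx_d Y j i (h i j x) + h l i (cx_d X i l x))) -> homotopic u v.
Proof. by move=> H; exists h => i x; apply: H => //; rewrite subrK. Qed.

(** Thick subcategories are closed under strict summands only. If g f is
    homotopic to the identity through tau, then Y is homotopy equivalent to
    X + cone f by the maps y |-> (g y, (0, y)) and (x, (x', y)) |-> f x + f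
    (tau x') + y - f (g y), one of whose composites is the identity of Y. *)
Lemma homotopy_retract_thick X Y (T : complex A -> Prop) : in_Kb_proj X -> thick T ->
  homotopy_retract X Y -> T Y -> T X.
Proof.
move=> XK Tt [f [g [tau tauP]]] TY.
have YK := thick_Kb Tt TY; have CK := cone_Kb f XK YK.
apply: (thick_summand Tt XK CK); apply: (thick_iso Tt) TY; first exact: cx_sum_Kb.
pose a i : {linear Y i -> cx_sum X (cone f) i} :=
  pair_lin (g i) (pair_lin (zero_lin (Y i) (X (i + 1))) (idlin (Y i))).
have aE i y : a i y = (g i y, (0, y)) by [].
pose b i : {linear cone f i -> Y i} := copair (lcomp (f i) (tau (i + 1) i))
  (sub_lin (idlin (Y i)) (lcomp (f i) (g i))).
have bE i z : b i z = f i (tau (i + 1) i z.1) + (z.2 - f i (g i z.2)) by [].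
have bc i j z : b j (cx_d (cone f) i j z) = cx_d Y i j (b i z).
  case: (eqVneq j (i + 1)) => [->|ij]; last by rewrite !cx_shape ?linear0.
  rewrite !bE cone_dE /= cmap_ext_diag ?(linearD, linearN) /= -?cmap_comm.
  have := tauP i (i + 1) (i + 1 + 1) erefl erefl z.1.
  move=> /(congr1 (f (i + 1))); rewrite linearB linearD /= => /(canRL (subrK _)) E.
  set F := f (i + 1) z.1 in E *; rewrite {1}E !addrA.
  rewrite [LHS](GRing.add.[ACl (1*2)*(4*6)*3*5*7]) /=.
  by rewrite addNr subrr !add0r.
pose c i : {linear cx_sum X (cone f) i -> Y i} := copair (f i) (b i).
have cE i z : c i z = f i z.1 + b i z.2 by [].
have ac i j y : a j (cx_d Y i j y) = cx_d (cx_sum X (cone f)) i j (a i y).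
  by rewrite !aE cx_sum_dE cone_dE /= !linear0 add0r cmap_comm.
have cc i j z : c j (cx_d (cx_sum X (cone f)) i j z) = cx_d Y i j (c i z).
  rewrite !cE cx_sum_dE (linearD (cx_d Y i j)) -[(_, _).1]/(cx_d X i j z.1).
  by rewrite -[(_, _).2]/(cx_d (cone f) i j z.2) bc cmap_comm.
exists (CMap ac), (CMap cc); split.
  apply: (homotopic_intro (h := fun _ _ => zero_lin _ _)) => j i l _ _ y.
  rewrite linear0 !addr0 [LHS]/= -[LHS]/(c i (a i y)) cE bE aE /= !linear0 add0r.
  by rewrite addrC subrK.
pose h1 i j : {linear cx_sum X (cone f) i -> X j} := copair (opp_lin (tau i j))
  (copair (opp_lin (lcomp (tau i j) (tau (i + 1) i))) (lcomp (tau i j) (g i))).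
pose h2 i j : {linear cx_sum X (cone f) i -> X (j + 1)} := lcomp (gid X i (j + 1))
  (copair (idlin (X i)) (copair (tau (i + 1) i) (opp_lin (g i)))).
pose h : gmap (cx_sum X (cone f)) (cx_sum X (cone f)) := fun i j =>
  pair_lin (h1 i j) (pair_lin (h2 i j) (zero_lin (cx_sum X (cone f) i) (Y j))).
have hE i j x x' y : h i j (x, (x', y)) =
  (- tau i j x + (- tau i j (tau (i + 1) i x') + tau i j (g i y)),
   (gid X i (j + 1) (x + (tau (i + 1) i x' - g i y)), 0)) by [].
apply: (homotopic_intro (h := h)) => j i l e1 e2 [x [x' y]].
subst i; subst l; rewrite [LHS]/= -[LHS]/(a (j + 1) (c (j + 1) (x, (x', y)))) aE cE bE.
rewrite !cx_sum_dE !cone_dE !hE /=.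
rewrite !cmap_ext_diag !gidE.
have E1 u := tauP j (j + 1) (j + 1 + 1) erefl erefl u.
have E2 := tauP (j + 1) (j + 1 + 1) (j + 1 + 1 + 1) erefl erefl x'.
have gf u : g (j + 1) (f (j + 1) u) = u - tau (j + 1 + 1) (j + 1) (cx_d X (j + 1) (j + 1 + 1) u)
    - cx_d X j (j + 1) (tau (j + 1) j u).
  by rewrite -[LHS](subKr u) E1 opprD addrA.
have gf' : g (j + 1 + 1) (f (j + 1 + 1) x') =
    x' - tau (j + 1 + 1 + 1) (j + 1 + 1) (cx_d X (j + 1 + 1) (j + 1 + 1 + 1) x')
    - cx_d X (j + 1) (j + 1 + 1) (tau (j + 1 + 1) (j + 1) x').
  by rewrite -[LHS](subKr x') E2 opprD addrA.
congr (_, (_, _)).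
- rewrite !(linearD, linearN) /= gf (gf (tau _ _ x')) (gf (g _ y)) gf' [g _ (cx_d Y _ _ y)]cmap_comm.
  rewrite !(linearD, linearN) /= ?(opprD, opprK) !addrA.
  rewrite [LHS](GRing.add.[ACl 1*2*3*4*5*6*9*10*(7*8)]) /=.
  rewrite [RHS](GRing.add.[ACl 1*5*2*7*9*3*10*4*(6*8)]) /=.
  by rewrite !subrr.
- rewrite !(linearD, linearN) /= gf' [g _ (cx_d Y _ _ y)]cmap_comm ?(opprD, opprK) !addrA.
  rewrite [RHS](GRing.add.[ACl (1*7)*(2*5)*(3*9)*(4*10)*(6*8)]) /=.
  by rewrite !(subrr, addNr) !addr0.
- rewrite [RHS]/= linear0 !addr0 !linearD linearN !addrA.
  by rewrite [LHS](GRing.add.[ACl 3*1*2*4]).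
Qed.

Section ConeIn.
Variables (X Y : complex A) (f : cmap X Y).
Definition cone_in_fun i : {linear Y i -> cone f i} := inr_lin (X (i + 1)) (Y i).
Lemma cone_in_comm i j x : cone_in_fun j (cx_d Y i j x) = cx_d (cone f) i j (cone_in_fun i x).
Proof.
by rewrite cone_dE /= /pair_lin_fun /= !linear0 add0r.
Qed.
Definition cone_in : cmap Y (cone f) := CMap cone_in_comm.

(** The cone of Y -> cone f is X[1] plus the contractible cone of the
    identity of Y. *)
Lemma homotopy_retract_shift_cone : homotopy_retract (shift X 1) (cone cone_in).
Proof.
pose u i : {linear shift X 1 i -> cone cone_in i} :=
  pair_lin (opp_lin (f (i + 1))) (inl_lin (X (i + 1)) (Y i)).
have uE i x : u i x = (- f (i + 1) x, (x, 0)) by [].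
pose v i : {linear cone cone_in i -> shift X 1 i} :=
  lcomp (fst_lin (X (i + 1)) (Y i)) (snd_lin (Y (i + 1)) (cone f i)).
have uc i j x : u j (cx_d (shift X 1) i j x) = cx_d (cone cone_in) i j (u i x).
  case: (eqVneq j (i + 1)) => [->|ij]; last by rewrite !cx_shape ?linear0.
  rewrite shift_dE !uE cone_dE /= cmap_ext_diag /= /pair_lin_fun /=.
  rewrite !linearN !cmap_comm /= cmap_ext_diag linear0 addr0.
  congr (_, _); rewrite ?opprK //.
  by congr (_, _); rewrite /= ?add0r ?addNr.
have vc i j x : v j (cx_d (cone cone_in) i j x) = cx_d (shift X 1) i j (v i x).
  case: (eqVneq j (i + 1)) => [->|ij]; last by rewrite !cx_shape ?linear0.
  rewrite shift_dE cone_dE cmap_ext_diag cone_dE /v /= /pair_lin_fun /=.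
  by rewrite add0r.
by apply: (@homotopy_retract_strict _ _ (CMap uc) (CMap vc)).
Qed.
End ConeIn.

Lemma gid_inj X i j : i = j -> forall x, gid X j i (gid X i j x) = x.
Proof. by move=> <- x; rewrite !gidE. Qed.

Lemma homotopy_retract_shift X n : homotopy_retract X (shift (shift X n) (- n)).
Proof.
have e i : i - n + n = i by rewrite subrK.
have dE i j x : cx_d (shift (shift X n) (- n)) i j x = cx_d X (i - n + n) (j - n + n) x.
  have o : oddz (- n) = oddz n by rewrite /oddz; lia.
  by rewrite !shift_dE o; case: oddz; rewrite ?opprK.
pose u i : {linear X i -> shift (shift X n) (- n) i} := gid X i (i - n + n).
pose v i : {linear shift (shift X n) (- n) i -> X i} := gid X (i - n + n) i.
have uc i j x : u j (cx_d X i j x) = cx_d (shift (shift X n) (- n)) i j (u i x).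
  by rewrite dE /u (gid_d _ (esym (e i)) (esym (e j))).
have vc i j x : v j (cx_d (shift (shift X n) (- n)) i j x) = cx_d X i j (v i x).
  by rewrite dE /v -(gid_d _ (e i) (e j)).
apply: (@homotopy_retract_strict _ _ (CMap uc) (CMap vc)) => i x.
by apply: gid_inj; rewrite e.
Qed.

Lemma thick_unshift (T : complex A -> Prop) X n : thick T -> in_Kb_proj X -> T (shift X n) -> T X.
Proof.
move=> Tt XK TX; apply: (homotopy_retract_thick XK Tt (homotopy_retract_shift X n)).
exact: thick_shift.
Qed.

(** Rotation makes X[1] a homotopy retract of the cone of Y -> cone f. *)
Lemma thick_fst (T : complex A -> Prop) X Y (f : cmap X Y) :
  thick T -> in_Kb_proj X -> T Y -> T (cone f) -> T X.
Proof.
move=> Tt XK TY TC; apply: (thick_unshift (n := 1) Tt XK).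
apply: (homotopy_retract_thick (shift_Kb 1 XK) Tt (homotopy_retract_shift_cone f)).
exact: thick_cone.
Qed.

Definition zero_cmap X Y : cmap X Y.
Proof. by exists (fun i => zero_lin (X i) (Y i)) => i j x; rewrite linear0. Defined.

(** The sum X + Y is the cone of the zero map X[-1] -> Y. *)
Lemma thick_sum (T : complex A -> Prop) X Y : thick T -> T X -> T Y -> T (cx_sum X Y).
Proof.
move=> Tt TX TY; have K := cx_sum_Kb (thick_Kb Tt TX) (thick_Kb Tt TY).
pose Z := cone (zero_cmap (shift X (- 1)) Y).
have TZ : T Z by apply: (thick_cone Tt) => //; exact: thick_shift.
apply: (homotopy_retract_thick K Tt) TZ.
have e (i : int) : i + 1 - 1 = i by rewrite addrK.
pose u i : {linear cx_sum X Y i -> Z i} :=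
  pair_lin (lcomp (gid X i (i + 1 - 1)) (fst_lin (X i) (Y i))) (snd_lin (X i) (Y i)).
pose v i : {linear Z i -> cx_sum X Y i} :=
  pair_lin (lcomp (gid X (i + 1 - 1) i) (fst_lin (X (i + 1 - 1)) (Y i)))
           (snd_lin (X (i + 1 - 1)) (Y i)).
have ext_van i j x : cmap_ext (zero_cmap (shift X (- 1)) Y) i j x = 0.
  case: (eqVneq i j) => [<-|ij]; last exact: cmap_ext_off.
  by rewrite cmap_ext_diag.
have dE i j z : cx_d Z i j z = (cx_d X (i + 1 - 1) (j + 1 - 1) z.1, cx_d Y i j z.2).
  by rewrite /Z cone_dE ext_van add0r shift_dE /= opprK.
have uc i j x : u j (cx_d (cx_sum X Y) i j x) = cx_d Z i j (u i x).
  rewrite dE cx_sum_dE /u /= /pair_lin_fun /=.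
  by rewrite (gid_d _ (esym (e i)) (esym (e j))).
have vc i j x : v j (cx_d Z i j x) = cx_d (cx_sum X Y) i j (v i x).
  rewrite dE cx_sum_dE /v /= /pair_lin_fun /=.
  by rewrite -(gid_d _ (e i) (e j)).
apply: (@homotopy_retract_strict _ _ (CMap uc) (CMap vc)) => i [x y].
by rewrite /= /pair_lin_fun /= gid_inj ?e.
Qed.
End Thick.

(** * Generation by left approximations *)

Section Approximations.
Context {k : fieldType} {A : falgType k}.
Implicit Types M N Q : fgmod A.
Implicit Types P R S W X Y Z : complex A.

Lemma ksl_linear N (c : k) : linear (fun x : N => kscale c x).
Proof. by move=> a x y; rewrite kscaleDr kscaleZ. Qed.
Definition ksl N c : {linear N -> N} := mklin (@ksl_linear N c).

(** Finite dimensionality of Hom_A(M, N): ev lists the values on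
    generators, and a linear relation between such lists holds between the
    maps. *)
Lemma lin_coord M N : exists m (ev : {linear M -> N} -> 'rV[k]_m),
  forall n (c : 'I_n -> k) (F : 'I_n -> {linear M -> N}) f,
  ev f = \sum_a c a *: ev (F a) -> forall x, f x = \sum_a kscale (c a) (F a x).
Proof.
have [l [e eP]] := fgmod_fin_gen M; have [p [q [pq qp]]] := kcoord N.
exists (l * kdim N)%N, (fun f => mxvec (\matrix_(i, j) q (f (e i)) 0 j)).
move=> n c F f; rewrite (_ : \sum_a _ = mxvec (\sum_a c a *: \matrix_(i, j) q (F a (e i)) 0 j));
  last by rewrite linear_sum; apply: eq_bigr => a _; rewrite linearZ.
move=> /(can_inj mxvecK) E.
have Ee i : f (e i) = \sum_a kscale (c a) (F a (e i)).
  apply: (can_inj qp); rewrite linear_sum; apply/rowP => j.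
  have := congr1 (fun B : 'M_(_, _) => B i j) E; rewrite mxE => ->.
  rewrite !summxE; apply: eq_bigr => a _.
  have -> : q (kscale (c a) (F a (e i))) = c a *: q (F a (e i)) by rewrite -linearZ.
  by rewrite !mxE.
move=> x; have [a ->] := eP x; rewrite linear_sum.
under eq_bigr => i _ do rewrite linearZ /= Ee scaler_sumr.
rewrite exchange_big; apply: eq_bigr => b _ /=.
rewrite linear_sum -[kscale _ _]/(ksl N (c b) _) linear_sum; apply: eq_bigr => i _.
by rewrite linearZ /= kscaleZ.
Qed.

Definition cmap_sub X Y (f g : cmap X Y) : cmap X Y.
Proof.
by exists (fun i => sub_lin (f i) (g i)) => i j x; rewrite /= !cmap_comm linearB.
Defined.
Definition cmap_scale X Y (c : k) (f : cmap X Y) : cmap X Y.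
Proof.
by exists (fun i => lcomp (ksl (Y i) c) (f i)) => i j x; rewrite /= cmap_comm kscale_lin.
Defined.
Definition cmap_pair X Y Z (f : cmap X Y) (g : cmap X Z) : cmap X (cx_sum Y Z).
Proof.
exists (fun i => pair_lin (f i) (g i) : {linear X i -> cx_sum Y Z i}) => i j x.
by rewrite /= /pair_lin_fun /= !cmap_comm.
Defined.
Definition cmap_copair X Y Z (f : cmap X Z) (g : cmap Y Z) : cmap (cx_sum X Y) Z.
Proof.
exists (fun i => copair (f i) (g i) : {linear cx_sum X Y i -> Z i}) => i j x.
by rewrite /= !cmap_comm linearD.
Defined.

Inductive copies S : complex A -> Prop :=
| copies0 : copies S (stalk zeromod)
| copiesS W : copies S W -> copies S (cx_sum S W).

Definition id_cmap X : cmap X X.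
Proof. by exists (fun i => idlin (X i)). Defined.

Lemma left_approx_enlarge X S W (phi : cmap X W) m (psi : 'I_m -> cmap X S) : copies S W ->
  exists W' (phi' : cmap X W'), copies S W' /\
   forall (u : cmap W S) (c : 'I_m -> k), exists u' : cmap W' S, forall i x,
     u' i (phi' i x) = u i (phi i x) + \sum_a kscale (c a) (psi a i x).
Proof.
elim: m psi => [|m IH] psi aW.
  by exists W, phi; split=> // u c; exists u => i x; rewrite big_ord0 addr0.
have [W' [phi' [aW' H]]] := IH (fun a => psi (lift ord0 a)) aW.
exists (cx_sum S W'), (cmap_pair (psi ord0) phi'); split; first exact: copiesS.
move=> u c; have [u' u'E] := H u (fun a => c (lift ord0 a)).
exists (cmap_copair (cmap_scale (c ord0) (id_cmap S)) u') => i x.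
by rewrite /= u'E big_ord_recl /= addrCA.
Qed.

(** The complex W is built degree by degree, so that every psi agrees below
    i0 with a map through W. The differences vanish below i0, and their
    components in degree i0 span a finite dimensional space, so that one
    more copy of S for each member of a finite spanning family reaches
    degree i0. *)
Lemma left_approx_ex X S : in_Kb_proj X -> exists W (phi : cmap X W), copies S W /\
  forall psi : cmap X S, exists u : cmap W S, forall i x, psi i x = u i (phi i x).
Proof.
move=> [[b Xb] _].
suff H r : exists W (phi : cmap X W), copies S W /\
   forall psi : cmap X S, exists u : cmap W S, forall i, - b%:Z <= i < - b%:Z + r%:Z ->
    forall x, psi i x = u i (phi i x).
  have [W [phi [aW P]]] := H (2 * b).+1; exists W, phi; split=> // psi.
  have [u uP] := P psi; exists u => i x; case: (ltnP b `|i|%N) => bi.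
    by rewrite (Xb i bi x) !linear0.
  by apply: uP; lia.
elim: r => [|r [W [phi [aW IH]]]].
  exists (stalk zeromod), (zero_cmap _ _); split; first exact: copies0.
  by move=> psi; exists (zero_cmap _ _) => i; lia.
pose i0 := - b%:Z + r%:Z.
have [m [ev evP]] := lin_coord (X i0) (S i0).
have [l [B [BD BS]]] := span_fin (fun v => exists psi : cmap X S,
  (forall i, - b%:Z <= i < i0 -> forall x, psi i x = 0) /\ v = ev (psi i0)).
have fB a : {psi : cmap X S | (forall i, - b%:Z <= i < i0 -> forall x, psi i x = 0) /\
   row a B = ev (psi i0)} by apply/cid/BD.
have [W' [phi' [aW' H]]] := left_approx_enlarge phi (fun a => sval (fB a)) aW.
exists W', phi'; split=> // psi; have [u uE] := IH psi.
pose psi1 := cmap_sub psi (CMap (fun i j x => etrans (congr1 _ (cmap_comm phi j x)) (cmap_comm u j (phi i x))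
   : lcomp (u j) (phi j) (cx_d X i j x) = cx_d S i j (lcomp (u i) (phi i) x))).
have psi10 i : - b%:Z <= i < i0 -> forall x, psi1 i x = 0.
  by move=> ib x; rewrite /= uE // subrr.
have /submxP[w wE] : (ev (psi1 i0) <= B)%MS by apply: BS; exists psi1.
have [u' u'E] := H u (fun a => w 0 a); exists u' => i ib x; rewrite u'E.
case: (eqVneq i i0) => [?|ne]; last first.
  have ib' : - b%:Z <= i < i0 by rewrite /i0; lia.
  rewrite -uE // big1 ?addr0 // => a _.
  by rewrite (svalP (fB a)).1 // /kscale scaler0.
subst i; rewrite -(evP l (fun a => w 0 a) (fun a => sval (fB a) i0) (psi1 i0)).
  by rewrite /= addrC subrK.
rewrite wE mulmx_sum_row; apply: eq_bigr => a _.
by congr (_ *: _); exact: (svalP (fB a)).2.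
Qed.

Lemma hom_van_sum_l X Y Z n : hom_van X Z n -> hom_van Y Z n -> hom_van (cx_sum X Y) Z n.
Proof.
move=> HX HY f fc.
have fE i j x y : f i j (x, y) = f i j (x, 0) + f i j (0, y).
  by rewrite -linearD; congr (f i j _); congr (_, _); rewrite /= ?addr0 ?add0r.
have [|h hP] := HX (fun i j => lcomp (f i j) (inl_lin (X i) (Y i))).
  move=> i j i' j' e1 e2 e3 x; rewrite /= -(fc i j i' j') //; congr (f _ _ _).
  by rewrite /= /pair_lin_fun /= linear0.
have [|h' hP'] := HY (fun i j => lcomp (f i j) (inr_lin (X i) (Y i))).
  move=> i j i' j' e1 e2 e3 x; rewrite /= -(fc i j i' j') //; congr (f _ _ _).
  by rewrite /= /pair_lin_fun /= linear0.
exists (fun i j => copair (h i j) (h' i j)) => i i' j' j e1 e2 e3 [x y].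
have := hP i i' j' j e1 e2 e3 x; have := hP' i i' j' j e1 e2 e3 y.
rewrite /= /pair_lin_fun /= => E2 E1; rewrite fE E1 E2.
by rewrite linearD addrACA.
Qed.

Lemma copies_hom_van_l S W Z n : copies S W -> hom_van S Z n -> hom_van W Z n.
Proof.
move=> aW HS; elim: aW => [|W' _ IH]; last exact: hom_van_sum_l.
by apply: hom_van_zero => i; left; rewrite /= /stalk_obj; case: (i == 0); exact: zeromod0.
Qed.
Lemma copies_hom_van_r S W Z n : copies S W -> hom_van Z S n -> hom_van Z W n.
Proof.
move=> aW HS; elim: aW => [|W' _ IH]; last exact: hom_van_sum.
by apply: hom_van_zero => i; right; rewrite /= /stalk_obj; case: (_ == 0); exact: zeromod0.
Qed.
Lemma copies_thick S W (T : complex A -> Prop) : thick T -> copies S W -> T S -> T W.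
Proof.
by move=> Tt aW TS; elim: aW => [|W' _ IH]; [exact: thick_zero | exact: thick_sum].
Qed.

(** Apply Hom(-, S[n]) to the triangle of phi. For n > 1 the term Hom(X,
    S[n-1]) vanishes; for n = 1 the map Hom(W, S) -> Hom(X, S) is onto,
    which is the approximation property. *)
Lemma hom_van_cone_approx X S W (phi : cmap X W) : copies S W ->
  (forall psi : cmap X S, exists u : cmap W S, forall i x, psi i x = u i (phi i x)) ->
  (forall n, 0 < n -> hom_van S S n) -> (forall n, 0 < n -> hom_van X S n) ->
  forall n, 0 < n -> hom_van (cone phi) S n.
Proof.
move=> aW ap SS XS n n0; apply: (hom_van_cone_from (m := n - 1)); first by rewrite subrK.
  exact: copies_hom_van_l (SS n n0).
case: (eqVneq n 1) => [n1 a aa|n1 a aa]; last first.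
  have [|s sP] := hom_van_anti (n := n - 1) _ aa; first by apply: XS; lia.
  exists s, (fun _ _ => zero_lin _ _); split; first by move=> i j i' j' _ _ _ x; rewrite linear0 oppr0.
  by move=> i i' j' j e1 e2 e3 x; rewrite addr0; exact: sP.
have {}aa : ganti 0 a by move: aa; rewrite n1.
have pc i j x : sgl (oddz j) (a j j) (cx_d X i j x) = cx_d S i j (sgl (oddz i) (a i i) x).
  case: (eqVneq j (i + 1)) => [->|ij]; last by rewrite !cx_shape ?linear0.
  rewrite !sglE oddz1 (aa i i (i + 1) (i + 1)) ?addr0 //.
  by case: oddz; rewrite /= ?opprK ?linearN.
have [u uE] := ap (CMap pc).
exists (fun _ _ => zero_lin _ _), (fun i j => sgl (oddz i) (cmap_ext u i j)); split.
  move=> i j i' j' e1 e2 e3 x; subst i'; have e : i = j by lia.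
  clear e1; subst j; subst j'; rewrite !sglE oddz1 !cmap_ext_diag cmap_comm.
  by case: oddz; rewrite /= ?opprK ?linearN ?opprK.
move=> i i' j' j e1 e2 e3 x; have e : i = j by lia.
clear e1 e3; subst j; rewrite !linear0 ?subrr !add0r !sglE cmap_ext_diag -uE /= sglE.
by case: oddz; rewrite /= ?opprK.
Qed.

(** The homotopy is built upwards in the degree c of X: the defect of the
    components found so far is a cocycle Y (c - n) -> X c. *)
Lemma coh_van_hom_van Y X n (c0 c1 : int) : (forall j, j < c0 -> is_zero (X j)) ->
  (forall j, c1 < j -> is_zero (X j)) -> (forall c, coh_van Y (X c) (c - n)) -> hom_van Y X n.
Proof.
move=> X0 X1 H f fc.
suff K m : exists h, forall i, i + n < c0 + m%:Z -> gnull_at n f h i.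
  have [h hP] := K `|c1 - c0|%N.+1; exists h => i; case: (lerP (i + n) c1) => ic.
    by apply: hP; lia.
  by move=> i' j' j e1 e2 e3 x; rewrite [LHS](X1 j) ?[RHS](X1 j) //; lia.
elim: m => [|m [h hP]].
  exists (fun _ _ => zero_lin _ _) => i ic i' j' j e1 e2 e3 x.
  by rewrite [LHS](X0 j) ?[RHS](X0 j) //; lia.
pose j0 := c0 + m%:Z; pose i0 := j0 - n.
have e0 : i0 + n = j0 by rewrite subrK.
have [|g gE] := H j0 (i0 - 1) (i0 + 1) (subrK _ _) erefl
   (sub_lin (f i0 j0) (lcomp (cx_d X (j0 - 1) j0) (h i0 (j0 - 1)))).
  move=> x; have e1 : i0 - 1 + n = j0 - 1 by lia.
  have e2 : i0 - 1 + 1 = i0 by rewrite subrK.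
  have e3 : j0 - 1 + 1 = j0 by rewrite subrK.
  rewrite /= (fc (i0 - 1) (j0 - 1) i0 j0 e1 e2 e3).
  have lt : i0 - 1 + n < c0 + m%:Z by rewrite e1 /j0; lia.
  rewrite (hP _ lt i0 (j0 - 1 - 1) (j0 - 1) e1 e2 (subrK _ _)).
  by rewrite linearD /= cx_dd add0r subrr.
exists (gupd h g) => i ic i' j' j e1 e2 e3 x; case: (eqVneq i i0) => [?|ne].
  subst i; have ej : j = j0 by lia.
  have ej' : j' = j0 - 1 by lia.
  clear e1 e3; subst j; subst j'; subst i'.
  rewrite gupdE -gE gupd_other; last by lia.
  rewrite -[sub_lin _ _ x]/(f i0 j0 x - cx_d X (j0 - 1) j0 (h i0 (j0 - 1) x)).
  by rewrite addrCA subrr addr0.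
have lt : i + n < c0 + m%:Z by rewrite /i0 /j0 in ne; lia.
by rewrite !gupd_other; [exact: hP | rewrite /i0 /j0 in ne *; lia..].
Qed.

(** Let X -> W be a left add S-approximation. Its cone again has no maps to
    S[n] for n > 0, and Hom(Y, cone[r+1]) = 0 since Hom(Y, W[r+1]) and
    Hom(Y, X[r+2]) vanish; so r drops by one. For r = 0 the connecting map
    from the cone to X[1] is null, and X is a homotopy retract of W. *)
Lemma generation S (T : complex A -> Prop) : thick T -> T S ->
  (forall n, 0 < n -> hom_van S S n) -> forall r X, in_Kb_proj X ->
  (forall n, 0 < n -> hom_van X S n) ->
  (forall Y, in_Kb_proj Y -> (forall n, 0 < n -> hom_van Y S n) -> hom_van Y X r.+1%:Z) -> T X.
Proof.
move=> Tt TS SS; elim=> [|r IH] X XK XS H;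
  have [W [phi [aW ap]]] := left_approx_ex S XK;
  have TW := copies_thick Tt aW TS; have CK := cone_Kb phi XK (thick_Kb Tt TW);
  have CS := hom_van_cone_approx aW ap SS XS.
  exact: (homotopy_retract_thick XK Tt (hom_van_conn (H _ CK CS)) TW).
apply: (thick_fst (f := phi) Tt XK TW); apply: IH => // Y YK YS.
apply: hom_van_cone_into; last by apply: copies_hom_van_r aW (YS _ _); lia.
by have := H Y YK YS; rewrite (_ : r.+1%:Z + 1 = r.+2%:Z) //; lia.
Qed.
End Approximations.

Theorem theorem1p3 (d : nat) (d_gt0 : (1 <= d)%N)
    (k : fieldType) (A : falgType k)
    (M U : fgmod A -> Prop)
    (M_ct : cluster_tilting d M)
    (U_tors : torsion_class d M U)
    (U_ff : functorially_finite U)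
    (MU : fgmod A)
    (MU_basic : basic MU)
    (MU_gen : ext_projective_generator d U MU)
    (PU : fgmod A)
    (PU_max : maximal_basic_proj_perp U PU)
    (P : complex A) (eps : {linear P 0 -> MU})
    (P_min : min_proj_resolution eps) :
  silting (cx_sum (trunc (- (d%:Z)) P) (shift (stalk PU) d%:Z)).
Proof.
have U_cov : covariantly_finite U by case: U_ff.
have Sh := silt_hom_van d_gt0 M_ct U_tors U_cov MU_gen PU_max P_min.
split; first exact: (silt_Kb d_gt0 PU_max P_min).
- by move=> n n0; exact: (hom_van_shift (Sh n n0)).
move=> T Tt TS X XK; have [[b Xb] Xp] := XK.
(* In degrees 0 to 2 b, the shifted complex has no maps to S[n] for n > 0,
   because S sits in degrees at most 0. If Hom(Y, -) has no cohomology
   below degree -d, then there are no maps from Y to its shift by n once n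
   > d + 2 b. *)
apply: (thick_unshift (n := - b%:Z) Tt XK).
have X'K := shift_Kb (- b%:Z) XK.
have X'0 j : j < 0 -> is_zero (shift X (- b%:Z) j) by move=> j0; apply: Xb; lia.
have X'1 j : (2 * b)%N%:Z < j -> is_zero (shift X (- b%:Z) j) by move=> j0; apply: Xb; lia.
apply: (generation Tt TS Sh (r := (d + 2 * b)%N) X'K).
  move=> n n0; apply: hom_van_zero => i; case: (ltrP i 0) => i0; first by left; exact: X'0.
  by right; apply: (silt_high d_gt0 P_min); lia.
move=> Y YK YS; apply: (coh_van_hom_van X'0 X'1) => c.
have [Z _ _] := coh_van_add Y (c - (d + 2 * b).+1%:Z).
case: (ltrP c 0) => c0; first exact/Z/X'0.
case: (ltrP (2 * b)%N%:Z c) => c1; first exact/Z/X'1.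
have -> : c - (d + 2 * b).+1%:Z = - ((d + 2 * b).+1 - `|c|)%N%:Z by lia.
by apply: (silt_coh d_gt0 M_ct U_tors U_cov MU_gen PU_max P_min YK YS); lia.
Qed.
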